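(* Let $f:\mathbb R\to\mathbb C$ be a continuous function with $f(0)=1$ and $f(t)\neq 0$ for all $t\in\mathbb R$. (a) Suppose that $$f(t)=\exp\biggl\{it\gamma+\int_{\mathbb R}\bigl(e^{itx}-1-it\sin(x)\bigr)\tfrac{1+x^2}{x^2}\,dG(x)\biggr\},\quad t\in\mathbb R,$$ with some $\gamma\in\mathbb R$ and some $G\in\boldsymbol V$ (for instance, $f$ is the characteristic function of some distribution function $F\in\boldsymbol Q$) satisfying $$\int_{\mathbb R}(1+x^2)\,d|G|(x)<\infty.$$ Then for any $t\in\mathbb R$ the second derivative $(\mathrm{Ln} f)''(t)$ exists and $$(\mathrm{Ln} f)''(t)=-\int_{\mathbb R}e^{itx}(1+x^2)\,dG(x),\quad t\in\mathbb R.$$ (b) Suppose that the formula $$(\mathrm{Ln} f)''(t)=-\int_{\mathbb R}e^{itx}(1+x^2)\,dG(x),\quad t\in\mathbb R,$$ holds with some function $G\in\boldsymbol V$ satisfying $\int_{\mathbb R}(1+x^2)\,d|G|(x)<\infty$. Then, with this function $G$ and with $\gamma=\mathrm{Arg} f(1)$, $$f(t)=\exp\biggl\{it\gamma+\int_{\mathbb R}\bigl(e^{itx}-1-it\sin(x)\bigr)\tfrac{1+x^2}{x^2}\,dG(x)\biggr\},\quad t\in\mathbb R.$$ If it is additionally known that $f$ is the characteristic function of some distribution function $F$, then $F\in\boldsymbol Q$.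
   Context: For continuous $f:\mathbb R\to\mathbb C$ with $f(0)=1$ and $f(t)\ne0$ for all $t$, the distinguished logarithm is $\mathrm{Ln} f(t)=\ln|f(t)|+i\,\mathrm{Arg} f(t)$, $t\in\mathbb R$, where $\mathrm{Arg} f$ is the unique continuous argument of $f$ on $\mathbb R$ with $\mathrm{Arg} f(0)=0$. $\boldsymbol V$ is the class of all functions $G:\mathbb R\to\mathbb R$ of bounded variation on $\mathbb R$ that are right-continuous at every point and satisfy $G(-\infty)=0$. For $G\in\boldsymbol V$, $|G|(x)$ denotes the total variation of $G$ on $(-\infty,x]$. Integrals with respect to $dG$ and $d|G|$ are Lebesgue–Stieltjes integrals. At $x=0$ the integrand $\bigl(e^{itx}-1-it\sin(x)\bigr)\frac{1+x^2}{x^2}$ is defined by continuity as $-\frac{t^2}{2}$. The characteristic function of a distribution function $F$ on $\mathbb R$ is $f(t)=\int_{\mathbb R}e^{itx}\,dF(x)$. $F$ is infinitely divisible if for every positive integer $n$ there is a distribution function $F_{1/n}$ whose $n$-fold convolution power is $F$. $\boldsymbol Q$ is the class of rational-infinitely divisible distribution functions, i.e. distribution functions $F$ for which there exist infinitely divisible distribution functions $F_1,F_2$ with $F_1=F*F_2$ (convolution).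
   Formalization: In (b), the representation of f is proved under the added hypothesis that f(-t) is the complex conjugate of f(t) for all t; without it the claim fails (f(t)=e^t, G=0), and every f with the representation satisfies it. *)

(* Defs.v *)
From HB Require Import structures.
From mathcomp Require Import all_boot all_order all_algebra.
From mathcomp Require Import all_classical all_reals all_analysis.
From mathcomp Require Export complex.

Set Implicit Arguments.
Unset Strict Implicit.
Unset Printing Implicit Defensive.

Import Order.TTheory GRing.Theory Num.Theory.
Import numFieldNormedType.Exports.

Local Open Scope classical_set_scope.
Local Open Scope ring_scope.

(* The complex numbers are [Rcomplex R]: the library already makes it a field,
   an R-module and an R-normed group for the modulus.  The instances below add
   the topology of the modulus, which makes it a normed R-module, so that
   [continuous], [derivable] and [derive1] apply to functions R -> C. *)
Section Rcomplex_normedModType.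
Variable R : realType.

Let Rcomplex_normrZ (a : R) (z : Rcomplex R) : `|a *: z| = `|a| * `|z|.
Proof.
case: z => x y; rewrite /Num.norm /= /Normc.normc /=.
rewrite 2!exprMn -mulrDr sqrtrM ?sqr_ge0//; congr (_ * _).
exact: sqrtr_sqr.
Qed.

HB.instance Definition _ :=
  PseudoMetric.copy (Rcomplex R) (pseudoMetric_normed (Rcomplex R)).
HB.instance Definition _ := isPointed.Build (Rcomplex R) 0.
HB.instance Definition _ :=
  NormedZmod_PseudoMetric_eq.Build R (Rcomplex R) erefl.
HB.instance Definition _ :=
  PseudoMetricNormedZmod_Lmodule_isNormedModule.Build R (Rcomplex R)
    Rcomplex_normrZ.

End Rcomplex_normedModType.

Section complex_functions.
Variable R : realType.
Local Notation C := (Rcomplex R).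

Definition imag (x : R) : C := Complex 0 x.

Definition expi (x : R) : C := Complex (cos x) (sin x).

Definition cexp (z : C) : C := expR (complex.Re z) *: expi (complex.Im z).

Definition cintegral d (T : measurableType d) (mu : {measure set T -> \bar R})
    (h : T -> C) : C :=
  Complex (Rintegral mu setT (fun x => complex.Re (h x)))
          (Rintegral mu setT (fun x => complex.Im (h x))).

Definition has_second_derivative (g : R -> C) (t : R) (l : C) : Prop :=
  [/\ \forall s \near t, derivable g s 1,
      derivable (derive1 g) t 1 &
      derive1n 2 g t = l].

Definition is_Arg (f : R -> C) (phi : R -> R) : Prop :=
  [/\ continuous phi, phi 0 = 0 & forall t, f t = `|f t| *: expi (phi t)].

(* For f continuous and nowhere zero with f 0 = 1, [is_Arg f] has exactly one
   solution; otherwise the default value is irrelevant. *)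
Definition Arg (f : R -> C) : R -> R := xget (fun=> 0) [set phi | is_Arg f phi].

Definition Ln (f : R -> C) (t : R) : C := Complex (ln `|f t|) (Arg f t).

End complex_functions.

Section bounded_variation_class.
Variable R : realType.

Definition bounded_variationT (G : R -> R) : Prop :=
  exists M : R, forall a b, a <= b -> (total_variation a b G <= M%:E)%E.

Definition V_axiom (G : R -> R) : Prop :=
  [/\ bounded_variationT G,
      forall x, G @ x^'+ --> G x &
      G @ -oo --> 0].

Record bvT := BvT { bvT_fun :> R -> R ; bvTP : V_axiom bvT_fun }.

(* |G|(x), the total variation of G on ]-oo, x] *)
Definition var (G : R -> R) (x : R) : R :=
  fine (ereal_sup [set total_variation a x G | a in [set a | a <= x]]).

Definition pos_var (G : R -> R) (x : R) : R := (var G x + G x) / 2.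
Definition neg_var (G : R -> R) (x : R) : R := (var G x - G x) / 2.

Section var_theory.
Variable G : bvT.

Let TV_fin a b : a <= b -> total_variation a b G \is a fin_num.
Proof.
move=> ab; have [[M GM] _ _] := bvTP G.
rewrite ge0_fin_numE ?total_variation_ge0//.
by rewrite (le_lt_trans (GM _ _ ab))// ltry.
Qed.

Let evar (x : R) : \bar R :=
  ereal_sup [set total_variation a x G | a in [set a | a <= x]].

Let evar_ge0 x : (0 <= evar x)%E.
Proof.
apply: ereal_sup_ubound; exists x => //=; exact: total_variationxx.
Qed.

Let evar_fin x : evar x \is a fin_num.
Proof.
have [[M GM] _ _] := bvTP G.
rewrite ge0_fin_numE ?evar_ge0// (@le_lt_trans _ _ M%:E) ?ltry//.
by apply: ge_ereal_sup => _ [a /= ax <-]; exact: GM.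
Qed.

Lemma varD x y : x <= y -> var G y = var G x + fine (total_variation x y G).
Proof.
move=> xy; rewrite /var -/(evar x) -/(evar y) -fineD ?evar_fin ?TV_fin//.
congr fine; apply/eqP; rewrite eq_le; apply/andP; split.
  apply: ge_ereal_sup => _ [a /= ay <-].
  have [ax|xa] := leP a x.
    rewrite (total_variationD G ax xy) leeD2r//.
    by apply: ereal_sup_ubound; exists a.
  rewrite (total_variationD G (ltW xa) ay) addeA leeDr//.
  by rewrite adde_ge0 ?evar_ge0 ?total_variation_ge0// ltW.
rewrite -leeBrDr ?TV_fin//; apply: ge_ereal_sup => _ [a /= ax <-].
rewrite leeBrDr ?TV_fin// -(total_variationD G ax xy).
by apply: ereal_sup_ubound; exists a => //=; exact: le_trans ax xy.
Qed.

Let incr_le x y : x <= y -> `|G y - G x| <= fine (total_variation x y G).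
Proof.
by move=> xy; rewrite -lee_fin fineK ?TV_fin//; exact: total_variation_ge.
Qed.

Lemma var_nd : nondecreasing (var G).
Proof.
move=> x y xy; rewrite (varD xy) lerDl.
exact: le_trans (normr_ge0 _) (incr_le xy).
Qed.

Lemma pos_var_nd : nondecreasing (pos_var G).
Proof.
move=> x y xy; rewrite /pos_var ler_pM2r ?invr_gt0// (varD xy) -addrA lerD2l.
rewrite -lerBlDr; apply: le_trans (incr_le xy).
by rewrite -normrN opprB ler_norm.
Qed.

Lemma neg_var_nd : nondecreasing (neg_var G).
Proof.
move=> x y xy; rewrite /neg_var ler_pM2r ?invr_gt0// (varD xy) -addrA lerD2l.
by rewrite lerBrDr addrC; apply: le_trans (incr_le xy); exact: ler_norm.
Qed.

Lemma var_rc : right_continuous (var G).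
Proof.
move=> x; have [_ Grc _] := bvTP G.
have xx1 : x < x + 1 by rewrite ltrDl.
have H : (fun y => var G x + fine (total_variation x y G)) y @[y --> x^'+]
    --> var G x + fine (total_variation x x G).
  apply: cvgD; first exact: cvg_cst.
  apply: (total_variation_right_continuous (lexx x) xx1 (Grc x)).
  exact/(bounded_variationP _ (ltW xx1))/TV_fin/ltW.
rewrite -varD// in H; apply: cvg_trans H; apply: near_eq_cvg.
near=> y; rewrite (@varD x y)//.
Unshelve. all: by end_near. Qed.

Lemma pos_var_rc : right_continuous (pos_var G).
Proof.
move=> x; have [_ Grc _] := bvTP G.
by apply: cvgMr_tmp; apply: cvgD; [exact: var_rc|exact: Grc].
Qed.

Lemma neg_var_rc : right_continuous (neg_var G).
Proof.
move=> x; have [_ Grc _] := bvTP G.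
by apply: cvgMr_tmp; apply: cvgB; [exact: var_rc|exact: Grc].
Qed.

HB.instance Definition _ := isCumulative.Build R _ R (var G) var_nd var_rc.
HB.instance Definition _ :=
  isCumulative.Build R _ R (pos_var G) pos_var_nd pos_var_rc.
HB.instance Definition _ :=
  isCumulative.Build R _ R (neg_var G) neg_var_nd neg_var_rc.

End var_theory.

(* The Lebesgue-Stieltjes integral of h with respect to dG, through the Jordan
   decomposition G = pos_var G - neg_var G. *)
Definition LSintegral (G : bvT) (h : R -> Rcomplex R) : Rcomplex R :=
  cintegral (lebesgue_stieltjes_measure (pos_var G)) h -
  cintegral (lebesgue_stieltjes_measure (neg_var G)) h.

Definition finite_second_moment (G : bvT) : Prop :=
  (\int[lebesgue_stieltjes_measure (var G)]_x (1 + x ^+ 2)%:E < +oo)%E.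

(* At x = 0 the value is the limit as x -> 0. *)
Definition LK_integrand (t x : R) : Rcomplex R :=
  if x == 0 then Complex (- (t ^+ 2 / 2)) 0
  else ((1 + x ^+ 2) / x ^+ 2) *: (expi (t * x) - 1 - imag (t * sin x)).

Definition LK_exp (gamma : R) (G : bvT) (t : R) : Rcomplex R :=
  cexp (imag (t * gamma) + LSintegral G (LK_integrand t)).

End bounded_variation_class.

Section distribution_functions.
Variable R : realType.

Definition distribution_function := cumulativeBounded (0 : R) (1 : R).
Identity Coercion distribution_function_cumulativeBounded :
  distribution_function >-> cumulativeBounded.

Definition char_fun (F : distribution_function) (t : R) : Rcomplex R :=
  cintegral (lebesgue_stieltjes_measure F) (fun x => expi (t * x)).

Definition convolution (A : R -> R) (B : distribution_function) (x : R) : R :=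
  Rintegral (lebesgue_stieltjes_measure B) setT (fun y => A (x - y)).

(* n-fold convolution power, for n > 0 *)
Definition convolution_power (n : nat) (F : distribution_function) : R -> R :=
  iter n.-1 (fun A => convolution A F) F.

Definition infinitely_divisible (F : distribution_function) : Prop :=
  forall n, (0 < n)%N -> exists Fn : distribution_function,
    convolution_power n Fn = F :> (R -> R).

Definition rational_infinitely_divisible (F : distribution_function) : Prop :=
  exists F1 F2 : distribution_function,
    [/\ infinitely_divisible F1, infinitely_divisible F2 &
        F1 = convolution F F2 :> (R -> R)].

End distribution_functions.

(* Main.v *)
Require Import Defs.
From HB Require Import structures.
From mathcomp Require Import all_boot all_order all_algebra.
From mathcomp Require Import all_classical all_reals all_analysis.
From mathcomp Require Import measurable_realfun ring lra.
Import Order.TTheory GRing.Theory Num.Theory.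
Import numFieldNormedType.Exports.
Local Open Scope classical_set_scope.
Local Open Scope ring_scope.

Set Implicit Arguments.
Unset Strict Implicit.
Unset Printing Implicit Defensive.

(** Part (a) and the first half of (b) are calculus.  The integrand and its first
    two derivatives in t are dominated by 1 + x^2, up to a factor that depends on
    t alone, and the second derivative is - (1 + x^2) e^{itx}; under the moment
    hypothesis the exponent can therefore be differentiated twice under the
    integral, against each Jordan component of dG ([is_derive_LKint],
    [is_derive_LKint']).  If f = exp psi with psi continuous and psi 0 = 0, then
    the imaginary part of psi is a continuous argument of f vanishing at 0, so
    that Ln f = psi ([Ln_eq]); existence of the argument is obtained by adding up
    the principal arguments of the small increments of f / |f| ([local_lift]).
    Conversely, Ln f and the exponent have the same second derivative and both
    vanish at 0, hence differ by t c ([second_derivative_unique]).  Hermitian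
    symmetry makes c imaginary, and at t = 1 the centering t sin x makes the
    integral real ([Im_LKint1]), whence c = i Arg f 1.

    For the last claim, laws F1 and F2 have to be found whose exponents are the
    integrals against the positive and the negative variation of G.  This is the
    existence half of the Levy-Khintchine theorem, usually derived from the
    continuity theorem for characteristic functions.  Here both laws are given in
    addition the same Gaussian component, which makes everything absolutely
    integrable.  Write gw tau for t |-> expR (- (tau t)^2 / 2).  The Fourier
    integral of phi * gw tau can be inverted by mollification
    ([gauss_fourier_inversion]), so for continuous hermitian phi with phi 0 = 1 the
    function phi * gw tau is a characteristic function as soon as this integral is
    nonnegative ([exists_distribution_char_fun]).  Call phi positive ([psd]) when
    the integral is nonnegative.  The constant 1 is positive, and positivity
    survives nonnegative combinations, bounded pointwise limits and products with
    characteristic functions of finite measures, which average translates of the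
    Fourier integral ([psdM_weighted_cf]).  As exp rho is the limit of
    (1 + rho / n)^n, it survives products with exponentials of such functions
    ([psdM_cexp]); this is the compound Poisson case.  The general exponent is a
    limit of that case, by moving the mass near 0 away from 0 ([psd_LK]).

    An n-th root of such a law has the measure, the drift and the Gaussian
    variance divided by n ([infinitely_divisible_LK]).  Finally the common
    Gaussian component cancels in F1 = F * F2: the characteristic functions of
    the two sides agree ([exists_convolution]), and a characteristic function
    determines its law ([char_fun_inj]). *)

(** * Complex numbers by real and imaginary parts *)

Local Notation Re := complex.Re.
Local Notation Im := complex.Im.

Section complex_numbers.
Variable R : realType.
Local Notation C := (Rcomplex R).
Implicit Types (z w : C) (x y a : R).

Lemma complex_ext z w : Re z = Re w -> Im z = Im w -> z = w.
Proof. by case: z w => [a b] [c d] /= -> ->. Qed.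

Lemma ReD z w : Re (z + w) = Re z + Re w. Proof. by case: z w => [? ?] []. Qed.
Lemma ImD z w : Im (z + w) = Im z + Im w. Proof. by case: z w => [? ?] []. Qed.
Lemma ReN z : Re (- z) = - Re z. Proof. by case: z. Qed.
Lemma ImN z : Im (- z) = - Im z. Proof. by case: z. Qed.
Lemma ReB z w : Re (z - w) = Re z - Re w. Proof. by rewrite ReD ReN. Qed.
Lemma ImB z w : Im (z - w) = Im z - Im w. Proof. by rewrite ImD ImN. Qed.
Lemma ReZ a z : Re (a *: z) = a * Re z. Proof. by case: z. Qed.
Lemma ImZ a z : Im (a *: z) = a * Im z. Proof. by case: z. Qed.
Lemma ReM z w : Re (z * w) = Re z * Re w - Im z * Im w.
Proof. by case: z w => [? ?] []. Qed.
Lemma ImM z w : Im (z * w) = Re z * Im w + Im z * Re w.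
Proof. by case: z w => [? ?] []. Qed.
Lemma Re1 : Re (1 : C) = 1. Proof. by []. Qed.
Lemma Im1 : Im (1 : C) = 0. Proof. by []. Qed.
Lemma Re0 : Re (0 : C) = 0. Proof. by []. Qed.
Lemma Im0 : Im (0 : C) = 0. Proof. by []. Qed.
Lemma Re_conj z : Re (conjc z) = Re z. Proof. by case: z. Qed.
Lemma Im_conj z : Im (conjc z) = - Im z. Proof. by case: z. Qed.

Definition ReImE := (ReD, ImD, ReN, ImN, ReZ, ImZ, ReM, ImM, Re1, Im1, Re0, Im0,
  Re_conj, Im_conj).

Lemma conjCB z w :
  conjc (z - w) = conjc z - conjc w :> C.
Proof. by case: z w => [a b] [c d]; apply: complex_ext => //=; rewrite opprD. Qed.

Lemma normC_def z : `|z| = Num.sqrt (Re z ^+ 2 + Im z ^+ 2).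
Proof. by case: z. Qed.

Lemma normC_sqr z : `|z| ^+ 2 = Re z ^+ 2 + Im z ^+ 2.
Proof. by rewrite normC_def sqr_sqrtr// addr_ge0 ?sqr_ge0. Qed.

Lemma normCM z w : `|(z * w : C)| = `|z| * `|w|.
Proof. exact: Normc.normcM. Qed.

Lemma normC1 : `|1 : C| = 1.
Proof. by rewrite normC_def /= expr0n /= addr0 expr1n sqrtr1. Qed.

Lemma normCX z n : `|(z ^+ n : C)| = `|z| ^+ n.
Proof. by elim: n => [|n IH]; rewrite ?expr0 ?normC1// !exprS normCM IH. Qed.

Lemma normC_conj z : `|(conjc z : C)| = `|z|.
Proof. by rewrite !normC_def Re_conj Im_conj sqrrN. Qed.

Lemma Re_le_norm z : `|Re z| <= `|z|.
Proof.
by rewrite normC_def -sqrtr_sqr ler_sqrt ?addr_ge0 ?sqr_ge0// lerDl sqr_ge0.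
Qed.

Lemma Im_le_norm z : `|Im z| <= `|z|.
Proof.
by rewrite normC_def -sqrtr_sqr ler_sqrt ?addr_ge0 ?sqr_ge0// lerDr sqr_ge0.
Qed.

Lemma norm_le_ReIm z : `|z| <= `|Re z| + `|Im z|.
Proof.
rewrite -(@ler_pXn2r _ 2)// ?nnegrE ?addr_ge0//.
rewrite normC_sqr sqrrD !real_normK ?num_real// -addrA lerD2l lerDr.
by rewrite mulrn_wge0// mulr_ge0.
Qed.

Lemma scaleCM a z w : a *: (z * w) = (a *: z) * w.
Proof. by apply: complex_ext; rewrite !ReImE; ring. Qed.

Lemma expiD x y : expi (x + y) = expi x * expi y.
Proof. by apply: complex_ext; rewrite !ReImE /= ?cosD ?sinD //; ring. Qed.

Lemma expi0 : expi (0 : R) = 1.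
Proof. by rewrite /expi cos0 sin0. Qed.

Lemma normC_expi x : `|expi x| = 1.
Proof. by rewrite normC_def /= cos2Dsin2 sqrtr1. Qed.

Lemma conj_expi x : conjc (expi x) = expi (- x).
Proof. by apply: complex_ext; rewrite /= ?cosN ?sinN. Qed.

Lemma cexpD z w : cexp (z + w) = cexp z * cexp w.
Proof.
rewrite /cexp ReD ImD expRD expiD; apply: complex_ext; rewrite !ReImE; ring.
Qed.

Lemma cexp0 : cexp (0 : C) = 1.
Proof. by rewrite /cexp /= expR0 expi0 scale1r. Qed.

Lemma normC_cexp z : `|cexp z| = expR (Re z).
Proof. by rewrite normrZ normC_expi mulr1 gtr0_norm ?expR_gt0. Qed.

Lemma conj_cexp z : conjc (cexp z) = cexp (conjc z).
Proof.
apply: complex_ext; rewrite /cexp !ReImE /= ?Re_conj ?Im_conj ?cosN ?sinN//.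
by rewrite mulrN.
Qed.

Lemma cexpMn n z : cexp (z *+ n) = cexp z ^+ n.
Proof.
by elim: n => [|n IH]; rewrite ?mulr0n ?cexp0// mulrSr exprSr cexpD IH.
Qed.

(** Convergence, continuity and derivability of complex-valued functions are
    handled through real and imaginary parts. *)
Lemma cvgC_ReIm T (F : set_system T) {FF : Filter F} (h : T -> C) (l : C) :
  (fun t => Re (h t)) @ F --> Re l -> (fun t => Im (h t)) @ F --> Im l ->
  h @ F --> l.
Proof.
move=> /cvgrPdist_lt hr /cvgrPdist_lt hi; apply/cvgrPdist_lt => e e0.
have e2 : 0 < e / 2 by rewrite divr_gt0.
near=> t; apply: le_lt_trans (norm_le_ReIm _) _; rewrite ReB ImB (splitr e).
by apply: ltrD; near: t; [exact: hr|exact: hi].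
Unshelve. all: by end_near. Qed.

Lemma cvg_Re T (F : set_system T) {FF : Filter F} (h : T -> C) (l : C) :
  h @ F --> l -> (fun t => Re (h t)) @ F --> Re l.
Proof.
move=> /cvgrPdist_lt hl; apply/cvgrPdist_lt => e e0.
near=> t; rewrite -ReB; apply: le_lt_trans (Re_le_norm _) _.
by near: t; exact: hl.
Unshelve. all: by end_near. Qed.

Lemma cvg_Im T (F : set_system T) {FF : Filter F} (h : T -> C) (l : C) :
  h @ F --> l -> (fun t => Im (h t)) @ F --> Im l.
Proof.
move=> /cvgrPdist_lt hl; apply/cvgrPdist_lt => e e0.
near=> t; rewrite -ImB; apply: le_lt_trans (Im_le_norm _) _.
by near: t; exact: hl.
Unshelve. all: by end_near. Qed.

Lemma cvgC_mul T (F : set_system T) {FF : Filter F}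
  (h k : T -> C) (l m : C) :
  h @ F --> l -> k @ F --> m -> (fun t => h t * k t : C) @ F --> (l * m : C).
Proof.
move=> hl km.
have hr : (fun t => Re (h t)) @ F --> Re l by exact: cvg_Re.
have hi : (fun t => Im (h t)) @ F --> Im l by exact: cvg_Im.
have kr : (fun t => Re (k t)) @ F --> Re m by exact: cvg_Re.
have ki : (fun t => Im (k t)) @ F --> Im m by exact: cvg_Im.
apply: cvgC_ReIm.
  rewrite (_ : (fun t => _) = fun t => Re (h t) * Re (k t) - Im (h t) * Im (k t)).
    by rewrite ReM; apply: cvgB; apply: cvgM.
  by apply/funext => t; rewrite ReM.
rewrite (_ : (fun t => _) = fun t => Re (h t) * Im (k t) + Im (h t) * Re (k t)).
  by rewrite ImM; apply: cvgD; apply: cvgM.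
by apply/funext => t; rewrite ImM.
Qed.

Lemma is_derive_ReIm (h : R -> C) (t : R) (l : C) :
  is_derive t 1 (fun s => Re (h s)) (Re l) ->
  is_derive t 1 (fun s => Im (h s)) (Im l) -> is_derive t 1 h l.
Proof.
move=> [/cvg_ex[a ra] dr] [/cvg_ex[b rb] di].
have ea : a = Re l by rewrite -dr /derive; exact/esym/(cvg_lim (@norm_hausdorff _ _)).
have eb : b = Im l by rewrite -di /derive; exact/esym/(cvg_lim (@norm_hausdorff _ _)).
subst a b.
have H : (fun u : R => u^-1 *: ((h \o shift t) (u *: (1:R)) - h t)) @ 0^' --> l.
  apply: cvgC_ReIm.
    apply: cvg_trans ra; apply: near_eq_cvg; apply: nearW => u /=.
    by rewrite ReZ ReB.
  apply: cvg_trans rb; apply: near_eq_cvg; apply: nearW => u /=.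
  by rewrite ImZ ImB.
by split; [apply/cvg_ex; exists l|rewrite /derive; exact/(cvg_lim (@norm_hausdorff _ _))].
Qed.

Lemma is_derive_Re (h : R -> C) (t : R) (l : C) :
  is_derive t 1 h l -> is_derive t 1 (fun s => Re (h s)) (Re l).
Proof.
move=> [/cvg_ex[a ra] dr].
have ea : a = l by rewrite -dr /derive; exact/esym/(cvg_lim (@norm_hausdorff _ _)).
subst a.
have H : (fun u : R => u^-1 *: (((fun s => Re (h s)) \o shift t) (u *: (1:R)) -
    Re (h t))) @ 0^' --> Re l.
  apply: cvg_trans (cvg_Re ra); apply: near_eq_cvg; apply: nearW => u /=.
  by rewrite ReZ ReB.
by split; [apply/cvg_ex; exists (Re l)|rewrite /derive; exact/(cvg_lim (@norm_hausdorff _ _))].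
Qed.

Lemma is_derive_Im (h : R -> C) (t : R) (l : C) :
  is_derive t 1 h l -> is_derive t 1 (fun s => Im (h s)) (Im l).
Proof.
move=> [/cvg_ex[a ra] dr].
have ea : a = l by rewrite -dr /derive; exact/esym/(cvg_lim (@norm_hausdorff _ _)).
subst a.
have H : (fun u : R => u^-1 *: (((fun s => Im (h s)) \o shift t) (u *: (1:R)) -
    Im (h t))) @ 0^' --> Im l.
  apply: cvg_trans (cvg_Im ra); apply: near_eq_cvg; apply: nearW => u /=.
  by rewrite ImZ ImB.
by split; [apply/cvg_ex; exists (Im l)|rewrite /derive; exact/(cvg_lim (@norm_hausdorff _ _))].
Qed.

Lemma is_derive_continuousC (h : R -> C) (t : R) (l : C) :
  is_derive t 1 h l -> {for t, continuous h}.
Proof.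
move=> dh.
have cr : {for t, continuous (fun s : R => Re (h s))}.
  have [d1 _] := is_derive_Re dh.
  by apply/differentiable_continuous/derivable1_diffP.
have ci : {for t, continuous (fun s : R => Im (h s))}.
  have [d1 _] := is_derive_Im dh.
  by apply/differentiable_continuous/derivable1_diffP.
exact: (cvgC_ReIm cr ci).
Qed.

End complex_numbers.

(** * Real integrals *)

Section real_integrals.
Context d (T : measurableType d) (R : realType).
Variable mu : {measure set T -> \bar R}.

Lemma bounded_integrableT (f : T -> R) (M : R) :
  (mu setT < +oo)%E -> measurable_fun setT f -> (forall x, `|f x| <= M) ->
  mu.-integrable setT (EFin \o f).
Proof.
move=> fin mf fM; apply: measurable_bounded_integrable => //.
exists M; split; first by rewrite num_real.
by move=> y My x _ /=; apply: le_trans (fM x) (ltW My).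
Qed.

Lemma le_integrableT (f g : T -> R) :
  mu.-integrable setT (EFin \o g) -> measurable_fun setT f ->
  (forall x, `|f x| <= g x) -> mu.-integrable setT (EFin \o f).
Proof.
move=> ig mf fg; apply: le_integrable ig => //; first exact/measurable_EFinP.
by move=> x _ /=; rewrite lee_fin; exact: le_trans (fg x) (ler_norm _).
Qed.

Lemma integrable_measurable (f : T -> R) :
  mu.-integrable setT (EFin \o f) -> measurable_fun setT f.
Proof. by move=> /(@measurable_int _ _ _ _ _ _)/measurable_EFinP. Qed.

(** Dominated convergence, with the limit taken in the real line and not in its
    extension. *)
Lemma dominated_Rintegral_cvg (f_ : nat -> T -> R) (f g : T -> R) :
  (forall n, measurable_fun setT (f_ n)) ->
  (forall x, f_ ^~ x @ \oo --> f x) ->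
  mu.-integrable setT (EFin \o g) ->
  (forall n x, `|f_ n x| <= g x) ->
  (fun n => \int[mu]_x f_ n x) @ \oo --> \int[mu]_x f x.
Proof.
move=> mf_ ff ig fg.
have mf : measurable_fun setT f by apply: measurable_fun_cvg => // x _; exact: ff.
have fgx x : `|f x| <= g x.
  have nf : (fun n => `|f_ n x|) @ \oo --> `|f x| by apply: cvg_norm; exact: ff.
  by apply: (ler_cvg_to nf (cvg_cst (g x))); exact: nearW.
apply: fine_cvg; rewrite fineK; last first.
  by apply: integrable_fin_num => //; exact: (le_integrableT ig).
apply: (@dominated_cvg _ _ _ mu setT _ (fun n => EFin \o f_ n) _ (EFin \o g)) => //.
- by move=> n; exact/measurable_EFinP.
- by move=> x _; apply/cvg_EFin; [exact: nearW|exact: ff].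
- by move=> n x _; rewrite lee_fin.
Qed.

Lemma le_norm_Rintegral_bound (f g : T -> R) :
  mu.-integrable setT (EFin \o g) -> measurable_fun setT f ->
  (forall x, `|f x| <= g x) -> `|\int[mu]_x f x| <= \int[mu]_x g x.
Proof.
move=> ig mf fg; apply: le_trans (le_normr_Rintegral _ _) _ => //.
  exact: le_integrableT fg.
apply: le_Rintegral => //; apply: (le_integrableT ig) => //.
  exact: measurableT_comp.
by move=> x; rewrite normr_id.
Qed.

(** A neighbourhood of a is all that domination needs, and radius 1 suits bounds
    that grow polynomially with the parameter. *)
Lemma is_derive_Rintegral (f df : R -> T -> R) (G : T -> R) (a : R) :
  (forall x, mu.-integrable setT (EFin \o f x)) ->
  (forall (x : R) y, is_derive x 1 (f ^~ y) (df x y)) ->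
  mu.-integrable setT (EFin \o G) ->
  (forall x y, a - 1 < x < a + 1 -> `|df x y| <= G y) ->
  is_derive a 1 (fun x => \int[mu]_y f x y) (\int[mu]_y df a y).
Proof.
move=> intf dfP iG bd.
have dE (x : R) y : partial1of2 f x y = df x y.
  by rewrite partial1of2E; have [_ ->] := dfP x y.
have aI : `]a - 1, a + 1[%classic a by rewrite /= in_itv /= ltrBlDr ltrDl ltr01.
have G0 y : 0 <= G y.
  by apply: le_trans (bd a y _); rewrite ?normr_ge0// ltrBlDr ltrDl ltr01.
have bd' x y : `]a - 1, a + 1[%classic x -> setT y -> `|partial1of2 f x y| <= G y.
  by rewrite /= in_itv /= dE => /bd.
have df' x y : `]a - 1, a + 1[%classic x -> setT y -> derivable (f ^~ y) x 1.
  by move=> _ _; have [] := dfP x y.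
have intf' x : `]a - 1, a + 1[%classic x -> mu.-integrable setT (EFin \o f x).
  by move=> _; exact: intf.
have dJ := derivable_under_integral measurableT aI intf' df' G0 iG bd'.
split => //; rewrite -derive1E.
rewrite (differentiation_under_integral measurableT aI intf' df' G0 iG bd').
by apply: eq_Rintegral => y _; rewrite dE.
Qed.

End real_integrals.

(** The two copies of the Borel measurable space of the reals have convertible
    measurable sets, but distinct canonical structures. *)
Lemma measurable_to_TypeR (R : realType) (f : R -> R) :
  measurable_fun [set: R] f -> measurable_fun [set: measurableTypeR R] f.
Proof. by []. Qed.

Lemma measurable_idR (R : realType) : measurable_fun [set: R] (fun x : R => x).
Proof. exact: measurable_id. Qed.
#[local] Hint Resolve measurable_idR : core.

Section real_fubini.
Context d1 d2 (T1 : measurableType d1) (T2 : measurableType d2) (R : realType).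
Variable m1 : {sigma_finite_measure set T1 -> \bar R}.
Variable m2 : {sigma_finite_measure set T2 -> \bar R}.
Variables (f : T1 -> T2 -> R) (a : T1 -> R) (b : T2 -> R).
Hypothesis mf : measurable_fun setT (fun p : T1 * T2 => f p.1 p.2).
Hypothesis ia : m1.-integrable setT (EFin \o a).
Hypothesis ib : m2.-integrable setT (EFin \o b).
Hypothesis fab : forall x y, `|f x y| <= a x * b y.

Let int12 : (m1 \x m2)%E.-integrable setT (fun p : T1 * T2 => (f p.1 p.2)%:E).
Proof.
apply/integrable12ltyP => /=; first exact/measurable_EFinP.
have [ma mb] := (integrable_measurable ia, integrable_measurable ib).
have iia := integrable_abse ia.
have iib := integrable_abse ib.
have fb := integrable_fin_num measurableT iib.
apply: (@le_lt_trans _ _ (\int[m1]_x (`|a x|%:E * \int[m2]_y `|b y|%:E))%E).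
  apply: ge0_le_integral => //=.
  - by move=> x _; apply: integral_ge0 => *; rewrite lee_fin.
  - apply: (@measurable_fun_fubini_tonelli_F _ _ _ _ _ m2
      (fun p : T1 * T2 => `|(f p.1 p.2)%:E|%E)) => //=.
    by apply/measurable_EFinP; exact: measurableT_comp.
  - apply: emeasurable_funM => //; apply/measurable_EFinP.
    exact: measurableT_comp.
  - move=> x _; rewrite -ge0_integralZl//; last first.
      by apply/measurable_EFinP; exact: measurableT_comp.
    apply: ge0_le_integral => //=.
    + apply/measurable_EFinP; apply: measurableT_comp => //.
      exact: (measurableT_comp mf (pair1_measurable x)).
    + by apply/measurable_EFinP; apply: measurable_funM => //; exact: measurableT_comp.
    + move=> y _; rewrite lee_fin (le_trans (fab _ _))//.
      by rewrite (le_trans (ler_norm _))// normrM.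
rewrite ge0_integralZr//=.
- by rewrite lte_mul_pinfty//; [exact: integral_ge0
    |exact: (integrable_fin_num measurableT iia)|rewrite ltey_eq fb].
- by apply/measurable_EFinP; exact: measurableT_comp.
- exact: integral_ge0.
Qed.

Let int_slice1 x : m2.-integrable setT (fun y => (f x y)%:E).
Proof.
apply: (@le_integrableT _ _ _ _ (f x) (fun y => a x * b y)) => //.
- under [X in integrable _ _ X]eq_fun do rewrite /= EFinM.
  exact: integrableZl.
- exact: (measurableT_comp mf (pair1_measurable x)).
Qed.

Let int_slice2 y : m1.-integrable setT (fun x => (f x y)%:E).
Proof.
apply: (@le_integrableT _ _ _ _ (f ^~ y) (fun x => a x * b y)) => //.
- under [X in integrable _ _ X]eq_fun do rewrite /= EFinM.
  exact: integrableZr.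
- exact: (measurableT_comp mf (pair2_measurable y)).
Qed.

Lemma Rintegral_integrable1 :
  m1.-integrable setT (EFin \o (fun x => \int[m2]_y f x y)).
Proof.
have := integrable_fubini_F int12; apply: eq_integrable => // x _ /=.
by rewrite fineK// integrable_fin_num//; exact: int_slice1.
Qed.

Lemma Rintegral_prod :
  \int[(m1 \x m2)%E]_q f q.1 q.2 = \int[m1]_x (\int[m2]_y f x y).
Proof.
rewrite [in LHS]/Rintegral -(integral12_prod_meas1 int12); congr fine.
by apply: eq_integral => x _; rewrite fineK// integrable_fin_num//; exact: int_slice1.
Qed.

(** Joint integrability follows from domination by a product of two integrable
    functions, one for each variable. *)
Lemma RFubini :
  \int[m1]_x (\int[m2]_y f x y) = \int[m2]_y (\int[m1]_x f x y).
Proof.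
congr fine; transitivity (\int[m1]_x \int[m2]_y (f x y)%:E)%E.
  by apply: eq_integral => x _; rewrite fineK// integrable_fin_num//; exact: int_slice1.
rewrite (Fubini int12) /=; apply: eq_integral => y _.
by rewrite fineK// integrable_fin_num//; exact: int_slice2.
Qed.

End real_fubini.

(** * Gaussian weights and their Fourier transform *)

Section gaussian.
Variable R : realType.
Local Notation mu := (@lebesgue_measure R).
Implicit Types (p q t u x y : R).

(** The real part of [z * expi x] when z has coordinates p and q.  Differentiation
    in x replaces z by i z, that is (p, q) by (- q, p), so that cosine and sine
    transforms are treated together. *)
Definition rexp p q x : R := p * cos x - q * sin x.

Lemma Re_mul_expi (z : Rcomplex R) x : Re (z * expi x) = rexp (Re z) (Im z) x.
Proof. by rewrite ReM. Qed.

Lemma rexp_bound p q x : `|rexp p q x| <= `|p| + `|q|.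
Proof.
rewrite /rexp (le_trans (ler_normB _ _))// !normrM lerD//.
  by rewrite ler_piMr// cos_max.
by rewrite ler_piMr// sin_max.
Qed.

Lemma is_derive_rexp p q t u :
  is_derive u 1 (fun u => rexp p q (u * t)) (t * rexp (- q) p (u * t)).
Proof.
apply: is_derive_eq; rewrite /rexp /GRing.scale /=; ring.
Qed.

Lemma continuous_rexp p q : continuous (rexp p q).
Proof.
move=> x; apply: cvgB; apply: cvgM; try exact: cvg_cst.
  exact: continuous_cos.
exact: continuous_sin.
Qed.

Lemma measurable_rexp p q d (T : measurableType d) (f : T -> R) :
  measurable_fun setT f -> measurable_fun setT (fun w => rexp p q (f w)).
Proof.
move=> mf; apply: measurableT_comp mf.
by apply: continuous_measurable_fun; exact: continuous_rexp.
Qed.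

(** The characteristic function of the centred normal law of variance tau^2. *)
Definition gw (tau t : R) : R := expR (- (tau * t) ^+ 2 / 2).

Lemma gw_gt0 tau t : 0 < gw tau t. Proof. exact: expR_gt0. Qed.
Lemma gw_ge0 tau t : 0 <= gw tau t. Proof. exact: expR_ge0. Qed.

Lemma gw_le1 tau t : gw tau t <= 1.
Proof.
by rewrite -[leRHS]expR0 ler_expR mulNr oppr_le0 divr_ge0// sqr_ge0.
Qed.

Lemma gw0 tau : gw tau 0 = 1.
Proof. by rewrite /gw mulr0 expr0n /= oppr0 mul0r expR0. Qed.

Lemma gwN tau t : gw tau (- t) = gw tau t.
Proof. by rewrite /gw mulrN sqrrN. Qed.

Lemma continuous_gw tau : continuous (gw tau).
Proof.
move=> t; apply: (@continuous_comp _ _ _ (fun t => - (tau * t) ^+ 2 / 2) expR).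
  apply: cvgM; last exact: cvg_cst.
  apply: cvgN; apply: (@continuous_comp _ _ _ (fun t => tau * t) (fun v => v ^+ 2)).
    by apply: cvgM; [exact: cvg_cst|exact: cvg_id].
  exact: exprn_continuous.
exact: continuous_expR.
Qed.

Lemma measurable_gw tau : measurable_fun setT (gw tau).
Proof. by apply: continuous_measurable_fun; exact: continuous_gw. Qed.

Lemma normal_pdf_gw (m s x : R) : 0 < s ->
  normal_pdf m s x = normal_peak s * gw s^-1 (m - x).
Proof.
move=> s0; rewrite normal_pdfE ?gt_eqF// /normal_fun /gw; congr (_ * expR _).
rewrite !mulNr; congr (- _); field.
by rewrite gt_eqF.
Qed.

Lemma gw_normal_pdf tau t : 0 < tau ->
  gw tau t = (normal_peak tau^-1)^-1 * normal_pdf 0 tau^-1 t.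
Proof.
move=> tau0; rewrite normal_pdf_gw ?invr_gt0// (invrK tau) sub0r gwN mulrA mulVf ?mul1r//.
by rewrite gt_eqF// normal_peak_gt0// invr_eq0 gt_eqF.
Qed.

Lemma integrable_gw tau : 0 < tau -> mu.-integrable setT (EFin \o gw tau).
Proof.
move=> tau0; have := integrableZl measurableT (normal_peak tau^-1)^-1
  (integrable_normal_pdf 0 tau^-1); apply: eq_integrable => // t _ /=.
by rewrite -EFinM -gw_normal_pdf.
Qed.

Lemma Rintegral_normal_pdf (m s : R) : \int[mu]_x normal_pdf m s x = 1.
Proof. by rewrite /Rintegral integral_normal_pdf. Qed.

Lemma Rintegral_gw tau : 0 < tau ->
  \int[mu]_t gw tau t = 2 * pi * normal_peak tau.
Proof.
move=> tau0; under eq_Rintegral do rewrite gw_normal_pdf//.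
rewrite RintegralZl//; last exact: integrable_normal_pdf.
rewrite Rintegral_normal_pdf mulr1 /normal_peak invrK.
have pi0 : 0 < pi :> R := pi_gt0 R.
have -> : tau^-1 ^+ 2 * pi *+ 2 = (2 * pi) * tau^-1 ^+ 2 by ring.
have -> : tau ^+ 2 * pi *+ 2 = (2 * pi) * tau ^+ 2 by ring.
have sq (a : R) : 0 < a -> Num.sqrt (2 * pi * a ^+ 2) = Num.sqrt 2 * Num.sqrt pi * a.
  move=> a0; rewrite sqrtrM ?mulr_ge0 ?ltW// sqrtr_sqr (gtr0_norm a0).
  by rewrite sqrtrM.
rewrite !sq ?invr_gt0//.
have e : 2 * pi = Num.sqrt 2 * Num.sqrt pi * (Num.sqrt 2 * Num.sqrt pi) :> R.
  by rewrite -expr2 exprMn !sqr_sqrtr// ltW.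
have s2 : Num.sqrt 2 != 0 :> R by rewrite sqrtr_eq0 -ltNge.
have s3 : Num.sqrt pi != 0 :> R by rewrite sqrtr_eq0 -ltNge.
by rewrite e; field; rewrite s2 s3 gt_eqF.
Qed.

(** The moment |t| gw is absorbed by a wider Gaussian because
    |v| <= 1 + v^2/4 <= expR (v^2/4). *)
Lemma norm_mul_gw_le tau t : 0 < tau ->
  `|t| * gw tau t <= tau^-1 * gw (tau / 2) t.
Proof.
move=> tau0; rewrite ler_pdivlMl// mulrA -{1}(gtr0_norm tau0) -normrM.
set v := tau * t.
have -> : gw (tau / 2) t = expR (3 / 8 * v ^+ 2) * gw tau t.
  by rewrite /gw -expRD /v; congr expR; field.
rewrite ler_wpM2r ?gw_ge0//; apply: le_trans (expR_ge1Dx _).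
rewrite -(real_normK (num_real v)) -subr_ge0.
have -> : 1 + 3 / 8 * `|v| ^+ 2 - `|v| =
  (1 - `|v| / 2) ^+ 2 + `|v| ^+ 2 / 8 by field.
by rewrite addr_ge0 ?sqr_ge0// divr_ge0 ?sqr_ge0.
Qed.

Lemma integrable_norm_mul_gw tau : 0 < tau ->
  mu.-integrable setT (EFin \o (fun t => `|t| * gw tau t)).
Proof.
move=> tau0; apply: (@le_integrableT _ (measurableTypeR R) R mu _ (fun t => tau^-1 * gw (tau / 2) t)).
- have := integrableZl measurableT tau^-1 (integrable_gw (divr_gt0 tau0 (ltr0Sn R 1))).
  by apply: eq_integrable.
- apply: measurable_to_TypeR; apply: measurable_funM; last exact: measurable_gw.
  exact: normr_measurable.
- move=> t; rewrite ger0_norm; first exact: norm_mul_gw_le.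
  by rewrite mulr_ge0// gw_ge0.
Qed.

Lemma gw_cvg0 tau : 0 < tau -> (fun n : nat => gw tau n.+1%:R) @ \oo --> (0 : R).
Proof.
move=> tau0; apply: (@squeeze_cvgr _ _ _ _ (fun=> 0) (fun n => tau^-1 * n.+1%:R^-1)).
- apply: nearW => n; rewrite gw_ge0 /=.
  rewrite -[leRHS](@mulrC _ (n.+1%:R^-1)) ler_pdivlMl ?ltr0n//.
  have := @norm_mul_gw_le tau n.+1%:R tau0; rewrite ger0_norm// => /le_trans->//.
  by rewrite ler_piMr ?gw_le1// invr_ge0 ltW.
- exact: cvg_cst.
- rewrite -[X in _ --> X](mulr0 tau^-1); apply: cvgM; first exact: cvg_cst.
  exact: cvg_harmonic.
Qed.

(** The fundamental theorem of calculus on [- n, n], in the limit. *)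
Lemma Rintegral_derive0 (F f : R -> R) :
  (forall t, is_derive t 1 F (f t)) -> continuous f ->
  mu.-integrable setT (EFin \o f) ->
  (fun n : nat => F n.+1%:R) @ \oo --> (0 : R) ->
  (fun n : nat => F (- n.+1%:R)) @ \oo --> (0 : R) ->
  \int[mu]_t f t = 0.
Proof.
move=> dF cf intf Fy FNy.
pose f_ (n : nat) : R -> R := f \_ `[- n.+1%:R, n.+1%:R].
have h1 : (fun n => \int[mu]_t f_ n t) @ \oo --> \int[mu]_t f t.
  apply: (@dominated_Rintegral_cvg _ (measurableTypeR R) R mu _ _ (fun t => `|f t|)).
  - move=> n; apply: measurable_to_TypeR.
    apply/(measurable_restrictT f (measurable_itv _)).
    by apply: measurable_funTS; exact: continuous_measurable_fun.
  - move=> t; apply: cvg_near_cst; near=> n.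
    rewrite /f_ patchE mem_set//= in_itv /= -ler_norml.
    near: n; exists (Num.bound t) => // n /= tn.
    apply: le_trans (ltW (archi_boundP (normr_ge0 _))) _.
    rewrite ler_nat (leq_trans _ (leqW tn))//.
    by rewrite /Num.bound normr_id.
  - have := integrable_abse intf; by apply: eq_integrable.
  - move=> n t; rewrite /f_ patchE; case: ifP => // _.
    by rewrite normr0.
have h2 : (fun n => \int[mu]_t f_ n t) @ \oo --> (0 : R).
  have -> : (fun n => \int[mu]_t f_ n t) = (fun n => F n.+1%:R - F (- n.+1%:R)).
    apply/funext => n; rewrite /f_ -Rintegral_mkcond /Rintegral.
    have cF t : {for t, continuous F}.
      by apply/differentiable_continuous/derivable1_diffP; have [] := dF t.
    rewrite (@continuous_FTC2 _ f F)//.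
    - by rewrite (@lt_trans _ _ 0)// ?oppr_lt0 ltr0n.
    - by apply: continuous_subspaceT => t; exact: cf.
    - split.
      + by move=> t _; have [] := dF t.
      + exact/cvg_at_right_filter/cF.
      + exact/cvg_at_left_filter/cF.
    - by move=> t _; rewrite derive1E; have [_ ->] := dF t.
  by rewrite -[X in _ --> X](subr0 0); apply: cvgB.
by rewrite -(cvg_lim (@norm_hausdorff _ _) h1) (cvg_lim (@norm_hausdorff _ _) h2).
Unshelve. all: by end_near. Qed.

Section fourier_transform.
Variable tau : R.
Hypothesis tau0 : 0 < tau.

Let integrable_rexp_gw p q u :
  mu.-integrable setT (EFin \o (fun t => rexp p q (u * t) * gw tau t)).
Proof.
apply: (@le_integrableT _ (measurableTypeR R) R mu _ (fun t => (`|p| + `|q|) * gw tau t)).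
- have := integrableZl measurableT (`|p| + `|q|) (integrable_gw tau0).
  by apply: eq_integrable.
- apply: measurable_to_TypeR; apply: measurable_funM; last exact: measurable_gw.
  by apply: measurable_rexp; exact: measurable_funM.
- by move=> t; rewrite normrM (ger0_norm (gw_ge0 _ _)) ler_wpM2r ?gw_ge0// rexp_bound.
Qed.

Let integrable_id_rexp_gw p q u :
  mu.-integrable setT (EFin \o (fun t => t * rexp p q (u * t) * gw tau t)).
Proof.
apply: (@le_integrableT _ (measurableTypeR R) R mu _ (fun t => (`|p| + `|q|) * (`|t| * gw tau t))).
- have := integrableZl measurableT (`|p| + `|q|) (integrable_norm_mul_gw tau0).
  by apply: eq_integrable.
- apply: measurable_to_TypeR; apply: measurable_funM; last exact: measurable_gw.
  by apply: measurable_funM => //; apply: measurable_rexp; exact: measurable_funM.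
- move=> t; rewrite mulrA 2!normrM (ger0_norm (gw_ge0 _ _)) ler_wpM2r ?gw_ge0//.
  by rewrite mulrC ler_wpM2r// rexp_bound.
Qed.

Let J p q u := \int[mu]_t (rexp p q (u * t) * gw tau t).

Let rexp_gw_cvg0 p q u (v : nat -> R) :
  (fun n => gw tau (v n)) @ \oo --> (0 : R) ->
  (fun n => rexp p q (u * v n) * gw tau (v n)) @ \oo --> (0 : R).
Proof.
move=> v0; apply/norm_cvg0P.
apply: (@squeeze_cvgr _ _ _ _ (fun=> 0) (fun n => (`|p| + `|q|) * gw tau (v n))).
- apply: nearW => n; rewrite normr_ge0 /= normrM (ger0_norm (gw_ge0 _ _)).
  by rewrite ler_wpM2r ?gw_ge0// rexp_bound.
- exact: cvg_cst.
- by rewrite -[X in _ --> X](mulr0 (`|p| + `|q|)); apply: cvgM => //; exact: cvg_cst.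
Qed.

Let continuous_rexp_gw p q u : continuous (fun t => rexp p q (u * t) * gw tau t).
Proof.
move=> t; apply: cvgM; last exact: continuous_gw.
apply: (@continuous_comp _ _ _ (fun t => u * t) (rexp p q)).
  by apply: cvgM; [exact: cvg_cst|exact: cvg_id].
exact: continuous_rexp.
Qed.

Let J_parts p q u :
  tau ^+ 2 * \int[mu]_t (t * rexp (- q) p (u * t) * gw tau t) = - u * J p q u.
Proof.
pose f t := (- u) * (rexp p q (u * t) * gw tau t) +
            - tau ^+ 2 * (t * rexp (- q) p (u * t) * gw tau t).
have i1 : mu.-integrable setT (EFin \o (fun t => - u * (rexp p q (u * t) * gw tau t))).
  have := integrableZl measurableT (- u) (integrable_rexp_gw p q u).
  by apply: eq_integrable.
have i2 : mu.-integrable setT (EFin \o (fun t =>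
    - tau ^+ 2 * (t * rexp (- q) p (u * t) * gw tau t))).
  have := integrableZl measurableT (- tau ^+ 2) (integrable_id_rexp_gw (- q) p u).
  by apply: eq_integrable.
have int0 : \int[mu]_t f t = 0.
  apply: (@Rintegral_derive0 (fun t => rexp (- q) p (u * t) * gw tau t)).
  - by move=> t; apply: is_derive_eq; rewrite /f /rexp /gw /GRing.scale /=; field.
  - move=> t; apply: cvgD; apply: cvgM; try exact: cvg_cst.
      exact: continuous_rexp_gw.
    rewrite (_ : (fun t => _) = fun t => t * (rexp (- q) p (u * t) * gw tau t)).
      by rewrite -mulrA; apply: cvgM; [exact: cvg_id|exact: continuous_rexp_gw].
    by apply/funext => s; rewrite mulrA.
  - have := integrableD measurableT i1 i2; exact: eq_integrable.
  - by apply: rexp_gw_cvg0; exact: gw_cvg0.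
  - by apply: rexp_gw_cvg0; under eq_fun do rewrite gwN; exact: gw_cvg0.
move: int0; rewrite /f RintegralD// !RintegralZl// ?integrable_id_rexp_gw// -/(J p q u).
by move=> /eqP; rewrite mulNr [X in _ + X == _]mulNr subr_eq0 => /eqP.
Qed.

Let is_derive_J p q u :
  is_derive u 1 (J p q) (\int[mu]_t (t * rexp (- q) p (u * t) * gw tau t)).
Proof.
apply: (@is_derive_Rintegral _ _ _ mu (fun u t => rexp p q (u * t) * gw tau t)
  (fun u t => t * rexp (- q) p (u * t) * gw tau t)
  (fun t => (`|p| + `|q|) * (`|t| * gw tau t))).
- by move=> x; exact: integrable_rexp_gw.
- move=> x t; have H := is_derive_rexp p q t x.
  by apply: is_derive_eq; rewrite /GRing.scale /=; ring.
- have := integrableZl measurableT (`|p| + `|q|) (integrable_norm_mul_gw tau0).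
  by apply: eq_integrable.
- move=> x t _; rewrite 2!normrM (ger0_norm (gw_ge0 _ _)) mulrA ler_wpM2r ?gw_ge0//.
  by rewrite mulrC ler_wpM2r// (le_trans (rexp_bound _ _ _))// normrN addrC.
Qed.

(** The Fourier transform J of a Gaussian satisfies tau^2 J'(u) = - u J(u), by
    integration by parts; so J(u) * expR (u^2 / (2 tau^2)) is constant. *)
Lemma Rintegral_rexp_gw p q u :
  \int[mu]_t (rexp p q (u * t) * gw tau t) = 2 * pi * p * normal_pdf 0 tau u.
Proof.
have t0 : tau != 0 by rewrite gt_eqF.
pose K x := J p q x * expR ((tau^-1 * x) ^+ 2 / 2).
have dK (x : R) : is_derive x 1 K 0.
  have dJ := is_derive_J p q x.
  apply: is_derive_eq.
  have -> : \int[mu]_t (t * rexp (- q) p (x * t) * gw tau t) =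
      - (tau^-1 ^+ 2 * x * J p q x).
    apply: (@mulfI _ (tau ^+ 2)); first by rewrite expf_neq0.
    by rewrite J_parts; field.
  by rewrite /GRing.scale /=; field.
have := @is_derive_0_is_cst _ K u 0 dK.
rewrite /K mulr0 expr0n /= mul0r expR0 mulr1 => e.
have -> : \int[mu]_t (rexp p q (u * t) * gw tau t) =
    J p q 0 * expR (- ((tau^-1 * u) ^+ 2 / 2)).
  by rewrite -e -mulrA -expRD addrN expR0 mulr1.
rewrite normal_pdf_gw// /gw sub0r mulrN sqrrN mulNr !mulrA; congr (_ * _).
rewrite /J.
under eq_Rintegral do rewrite mul0r /rexp cos0 sin0 mulr1 mulr0 subr0.
rewrite RintegralZl//; last exact: integrable_gw.
rewrite Rintegral_gw//; ring.
Qed.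

End fourier_transform.
End gaussian.

(** * Normal densities as an approximate identity *)

Section approximate_identity.
Variable R : realType.
Local Notation mu := (@lebesgue_measure R).

Lemma normal_peak_double (s : R) : 0 < s -> normal_peak s = 2 * normal_peak (2 * s).
Proof.
move=> s0; rewrite /normal_peak.
have -> : (2 * s) ^+ 2 * pi *+ 2 = 2 ^+ 2 * (s ^+ 2 * pi *+ 2) :> R by ring.
rewrite sqrtrM ?sqr_ge0// sqrtr_sqr ger0_norm// invfM mulrA mulfV ?mul1r//.
Qed.

(** Doubling the width s of the density frees a factor expR (- 3 / 8 w^2), with
    w = (x - v) / s, which the inequality v <= expR v turns into s^2. *)
Lemma normal_pdf_tail (s x v delta : R) : 0 < s -> 0 < delta -> delta <= `|x - v| ->
  normal_pdf x s v <= 16 / 3 / delta ^+ 2 * s ^+ 2 * normal_pdf x (2 * s) v.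
Proof.
move=> s0 d0 dxv; rewrite !normal_pdf_gw ?mulr_gt0// (normal_peak_double s0).
set P := normal_peak (2 * s).
have P0 : 0 <= P by exact: normal_peak_ge0.
have sN0 : s != 0 by rewrite gt_eqF.
pose w2 := ((x - v) / s) ^+ 2.
have w2E : delta ^+ 2 / s ^+ 2 <= w2.
  rewrite /w2 expr_div_n ler_wpM2r ?invr_ge0 ?sqr_ge0//.
  by rewrite -(real_normK (num_real (x - v))) ler_pXn2r ?nnegrE// ltW.
have -> : gw s^-1 (x - v) = expR (- (3 / 8 * w2)) * gw (2 * s)^-1 (x - v).
  by rewrite /gw -expRD /w2; congr expR; field.
have e : expR (- (3 / 8 * w2)) <= 8 / 3 / delta ^+ 2 * s ^+ 2.
  have q0 : 0 < delta ^+ 2 / s ^+ 2 by rewrite divr_gt0 ?exprn_gt0.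
  have w0 : 0 < 3 / 8 * w2 by rewrite mulr_gt0// (lt_le_trans q0).
  rewrite expRN; have -> : 8 / 3 / delta ^+ 2 * s ^+ 2 = (3 / 8 * (delta ^+ 2 / s ^+ 2))^-1.
    by field; rewrite sN0 gt_eqF.
  rewrite lef_pV2 ?posrE ?expR_gt0 ?mulr_gt0 ?invr_gt0 ?exprn_gt0//.
  apply: le_trans (expR_ge1Dx _); rewrite ler_wpDl// ler_wpM2l// invr_gt0 exprn_gt0.
have -> : 16 / 3 / delta ^+ 2 * s ^+ 2 * (P * gw (2 * s)^-1 (x - v)) =
  2 * P * (8 / 3 / delta ^+ 2 * s ^+ 2 * gw (2 * s)^-1 (x - v)) by ring.
by rewrite ler_wpM2l ?mulr_ge0// ler_wpM2r ?gw_ge0.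
Qed.

Lemma integrable_mul_bounded (h g : R -> R) (M : R) :
  measurable_fun setT h -> (forall v, `|h v| <= M) ->
  mu.-integrable setT (EFin \o g) ->
  mu.-integrable setT (EFin \o (fun v => h v * g v)).
Proof.
move=> mh hM ig; apply: (@le_integrableT _ (measurableTypeR R) R mu _ (fun v => M * `|g v|)).
- have := integrableZl measurableT M (integrable_abse ig); exact: eq_integrable.
- apply: measurable_to_TypeR; apply: measurable_funM => //.
  exact: (integrable_measurable ig).
- by move=> v; rewrite normrM ler_wpM2r.
Qed.

(** Near x, h varies little; away from x, [normal_pdf_tail] bounds the normal
    density by s^2 times another one.  Densities having mass 1, the error is
    e / 2 + K s^2. *)
Lemma approximate_identity (h : R -> R) (M x : R) :
  measurable_fun setT h -> (forall v, `|h v| <= M) -> {for x, continuous h} ->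
  (fun n : nat => \int[mu]_v (h v * normal_pdf x n.+1%:R^-1 v)) @ \oo --> h x.
Proof.
move=> mh hM cx; apply/cvgrPdist_lt => e e0.
have M0 : 0 <= M by apply: le_trans (hM 0).
have e2 : 0 < e / 2 by rewrite divr_gt0.
move/cvgrPdist_lt : cx => /(_ _ e2)/nbhs_ballP[delta /= d0 hd].
pose K := 2 * M * (16 / 3 / delta ^+ 2).
have K0 : 0 <= K by rewrite !mulr_ge0// ?invr_ge0 ?sqr_ge0.
have bnd (s : R) : 0 < s ->
    `|h x - \int[mu]_v (h v * normal_pdf x s v)| <= e / 2 + K * s ^+ 2.
  move=> s0.
  have i1 := integrable_normal_pdf x s.
  have i2 := integrable_normal_pdf x (2 * s).
  have i3 := integrable_mul_bounded mh hM i1.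
  have -> : h x = \int[mu]_v (h x * normal_pdf x s v).
    by rewrite RintegralZl// Rintegral_normal_pdf mulr1.
  rewrite -RintegralB//; last first.
    by have := integrableZl measurableT (h x) i1; exact: eq_integrable.
  have e1 : e / 2 + K * s ^+ 2 = \int[mu]_v
      (e / 2 * normal_pdf x s v + K * s ^+ 2 * normal_pdf x (2 * s) v).
    rewrite RintegralD//; last 2 first.
      by have := integrableZl measurableT (e / 2) i1; exact: eq_integrable.
      by have := integrableZl measurableT (K * s ^+ 2) i2; exact: eq_integrable.
    by rewrite !RintegralZl// !Rintegral_normal_pdf !mulr1.
  rewrite e1; apply: (@le_norm_Rintegral_bound _ (measurableTypeR R)).
  - have := integrableD measurableT (integrableZl measurableT (e / 2) i1)
      (integrableZl measurableT (K * s ^+ 2) i2); exact: eq_integrable.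
  - apply: measurable_to_TypeR; apply: measurable_funB.
      by apply: measurable_funM => //; exact: measurable_normal_pdf.
    by apply: measurable_funM => //; exact: measurable_normal_pdf.
  - move=> v; rewrite -mulrBl normrM (ger0_norm (normal_pdf_ge0 _ _ _)).
    have [xv|xv] := ltP `|x - v| delta.
      rewrite ler_wpDr//; first by rewrite mulr_ge0 ?normal_pdf_ge0// mulr_ge0 ?sqr_ge0.
      by rewrite ler_wpM2r ?normal_pdf_ge0// ltW// hd.
    rewrite ler_wpDl//; first by rewrite mulr_ge0 ?normal_pdf_ge0// ltW.
    apply: (@le_trans _ _ (2 * M * normal_pdf x s v)).
      rewrite ler_wpM2r ?normal_pdf_ge0// (le_trans (ler_normB _ _))//.
      by rewrite mulr_natl mulr2n lerD.
    have -> : K * s ^+ 2 * normal_pdf x (2 * s) v = 2 * M *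
        (16 / 3 / delta ^+ 2 * s ^+ 2 * normal_pdf x (2 * s) v) by rewrite /K; ring.
    by rewrite ler_wpM2l ?mulr_ge0//; exact: normal_pdf_tail.
have : (fun n => K * n.+1%:R^-1) @ \oo --> (0 : R).
  by rewrite -[X in _ --> X](mulr0 K); apply: cvgM; [exact: cvg_cst|exact: cvg_harmonic].
move=> /cvgrPdist_lt /(_ _ e2) H.
near=> n; apply: le_lt_trans (bnd _ _) _; first by rewrite invr_gt0 ltr0n.
rewrite [ltRHS]splitr ltrD2l.
apply: (@le_lt_trans _ _ (K * n.+1%:R^-1)).
  rewrite ler_wpM2l// expr2 ler_piMr ?invr_ge0 ?ler0n// invf_le1 ?ltr0n//.
  by rewrite ler1n.
apply: le_lt_trans (ler_norm _) _; rewrite -normrN -sub0r; near: n; exact: H.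
Unshelve. all: by end_near. Qed.

End approximate_identity.

(** * Functions with nonnegative Fourier transform *)

Section positive_definite.
Variable R : realType.
Local Notation mu := (@lebesgue_measure R).
Local Notation C := (Rcomplex R).
Implicit Types (phi rho : R -> C).

Definition measurableC d (T : measurableType d) (h : T -> C) :=
  measurable_fun setT (fun t => Re (h t)) /\ measurable_fun setT (fun t => Im (h t)).

Lemma measurableC_mul d (T : measurableType d) (h k : T -> C) :
  measurableC h -> measurableC k -> measurableC (fun t => h t * k t : C).
Proof.
move=> [hr hi] [kr ki]; split.
  under eq_fun do rewrite ReM.
  by apply: measurable_funB; apply: measurable_funM.
under eq_fun do rewrite ImM.
by apply: measurable_funD; apply: measurable_funM.
Qed.

Lemma measurableC_expi d (T : measurableType d) (f : T -> R) :
  measurable_fun setT f -> measurableC (fun t => expi (f t)).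
Proof.
move=> mf; split.
  apply: (@measurableT_comp _ _ _ _ _ _ (@cos R)) => //.
  by apply: continuous_measurable_fun; exact: continuous_cos.
apply: (@measurableT_comp _ _ _ _ _ _ (@sin R)) => //.
by apply: continuous_measurable_fun; exact: continuous_sin.
Qed.

(** Only the real part is kept: for hermitian phi, the case of interest, the
    Fourier integral is real. *)
Definition gauss_fourier (tau : R) phi (y : R) : R :=
  \int[mu]_t (Re (phi t * expi (- (t * y)) : C) * gw tau t).

(** For continuous hermitian phi this amounts to positive-definiteness of
    phi * gw tau, by Bochner's theorem. *)
Definition psd tau phi : Prop :=
  [/\ measurableC phi, exists M : R, forall t, `|phi t| <= M &
      forall y, 0 <= gauss_fourier tau phi y].

Lemma Re_mul_expi_bound (z : C) x : `|Re (z * expi x : C)| <= `|z|.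
Proof. by apply: le_trans (Re_le_norm _) _; rewrite normCM normC_expi mulr1. Qed.

Section fixed_width.
Variable tau : R.
Hypothesis tau0 : 0 < tau.

Let integrable_Mgw (M : R) : mu.-integrable setT (EFin \o (fun t => M * gw tau t)).
Proof.
have := integrableZl measurableT M (integrable_gw tau0).
exact: eq_integrable.
Qed.

Lemma measurable_gauss_fourier_integrand phi y : measurableC phi ->
  measurable_fun setT (fun t => Re (phi t * expi (- (t * y)) : C) * gw tau t).
Proof.
move=> mphi; apply: measurable_funM; last exact: measurable_gw.
apply: (measurableC_mul mphi (measurableC_expi _)).1.
by apply: measurableT_comp => //; exact: measurable_funM.
Qed.

Lemma gauss_fourier_integrand_bound phi (M : R) y t : (forall t, `|phi t| <= M) ->
  `|Re (phi t * expi (- (t * y)) : C) * gw tau t| <= M * gw tau t.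
Proof.
move=> phiM; rewrite normrM (ger0_norm (gw_ge0 _ _)) ler_wpM2r ?gw_ge0//.
by apply: le_trans (phiM t); exact: Re_mul_expi_bound.
Qed.

Lemma integrable_gauss_fourier phi y (M : R) :
  measurableC phi -> (forall t, `|phi t| <= M) ->
  mu.-integrable setT (EFin \o (fun t => Re (phi t * expi (- (t * y)) : C) * gw tau t)).
Proof.
move=> mphi phiM; apply: (@le_integrableT _ (measurableTypeR R) R mu _ (fun t => M * gw tau t)).
- exact: integrable_Mgw.
- apply: measurable_to_TypeR; exact: measurable_gauss_fourier_integrand.
- by move=> t; exact: gauss_fourier_integrand_bound.
Qed.

Lemma psd1 : psd tau (fun=> 1).
Proof.
split.
- by split; exact: measurable_cst.
- by exists 1 => t; rewrite normC1.
- move=> y; have -> : gauss_fourier tau (fun=> 1) y =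
      \int[mu]_t (rexp 1 0 (- y * t) * gw tau t).
    apply: eq_Rintegral => t _; congr (_ * _); rewrite Re_mul_expi /=.
    by rewrite mulNr mulrC.
  rewrite Rintegral_rexp_gw// mulr1 !mulr_ge0 ?normal_pdf_ge0//.
  exact: pi_ge0.
Qed.

Lemma psdD phi rho : psd tau phi -> psd tau rho -> psd tau (fun t => phi t + rho t : C).
Proof.
move=> [[mr mi] [M HM] p0] [[mr' mi'] [M' HM'] p0']; split.
- split.
    by under eq_fun do rewrite ReD; exact: measurable_funD.
  by under eq_fun do rewrite ImD; exact: measurable_funD.
- by exists (M + M') => t; rewrite (le_trans (ler_normD _ _))// lerD.
- move=> y; have -> : gauss_fourier tau (fun t => phi t + rho t : C) y =
      gauss_fourier tau phi y + gauss_fourier tau rho y.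
    rewrite /gauss_fourier -RintegralD//; last 2 first.
      exact: integrable_gauss_fourier HM.
      exact: integrable_gauss_fourier HM'.
    by apply: eq_Rintegral => t _; rewrite mulrDl ReD mulrDl.
  exact: addr_ge0.
Qed.

Lemma psdZ (c : R) phi : 0 <= c -> psd tau phi -> psd tau (fun t => c *: phi t).
Proof.
move=> c0 [[mr mi] [M HM] p0]; split.
- split.
    by under eq_fun do rewrite ReZ; exact: measurable_funM.
  by under eq_fun do rewrite ImZ; exact: measurable_funM.
- by exists (c * M) => t; rewrite normrZ ger0_norm// ler_wpM2l.
- move=> y; have -> : gauss_fourier tau (fun t => c *: phi t) y =
      c * gauss_fourier tau phi y.
    rewrite /gauss_fourier -RintegralZl//; last exact: integrable_gauss_fourier HM.
    by apply: eq_Rintegral => t _; rewrite -scaleCM ReZ mulrA.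
  exact: mulr_ge0.
Qed.

Lemma psd_lim (phi_ : nat -> R -> C) phi (M : R) :
  (forall n, psd tau (phi_ n)) -> (forall n t, `|phi_ n t| <= M) ->
  (forall t, phi_ ^~ t @ \oo --> phi t) -> psd tau phi.
Proof.
move=> ppsd phiM pcvg; split.
- split.
    apply: (@measurable_fun_cvg _ _ _ setT (fun n t => Re (phi_ n t))).
      by move=> n; have [[]] := ppsd n.
    by move=> t _; apply: cvg_Re; exact: pcvg.
  apply: (@measurable_fun_cvg _ _ _ setT (fun n t => Im (phi_ n t))).
    by move=> n; have [[]] := ppsd n.
  by move=> t _; apply: cvg_Im; exact: pcvg.
- exists M => t; apply: (ler_cvg_to (cvg_norm (pcvg t)) (cvg_cst M)).
  exact: nearW.
- move=> y; have : (fun n => gauss_fourier tau (phi_ n) y) @ \oo -->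
      gauss_fourier tau phi y.
    apply: (@dominated_Rintegral_cvg _ (measurableTypeR R) R mu _ _ (fun t => M * gw tau t)).
    + move=> n; apply: measurable_to_TypeR; apply: measurable_gauss_fourier_integrand.
      by have [] := ppsd n.
    + move=> t; apply: cvgM; last exact: cvg_cst.
      have : (fun n => Re (phi_ n t * expi (- (t * y)) : C)) =
          (fun n => Re (phi_ n t) * Re (expi (- (t * y))) -
                    Im (phi_ n t) * Im (expi (- (t * y)))).
        by apply/funext => n; rewrite ReM.
      move=> ->; rewrite ReM; apply: cvgB; apply: cvgM; try exact: cvg_cst.
        apply: cvg_Re; exact: pcvg.
      apply: cvg_Im; exact: pcvg.
    + exact: integrable_Mgw.
    + by move=> n t; exact: gauss_fourier_integrand_bound.
  move=> H; apply: (ler_cvg_to (cvg_cst 0) H).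
  by apply: nearW => n; have [_ _] := ppsd n; exact.
Qed.

(** A drift translates the Fourier integral. *)
Lemma psd_expi (b : R) phi : psd tau phi -> psd tau (fun t => phi t * expi (t * b) : C).
Proof.
move=> [mphi [M HM] p0]; split.
- by apply: measurableC_mul => //; apply: measurableC_expi; exact: measurable_funM.
- by exists M => t; rewrite normCM normC_expi mulr1.
- move=> y; have -> : gauss_fourier tau (fun t => phi t * expi (t * b) : C) y =
      gauss_fourier tau phi (y - b).
    apply: eq_Rintegral => t _; rewrite -mulrA -expiD; congr (Re (_ * expi _) * _); ring.
  exact: p0.
Qed.

Section multiplier.
Context d (Y : measurableType d) (m : {sigma_finite_measure set Y -> \bar R}).
Variables (w X : Y -> R).
Hypothesis mfin : (m setT < +oo)%E.
Hypothesis mX : measurable_fun setT X.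
Hypothesis w0 : forall x, 0 <= w x.
Hypothesis iw : m.-integrable setT (EFin \o w).

Definition weighted_cf (t : R) : C :=
  Complex (\int[m]_x (w x * cos (t * X x))) (\int[m]_x (w x * sin (t * X x))).

Let mw : measurable_fun setT w. Proof. exact: integrable_measurable iw. Qed.

Let mcosX t : measurable_fun setT (fun x => cos (t * X x)).
Proof. by apply: (measurableC_expi _).1; exact: measurable_funM. Qed.

Let msinX t : measurable_fun setT (fun x => sin (t * X x)).
Proof. by apply: (measurableC_expi (measurable_funM _ _)).2. Qed.

Let icos t : m.-integrable setT (EFin \o (fun x => w x * cos (t * X x))).
Proof.
apply: (le_integrableT iw); first exact: measurable_funM.
by move=> x; rewrite normrM (ger0_norm (w0 x)) ler_piMr// cos_max.
Qed.

Let isin t : m.-integrable setT (EFin \o (fun x => w x * sin (t * X x))).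
Proof.
apply: (le_integrableT iw); first exact: measurable_funM.
by move=> x; rewrite normrM (ger0_norm (w0 x)) ler_piMr// sin_max.
Qed.

Lemma weighted_cf_bound t : `|weighted_cf t| <= 2 * \int[m]_x w x.
Proof.
apply: le_trans (norm_le_ReIm _) _; rewrite mulr_natl mulr2n lerD//=.
  apply: le_norm_Rintegral_bound => //; first exact: measurable_funM.
  by move=> x; rewrite normrM (ger0_norm (w0 x)) ler_piMr// cos_max.
apply: le_norm_Rintegral_bound => //; first exact: measurable_funM.
by move=> x; rewrite normrM (ger0_norm (w0 x)) ler_piMr// sin_max.
Qed.

Lemma Re_mul_weighted_cf (z : C) t :
  Re (z * weighted_cf t : C) = \int[m]_x (w x * Re (z * expi (t * X x) : C)).
Proof.
rewrite ReM /= -!RintegralZl// -RintegralB//; last 2 first.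
  by have := integrableZl measurableT (Re z) (icos t); exact: eq_integrable.
  by have := integrableZl measurableT (Im z) (isin t); exact: eq_integrable.
by apply: eq_Rintegral => x _; rewrite ReM /=; ring.
Qed.

Let measurable_mulX : measurable_fun setT (fun p : measurableTypeR R * Y => (p.1 : R) * X p.2).
Proof.
apply: measurable_funM; first exact: measurable_fst.
by apply: measurableT_comp => //; exact: measurable_snd.
Qed.

(** The Gaussian factor makes the integrand jointly integrable, so that Fubini's
    theorem gives measurability in t; the factor is then divided out. *)
Let measurable_slice (g : R -> R) : continuous g -> (forall x, `|g x| <= 1) ->
  measurable_fun setT (fun t : R => \int[m]_x (w x * g (t * X x))).
Proof.
move=> cg g1.
pose f (t : measurableTypeR R) x := w x * g (t * X x) * gw tau t.
have mg : measurable_fun setT g by exact: continuous_measurable_fun.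
have mf : measurable_fun setT (fun p : measurableTypeR R * Y => f p.1 p.2).
  apply: measurable_funM.
    apply: measurable_funM; first by apply: measurableT_comp => //; exact: measurable_snd.
    exact: measurableT_comp measurable_mulX.
  apply: (@measurableT_comp _ _ _ _ _ _ (gw tau : measurableTypeR R -> R)).
    exact: measurable_to_TypeR (measurable_gw _).
  exact: measurable_fst.
have fab (t : R) x : `|f t x| <= gw tau t * w x.
  rewrite /f !normrM (ger0_norm (w0 x)) (ger0_norm (gw_ge0 _ _)) mulrC.
  by rewrite ler_wpM2l ?gw_ge0// ler_piMr.
have mF := integrable_measurable (Rintegral_integrable1 mf (integrable_gw tau0) iw fab).
rewrite (_ : (fun t => _) = (fun t => (\int[m]_x f t x) * (gw tau t)^-1)); last first.
  apply/funext => t; rewrite /f RintegralZr//; last first.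
    apply: (le_integrableT iw); first by apply: measurable_funM => //;
      apply: measurableT_comp => //; exact: measurable_funM.
    by move=> x; rewrite normrM (ger0_norm (w0 x)) ler_piMr.
  by rewrite -mulrA mulfV ?mulr1// gt_eqF// gw_gt0.
apply: measurable_funM; first exact: mF.
apply: continuous_measurable_fun => t; apply: cvgV; last exact: continuous_gw.
by rewrite gt_eqF// gw_gt0.
Qed.

(** Multiplying by the characteristic function of a positive measure averages
    the translates of the nonnegative function [gauss_fourier tau phi]. *)
Lemma psdM_weighted_cf phi : psd tau phi ->
  psd tau (fun t => phi t * weighted_cf t : C).
Proof.
move=> [mphi [M HM] p0]; split.
- apply: measurableC_mul => //; split => /=.
    by apply: measurable_slice; [exact: continuous_cos|exact: cos_max].
  by apply: measurable_slice; [exact: continuous_sin|exact: sin_max].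
- exists (M * (2 * \int[m]_x w x)) => t; rewrite normCM ler_pM//.
  exact: weighted_cf_bound.
- move=> y.
  pose f (t : measurableTypeR R) x :=
    Re (phi t * expi (- (t * (y - X x))) : C) * gw tau t * w x.
  have mf : measurable_fun setT (fun p : measurableTypeR R * Y => f p.1 p.2).
    apply: measurable_funM; last by apply: measurableT_comp => //; exact: measurable_snd.
    apply: measurable_funM; last first.
      apply: (@measurableT_comp _ _ _ _ _ _ (gw tau : measurableTypeR R -> R)).
        exact: measurable_to_TypeR (measurable_gw _).
      exact: measurable_fst.
    apply: (measurableC_mul _ (measurableC_expi _)).1.
      split.
        apply: (@measurableT_comp _ _ _ _ _ _ (fun t : measurableTypeR R => Re (phi t))).
          exact: measurable_to_TypeR mphi.1.
        exact: measurable_fst.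
      apply: (@measurableT_comp _ _ _ _ _ _ (fun t : measurableTypeR R => Im (phi t))).
        exact: measurable_to_TypeR mphi.2.
      exact: measurable_fst.
    rewrite (_ : (fun p => _) = (fun p : measurableTypeR R * Y => p.1 * X p.2 - p.1 * y)).
      apply: measurable_funB => //; apply: measurable_funM => //; exact: measurable_fst.
    by apply/funext => p; ring.
  have fab (t : R) x : `|f t x| <= M * gw tau t * w x.
    rewrite /f normrM (ger0_norm (w0 x)) ler_wpM2r//.
    exact: gauss_fourier_integrand_bound.
  have -> : gauss_fourier tau (fun t => phi t * weighted_cf t : C) y =
      \int[mu]_t (\int[m]_x f t x).
    apply: eq_Rintegral => t _.
    rewrite mulrAC Re_mul_weighted_cf -RintegralZr//.
      apply: eq_Rintegral => x _; rewrite /f -!mulrA -expiD.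
      rewrite (_ : - (t * y) + t * X x = - (t * (y - X x))); last by ring.
      by rewrite mulrC -mulrA.
    have m2 : measurableC (fun x : Y => phi t * expi (- (t * y)) * expi (t * X x) : C).
      apply: measurableC_mul; first by split; exact: measurable_cst.
      by apply: measurableC_expi; exact: measurable_funM.
    apply: (@le_integrableT _ _ _ _ _ (fun x => M * w x)).
    + by have := integrableZl measurableT M iw; exact: eq_integrable.
    + by apply: measurable_funM => //; exact: m2.1.
    + move=> x; rewrite normrM (ger0_norm (w0 x)) mulrC ler_wpM2r//.
      apply: le_trans (Re_mul_expi_bound _ _) _.
      by rewrite normCM normC_expi mulr1.
  rewrite (RFubini mf (integrable_Mgw M) iw fab).
  apply: Rintegral_ge0 => x _; rewrite /f RintegralZr//.
    by rewrite mulr_ge0//; exact: p0.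
  exact: integrable_gauss_fourier HM.
Qed.

End multiplier.

(** Multipliers can be iterated, which gives powers and, in the limit, exponentials.
    The product of two functions that are merely positive would carry the square of
    the Gaussian factor. *)
Definition multiplier rho : Prop :=
  (exists M : R, forall t, `|rho t| <= M) /\
  (forall phi, psd tau phi -> psd tau (fun t => phi t * rho t : C)).

Lemma psdMX rho phi n : multiplier rho -> psd tau phi ->
  psd tau (fun t => phi t * rho t ^+ n : C).
Proof.
move=> [_ mrho]; elim: n phi => [|n IH] phi pphi.
  by under eq_fun do rewrite expr0 mulr1.
by under eq_fun do rewrite exprS mulrA; apply: IH; exact: mrho.
Qed.

Lemma multiplier_1D rho (c : R) : 0 <= c -> multiplier rho ->
  multiplier (fun t => 1 + c *: rho t : C).
Proof.
move=> c0 [[M HM] mrho]; split.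
  exists (1 + c * M) => t; rewrite (le_trans (ler_normD _ _))// normC1 lerD2l.
  by rewrite normrZ ger0_norm// ler_wpM2l.
move=> phi pphi.
rewrite (_ : (fun t => _) = (fun t => phi t + c *: (phi t * rho t) : C)).
  by apply: psdD => //; apply: psdZ => //; exact: mrho.
by apply/funext => t; apply: complex_ext; rewrite !ReImE; ring.
Qed.

Lemma norm_subXX_le (a b : C) (q : R) n : 1 <= q -> `|a| <= q -> `|b| <= q ->
  `|(a ^+ n - b ^+ n : C)| <= n%:R * q ^+ n * `|a - b|.
Proof.
move=> q1 aq bq; elim: n => [|n IH].
  by rewrite !expr0 subrr normr0 mul0r mul0r.
have -> : a ^+ n.+1 - b ^+ n.+1 = a * (a ^+ n - b ^+ n) + (a - b) * b ^+ n :> C.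
  by rewrite !exprS; ring.
apply: le_trans (ler_normD _ _) _; rewrite !normCM.
have q0 : 0 <= q by exact: le_trans q1.
have h1 : `|a| * `|a ^+ n - b ^+ n : C| <= n%:R * q ^+ n.+1 * `|a - b|.
  apply: (@le_trans _ _ (q * (n%:R * q ^+ n * `|a - b|))); first exact: ler_pM.
  by rewrite exprS !mulrA (mulrC q).
have h2 : `|a - b| * `|(b ^+ n : C)| <= q ^+ n.+1 * `|a - b|.
  rewrite mulrC ler_wpM2r// normCX.
  apply: (@le_trans _ _ (q ^+ n)); first by rewrite lerXn2r ?nnegrE.
  by rewrite exprS ler_peMl ?exprn_ge0.
by rewrite -natr1 2!mulrDl mul1r; exact: lerD.
Qed.

Lemma is_derive_cexp0 (z : C) : is_derive (0 : R) 1 (fun h : R => cexp (h *: z)) z.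
Proof.
have e (h : R) : cexp (h *: z) = Complex (expR (h * Re z) * cos (h * Im z))
    (expR (h * Re z) * sin (h * Im z)).
  by apply: complex_ext; rewrite /cexp !ReImE.
under [X in is_derive _ _ X _]eq_fun do rewrite e.
apply: is_derive_ReIm => /=; apply: is_derive_eq;
  by rewrite /GRing.scale /= !mul0r expR0 cos0 sin0; ring.
Qed.

(** The numbers cexp (z / n) and 1 + z / n differ by o(1 / n), since z is the
    derivative of h |-> cexp (h z) at 0, and raising to the n-th power multiplies
    this error by at most n expR |z|. *)
Lemma cvg_1DX_cexp (z : C) :
  (fun n : nat => (1 + n.+1%:R^-1 *: z : C) ^+ n.+1 : C) @ \oo --> cexp z.
Proof.
pose a n : C := cexp (n.+1%:R^-1 *: z).
pose b n : C := 1 + n.+1%:R^-1 *: z.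
have aE n : a n ^+ n.+1 = cexp z.
  rewrite /a -cexpMn; congr cexp; apply: complex_ext;
  rewrite -scaler_nat !ReImE mulrA mulfV ?mul1r// pnatr_eq0 //.
have H : (fun n : nat => n.+1%:R *: (a n - b n)) @ \oo --> (0 : C).
  have [d0 d1] := is_derive_cexp0 z.
  have H1 : (fun h : R => h^-1 *: (cexp (h *: z) - 1)) @ 0^' --> z.
    move/cvg_ex : d0 => [l Hl].
    have el : l = z by rewrite -d1 /derive; exact/esym/(cvg_lim (@norm_hausdorff _ _)).
    rewrite el in Hl; apply: cvg_trans Hl; apply: near_eq_cvg; apply: nearW => h /=.
    by rewrite addr0 scaler1 scale0r cexp0.
  have Hu : (fun n : nat => n.+1%:R^-1 : R) @ \oo --> (0 : R)^'.
    move=> A /nbhs_ballP[r /= r0 HA].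
    have /cvgrPdist_lt /(_ _ r0) Hr := @cvg_harmonic R.
    suff : \forall n \near \oo, A (n.+1%:R^-1) by [].
    near=> n; have nz : (n.+1%:R^-1 : R) != 0 by rewrite invr_eq0 pnatr_eq0.
    have bz : ball (0 : R) r n.+1%:R^-1 by rewrite /ball /=; near: n; exact: Hr.
    exact: HA bz nz.
  have H2 : (fun n : nat => (n.+1%:R^-1 : R)^-1 *: (cexp (n.+1%:R^-1 *: z) - 1)) @ \oo --> z.
    exact: cvg_comp Hu H1.
  rewrite -(subrr z); apply: cvg_trans (cvgB H2 (cvg_cst z)).
  apply: near_eq_cvg; apply: nearW => n.
  transitivity (n.+1%:R^-1^-1 *: (cexp (n.+1%:R^-1 *: z) - 1) - z : C) => //.
  rewrite invrK /a /b; have : n.+1%:R != 0 :> R by rewrite pnatr_eq0.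
  by move: (n.+1%:R : R) => N N0; apply: complex_ext; rewrite !ReImE; field.
have Hn : (fun n : nat => expR `|z| * `|n.+1%:R *: (a n - b n)|) @ \oo --> (0 : R).
  rewrite -[X in _ --> X](mulr0 (expR `|z|)); apply: cvgM; first exact: cvg_cst.
  by apply/norm_cvg0P.
apply/cvgrPdist_lt => e e0.
have {}Hn : \forall n \near \oo, expR `|z| * `|n.+1%:R *: (a n - b n)| < e.
  move/cvgrPdist_lt : Hn => /(_ _ e0); apply: filterS => k.
  by rewrite sub0r normrN; apply: le_lt_trans (ler_norm _).
near=> n; rewrite -(aE n).
have n0 : 0 < n.+1%:R :> R by rewrite ltr0n.
apply: (@le_lt_trans _ _ (expR `|z| * `|n.+1%:R *: (a n - b n)|)); last first.
  by near: n; exact: Hn.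
have q1 : 1 <= expR (`|z| / n.+1%:R) :> R.
  by rewrite -[leLHS]expR0 ler_expR divr_ge0.
apply: le_trans (norm_subXX_le n.+1 q1 _ _) _.
- rewrite normC_cexp ler_expR ReZ mulrC ler_wpM2r ?invr_ge0//.
  exact: le_trans (ler_norm _) (Re_le_norm _).
- apply: le_trans (expR_ge1Dx _); rewrite (le_trans (ler_normD _ _))// normC1 lerD2l.
  by rewrite normrZ ger0_norm ?invr_ge0// mulrC.
- rewrite normrZ ger0_norm// -expRM_natl mulrCA mulfV ?gt_eqF// mulr1.
  by rewrite mulrCA mulrA.
Unshelve. all: by end_near. Qed.

(** The functions phi * (1 + rho / n)^n are positive and tend boundedly to
    phi * exp rho. *)
Lemma psdM_cexp rho phi : multiplier rho -> psd tau phi ->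
  psd tau (fun t => phi t * cexp (rho t) : C).
Proof.
move=> mrho pphi; have [[M HM] _] := mrho; have [_ [M' HM'] _] := pphi.
have M0 : 0 <= M by apply: le_trans (HM 0).
apply: (@psd_lim (fun n t => phi t * (1 + n.+1%:R^-1 *: rho t : C) ^+ n.+1 : C) _
  (M' * expR M)).
- by move=> n; apply: psdMX => //; apply: multiplier_1D; rewrite ?invr_ge0.
- move=> n t; rewrite normCM ler_pM// normCX.
  rewrite -[M in leRHS](@mulfVK _ n.+1%:R) ?pnatr_eq0// mulrC expRM_natl.
  rewrite lerXn2r ?nnegrE ?expR_ge0//; apply: le_trans (expR_ge1Dx _).
  rewrite (le_trans (ler_normD _ _))// normC1 lerD2l normrZ ger0_norm ?invr_ge0//.
  by rewrite mulrC ler_wpM2r ?invr_ge0.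
- move=> t; have H := @cvg_1DX_cexp (rho t).
  apply: cvgC_ReIm; [under eq_fun do rewrite ReM|under eq_fun do rewrite ImM].
    by rewrite ReM; apply: cvgB; apply: cvgM; try exact: cvg_cst;
      [exact: cvg_Re H|exact: cvg_Im H].
  by rewrite ImM; apply: cvgD; apply: cvgM; try exact: cvg_cst;
    [exact: cvg_Im H|exact: cvg_Re H].
Qed.

End fixed_width.
End positive_definite.

(** * The integrand and its derivatives in t *)

Section trigonometric_bounds.
Variable R : realType.
Implicit Types u x t : R.

(** Each of the bounds below follows from the previous ones by this inequality;
    the constants are not optimal. *)
Lemma mean_value_bound (F f : R -> R) (K u : R) :
  (forall x : R, is_derive x 1 F (f x)) -> F 0 = 0 ->
  (forall c, `|c| <= `|u| -> `|f c| <= K) -> `|F u| <= K * `|u|.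
Proof.
move=> dF F0 fK.
have cF (A : set R) : {within A, continuous F}.
  apply: continuous_subspaceT => x.
  by apply/differentiable_continuous/derivable1_diffP; have [] := dF x.
have [u0|u0] := leP 0 u.
  have [c] := @MVT_segment _ F f 0 u u0 (fun x _ => dF x) (cF _).
  rewrite in_itv /= F0 !subr0 => /andP[c0 cu] ->; rewrite normrM ler_wpM2r//.
  by apply: fK; rewrite !ger0_norm.
have [c] := @MVT_segment _ F f u 0 (ltW u0) (fun x _ => dF x) (cF _).
rewrite in_itv /= F0 !sub0r => /andP[cu c0] e.
rewrite -normrN e mulrN normrN normrM ler_wpM2r//.
by apply: fK; rewrite !ler0_norm ?lerN2// ltW.
Qed.

Lemma norm_sin_le u : `|sin u| <= `|u|.
Proof.
rewrite -[leRHS]mul1r; apply: (mean_value_bound (f := @cos R)).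
- exact: sin0.
- by move=> c _; exact: cos_max.
Qed.

Lemma is_derive_cosB1 x : is_derive x 1 (fun u : R => cos u - 1) (- sin x).
Proof. by apply: is_derive_eq; rewrite /GRing.scale /=; ring. Qed.

Lemma norm_cosB1_le1 u : `|cos u - 1| <= `|u|.
Proof.
rewrite -[leRHS]mul1r; apply: (mean_value_bound (F := fun u => cos u - 1) (f := fun x => - sin x)).
- exact: is_derive_cosB1.
- by rewrite cos0 subrr.
- by move=> c _; rewrite normrN sin_max.
Qed.

Lemma norm_cosB1_le u : `|cos u - 1| <= u ^+ 2.
Proof.
rewrite -(real_normK (num_real u)) expr2.
apply: (mean_value_bound (F := fun u => cos u - 1) (f := fun x => - sin x)).
- exact: is_derive_cosB1.
- by rewrite cos0 subrr.
- by move=> c cu; rewrite normrN; exact: le_trans (norm_sin_le _) cu.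
Qed.

Lemma norm_sinB_le2 u : `|sin u - u| <= u ^+ 2.
Proof.
rewrite -(real_normK (num_real u)) expr2.
apply: (mean_value_bound (F := fun u => sin u - u) (f := fun x => cos x - 1)).
- by rewrite sin0 subrr.
- by move=> c cu; exact: le_trans (norm_cosB1_le1 _) cu.
Qed.

Lemma norm_sinB_le3 u : `|sin u - u| <= `|u| ^+ 3.
Proof.
rewrite exprSr; apply: (mean_value_bound (F := fun u => sin u - u) (f := fun x => cos x - 1)).
- by rewrite sin0 subrr.
- move=> c cu; apply: le_trans (norm_cosB1_le _) _.
  by rewrite -(real_normK (num_real c)) lerXn2r ?nnegrE.
Qed.

Lemma norm_cosB1D_le u : `|cos u - 1 + u ^+ 2 / 2| <= u ^+ 4.
Proof.
have -> : u ^+ 4 = `|u| ^+ 3 * `|u|.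
  by rewrite -exprSr (exprM _ 2 2) -(real_normK (num_real u)) -exprM.
apply: (mean_value_bound (F := fun u => cos u - 1 + u ^+ 2 / 2)
  (f := fun x => - (sin x - x))).
- by move=> x; apply: is_derive_eq; rewrite /GRing.scale /=; field.
- by rewrite cos0 subrr expr0n /= mul0r addr0.
- move=> c cu; rewrite normrN; apply: le_trans (norm_sinB_le3 _) _.
  by rewrite lerXn2r ?nnegrE.
Qed.

End trigonometric_bounds.

Section levy_khintchine_integrand.
Variable R : realType.
Implicit Types t x : R.

Definition LK_integrand' t x : Rcomplex R :=
  if x == 0 then Complex (- t) 0
  else ((1 + x ^+ 2) / x ^+ 2) *:
    (Complex (- (x * sin (t * x))) (x * cos (t * x) - sin x) : Rcomplex R).

Definition LK_integrand'' t x : Rcomplex R := - ((1 + x ^+ 2) *: expi (t * x)).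

Lemma Re_LK t x : Re (LK_integrand t x) = if x == 0 then - (t ^+ 2 / 2)
  else (1 + x ^+ 2) / x ^+ 2 * (cos (t * x) - 1).
Proof.
rewrite /LK_integrand; case: eqP => // _; rewrite ReZ !ReB /=; ring.
Qed.

Lemma Im_LK t x : Im (LK_integrand t x) = if x == 0 then 0
  else (1 + x ^+ 2) / x ^+ 2 * (sin (t * x) - t * sin x).
Proof.
rewrite /LK_integrand; case: eqP => // _; rewrite ImZ !ImB /=; ring.
Qed.

Lemma Re_LK' t x : Re (LK_integrand' t x) = if x == 0 then - t
  else (1 + x ^+ 2) / x ^+ 2 * - (x * sin (t * x)).
Proof. by rewrite /LK_integrand'; case: eqP => // _; rewrite ReZ. Qed.

Lemma Im_LK' t x : Im (LK_integrand' t x) = if x == 0 then 0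
  else (1 + x ^+ 2) / x ^+ 2 * (x * cos (t * x) - sin x).
Proof. by rewrite /LK_integrand'; case: eqP => // _; rewrite ImZ. Qed.

Lemma is_derive_Re_LK t x :
  is_derive t 1 (fun t => Re (LK_integrand t x)) (Re (LK_integrand' t x)).
Proof.
under [X in is_derive _ _ X _]eq_fun do rewrite Re_LK.
rewrite Re_LK'; case: eqP => [x0|/eqP x0].
  by apply: is_derive_eq; rewrite /GRing.scale /=; field.
by apply: is_derive_eq; rewrite /GRing.scale /=; field.
Qed.

Lemma is_derive_Im_LK t x :
  is_derive t 1 (fun t => Im (LK_integrand t x)) (Im (LK_integrand' t x)).
Proof.
under [X in is_derive _ _ X _]eq_fun do rewrite Im_LK.
rewrite Im_LK'; case: eqP => [x0|/eqP x0].
  exact: is_derive_cst.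
by apply: is_derive_eq; rewrite /GRing.scale /=; field.
Qed.

Lemma is_derive_Re_LK' t x :
  is_derive t 1 (fun t => Re (LK_integrand' t x)) (Re (LK_integrand'' t x)).
Proof.
under [X in is_derive _ _ X _]eq_fun do rewrite Re_LK'.
rewrite /LK_integrand'' ReN ReZ /=; case: eqP => [->|/eqP x0].
  by apply: is_derive_eq; rewrite /GRing.scale /= mulr0 cos0; ring.
by apply: is_derive_eq; rewrite /GRing.scale /=; field.
Qed.

Lemma is_derive_Im_LK' t x :
  is_derive t 1 (fun t => Im (LK_integrand' t x)) (Im (LK_integrand'' t x)).
Proof.
under [X in is_derive _ _ X _]eq_fun do rewrite Im_LK'.
rewrite /LK_integrand'' ImN ImZ /=; case: eqP => [->|/eqP x0].
  by apply: is_derive_eq; rewrite ?mulr0 ?sin0 ?mulr0 ?oppr0.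
by apply: is_derive_eq; rewrite /GRing.scale /=; field.
Qed.

Lemma oneDsqr_gt0 x : 0 < 1 + x ^+ 2.
Proof. by rewrite ltr_wpDr ?sqr_ge0. Qed.

(** The singular factor (1 + x^2) / x^2 of the integrand is harmless in front of
    anything of order x^2. *)
Lemma ratio_bound x (a C : R) : x != 0 -> `|a| <= C * x ^+ 2 ->
  `|(1 + x ^+ 2) / x ^+ 2 * a| <= C * (1 + x ^+ 2).
Proof.
move=> x0 aC; have x20 : 0 < x ^+ 2 by rewrite exprn_even_gt0.
have d0 := ltW (oneDsqr_gt0 x).
rewrite normrM ger0_norm ?divr_ge0// ?sqr_ge0// mulrAC ler_pdivrMr//.
by rewrite mulrC mulrAC ler_wpM2r.
Qed.

Lemma Re_LK_bound t x : `|Re (LK_integrand t x)| <= t ^+ 2 * (1 + x ^+ 2).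
Proof.
rewrite Re_LK; case: eqP => [->|/eqP x0].
  rewrite expr0n /= addr0 mulr1 normrN ger0_norm ?divr_ge0 ?sqr_ge0//.
  by rewrite ler_piMr ?sqr_ge0// invf_le1// ler1n.
by apply: ratio_bound => //; rewrite -exprMn norm_cosB1_le.
Qed.

Lemma Im_LK_bound t x : `|Im (LK_integrand t x)| <= (t ^+ 2 + `|t|) * (1 + x ^+ 2).
Proof.
rewrite Im_LK; case: eqP => [->|/eqP x0].
  by rewrite normr0 mulr_ge0 ?addr_ge0 ?sqr_ge0.
apply: ratio_bound => //.
have -> : sin (t * x) - t * sin x = (sin (t * x) - t * x) - t * (sin x - x) by ring.
rewrite (le_trans (ler_normB _ _))// mulrDl lerD//.
  by rewrite -exprMn norm_sinB_le2.
by rewrite normrM ler_wpM2l// norm_sinB_le2.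
Qed.

Lemma Re_LK'_bound t x : `|Re (LK_integrand' t x)| <= `|t| * (1 + x ^+ 2).
Proof.
rewrite Re_LK'; case: eqP => [->|/eqP x0].
  by rewrite expr0n /= addr0 mulr1 normrN.
apply: ratio_bound => //; rewrite normrN normrM -(real_normK (num_real x)) expr2 mulrCA.
by rewrite ler_wpM2l// -normrM norm_sin_le.
Qed.

Lemma Im_LK'_bound t x : `|Im (LK_integrand' t x)| <= (`|t| + 1) * (1 + x ^+ 2).
Proof.
rewrite Im_LK'; case: eqP => [->|/eqP x0].
  by rewrite normr0 mulr_ge0 ?addr_ge0 ?sqr_ge0.
apply: ratio_bound => //.
have -> : x * cos (t * x) - sin x = x * (cos (t * x) - 1) - (sin x - x) by ring.
rewrite (le_trans (ler_normB _ _))// mulrDl lerD//.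
  rewrite normrM -(real_normK (num_real x)) expr2 mulrCA ler_wpM2l// -normrM.
  exact: norm_cosB1_le1.
by rewrite mul1r norm_sinB_le2.
Qed.

Lemma Re_LK''_bound t x : `|Re (LK_integrand'' t x)| <= 1 + x ^+ 2.
Proof.
have d0 := ltW (oneDsqr_gt0 x).
by rewrite ReN ReZ normrN normrM ger0_norm// ler_piMr// cos_max.
Qed.

Lemma Im_LK''_bound t x : `|Im (LK_integrand'' t x)| <= 1 + x ^+ 2.
Proof.
have d0 := ltW (oneDsqr_gt0 x).
by rewrite ImN ImZ normrN normrM ger0_norm// ler_piMr// sin_max.
Qed.

Lemma Re_LK_le0 t x : Re (LK_integrand t x) <= 0.
Proof.
rewrite Re_LK; case: eqP => [_|_].
  by rewrite oppr_le0 divr_ge0 ?sqr_ge0.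
have d0 := ltW (oneDsqr_gt0 x).
by rewrite mulr_ge0_le0 ?divr_ge0 ?sqr_ge0// subr_le0 cos_le1.
Qed.

(** The factor of (1 + x^2) / x^2 differs from - (t x)^2 / 2 by O(x^4) in its real
    part and by O(x^3) in its imaginary part. *)
Lemma LK_integrand_cvg0 t :
  (fun n : nat => LK_integrand t n.+1%:R^-1) @ \oo --> LK_integrand t 0.
Proof.
have h0 n : (n.+1%:R^-1 : R) != 0 by rewrite invr_eq0 pnatr_eq0.
have h1 n : 0 <= (n.+1%:R^-1 : R) <= 1.
  by rewrite invr_ge0 ler0n invf_le1 ?ltr0n// ler1n.
have sq (K : R) (u : nat -> R) (l : R) : (forall n, `|l - u n| <= K * n.+1%:R^-1) ->
    u @ \oo --> l.
  move=> H; apply/cvgrPdist_le => e e0.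
  have : (fun n => K * n.+1%:R^-1) @ \oo --> (0 : R).
    by rewrite -[X in _ --> X](mulr0 K); apply: cvgM; [exact: cvg_cst|exact: cvg_harmonic].
  move=> /cvgrPdist_le /(_ _ e0); apply: filterS => n; rewrite sub0r normrN => Hn.
  exact: le_trans (H n) (le_trans (ler_norm _) Hn).
apply: cvgC_ReIm.
  apply: (sq (2 * t ^+ 4 + t ^+ 2)) => n.
  have := h0 n; have := h1 n; move: (n.+1%:R^-1 : R) => h /andP[hge0 hle1] hn0.
  rewrite !Re_LK eqxx (negbTE hn0).
  have -> : - (t ^+ 2 / 2) - (1 + h ^+ 2) / h ^+ 2 * (cos (t * h) - 1) =
     t ^+ 2 / 2 * h ^+ 2 -
     (1 + h ^+ 2) / h ^+ 2 * (cos (t * h) - 1 + (t * h) ^+ 2 / 2) by field.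
  have hh : h ^+ 2 <= h by rewrite expr2 ler_piMr.
  rewrite (addrC (2 * t ^+ 4)) [leRHS]mulrDl (le_trans (ler_normB _ _))// lerD//.
    have t20 : 0 <= t ^+ 2 / 2 by rewrite divr_ge0 ?sqr_ge0.
    rewrite ger0_norm; last by rewrite mulr_ge0 ?sqr_ge0.
    apply: ler_pM => //; first exact: sqr_ge0.
    by rewrite ler_piMr ?sqr_ge0// invf_le1// ler1n.
  apply: (@le_trans _ _ (t ^+ 4 * h ^+ 2 * (1 + h ^+ 2))).
    apply: ratio_bound => //; rewrite -mulrA -exprD -exprMn; exact: norm_cosB1D_le.
  have -> : 2 * t ^+ 4 * h = t ^+ 4 * h * 2 by ring.
  apply: ler_pM.
  - by rewrite mulr_ge0 ?sqr_ge0// exprn_even_ge0.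
  - exact: ltW (oneDsqr_gt0 h).
  - by rewrite ler_wpM2l// exprn_even_ge0.
  - by rewrite -[2]/(1 + 1) lerD2l (le_trans hh).
apply: (sq (2 * (`|t| ^+ 3 + `|t|))) => n.
have := h0 n; have := h1 n; move: (n.+1%:R^-1 : R) => h /andP[hge0 hle1] hn0.
rewrite !Im_LK eqxx (negbTE hn0) sub0r normrN.
apply: (@le_trans _ _ ((`|t| ^+ 3 + `|t|) * h * (1 + h ^+ 2))).
  apply: ratio_bound => //.
  have -> : sin (t * h) - t * sin h = (sin (t * h) - t * h) - t * (sin h - h) by ring.
  rewrite -mulrA -exprS mulrDl (le_trans (ler_normB _ _))// lerD//.
    by apply: le_trans (norm_sinB_le3 _) _; rewrite normrM exprMn (ger0_norm hge0).
  rewrite normrM ler_wpM2l//; apply: le_trans (norm_sinB_le3 _) _.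
  by rewrite (ger0_norm hge0).
have -> : 2 * (`|t| ^+ 3 + `|t|) * h = (`|t| ^+ 3 + `|t|) * h * 2 by ring.
rewrite ler_wpM2l//; first by rewrite mulr_ge0// addr_ge0// exprn_ge0.
by rewrite -[2]/(1 + 1) lerD2l expr_le1.
Qed.

Lemma measurable_oneDsqr d (T : measurableType d) (X : T -> R) :
  measurable_fun setT X -> measurable_fun setT (fun y => 1 + X y ^+ 2).
Proof. by move=> mX; apply: measurable_funD => //; exact: measurable_funX. Qed.

End levy_khintchine_integrand.

(** * The exponent of a single positive measure *)

(** With the value 0 at 0, the inverse is discontinuous there, but it is the limit
    of the continuous functions v / (v^2 + 1 / n). *)
Lemma measurable_invr (R : realType) : measurable_fun [set: R] (fun v : R => v^-1).
Proof.
apply: (@measurable_fun_cvg _ _ _ setT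
  (fun n (v : R) => v * (v ^+ 2 + n.+1%:R^-1)^-1)).
- move=> n; apply: measurable_funM => //.
  apply: continuous_measurable_fun => v; apply: cvgV.
    by rewrite gt_eqF// ltr_wpDl ?sqr_ge0// invr_gt0.
  apply: cvgD; last exact: cvg_cst.
  exact: exprn_continuous.
- move=> v _; have [->|v0] := eqVneq v 0.
    by under eq_fun do rewrite mul0r; rewrite invr0; exact: cvg_cst.
  have -> : v^-1 = v * (v ^+ 2 + 0)^-1 by field.
  apply: cvgM; first exact: cvg_cst.
  apply: cvgV; first by rewrite addr0 expf_neq0.
  by apply: cvgD; [exact: cvg_cst|exact: cvg_harmonic].
Qed.

Section levy_khintchine_exponent.
Context (R : realType) d (Y : measurableType d).
Variable m : {sigma_finite_measure set Y -> \bar R}.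
Variable X : Y -> R.
Hypothesis mX : measurable_fun setT X.
Hypothesis moment2 : m.-integrable setT (EFin \o (fun y => 1 + X y ^+ 2)).
Local Notation C := (Rcomplex R).
Implicit Types t : R.

Lemma moment2_finite : (m setT < +oo)%E.
Proof.
have /integrableP[_] := moment2; apply: le_lt_trans.
rewrite -[leLHS]mul1e -integral_cst//; apply: ge0_le_integral => //=.
- apply/measurable_EFinP; apply: measurableT_comp => //.
  exact: measurable_oneDsqr.
- by move=> y _; rewrite lee_fin ger0_norm ?(ltW (oneDsqr_gt0 _))// lerDl sqr_ge0.
Qed.

Let measurable_if0 (a : R) (g : R -> R) : measurable_fun setT g ->
  measurable_fun setT (fun x : R => if x == 0 then a else (1 + x ^+ 2) / x ^+ 2 * g x).
Proof.
move=> mg; apply: measurable_fun_ifT => //; first exact: measurable_fun_eqr.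
apply: measurable_funM => //; apply: measurable_funM.
  by apply: measurable_funD => //; exact: measurable_funX.
apply: (@measurableT_comp _ _ _ _ _ _ (fun v : R => v^-1)); first exact: measurable_invr.
exact: measurable_funX.
Qed.

Let mcos t : measurable_fun setT (fun x => cos (t * x)).
Proof. by apply: (measurableC_expi _).1; exact: measurable_funM. Qed.

Let msin t : measurable_fun setT (fun x => sin (t * x)).
Proof. by apply: (measurableC_expi (measurable_funM _ _)).2. Qed.

Let msin1 : measurable_fun setT (@sin R).
Proof. by apply: continuous_measurable_fun; exact: continuous_sin. Qed.

Lemma measurableC_LK t : measurableC (fun x : R => LK_integrand t x).
Proof.
split; [under eq_fun do rewrite Re_LK|under eq_fun do rewrite Im_LK]; apply: measurable_if0.
  exact: measurable_funB.
by apply: measurable_funB => //; exact: measurable_funM.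
Qed.

Lemma measurableC_LK' t : measurableC (fun x : R => LK_integrand' t x).
Proof.
split; [under eq_fun do rewrite Re_LK'|under eq_fun do rewrite Im_LK']; apply: measurable_if0.
  by apply: measurableT_comp => //; exact: measurable_funM.
by apply: measurable_funB => //; exact: measurable_funM.
Qed.

Lemma measurableC_LK'' t : measurableC (fun x : R => LK_integrand'' t x).
Proof.
have m1 : measurable_fun setT (fun x : R => 1 + x ^+ 2).
  by apply: measurable_oneDsqr; exact: measurable_idR.
have [mc ms] := (measurable_funM m1 (mcos t), measurable_funM m1 (msin t)).
split; rewrite /LK_integrand''.
  by under eq_fun do rewrite ReN ReZ; exact: measurableT_comp.
by under eq_fun do rewrite ImN ImZ; exact: measurableT_comp.
Qed.

Lemma integrable_moment2 (c : R) :
  m.-integrable setT (EFin \o (fun y => c * (1 + X y ^+ 2))).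
Proof. by have := integrableZl measurableT c moment2; exact: eq_integrable. Qed.

Let integrable_comp (c : R) (g : R -> R) : measurable_fun setT g ->
  (forall x, `|g x| <= c * (1 + x ^+ 2)) -> m.-integrable setT (EFin \o (g \o X)).
Proof.
move=> mg gc; apply: (le_integrableT (integrable_moment2 c)); last by move=> y; exact: gc.
exact: measurableT_comp.
Qed.

Lemma integrable_Re_LK t : m.-integrable setT (EFin \o (fun y => Re (LK_integrand t (X y)))).
Proof. exact: (integrable_comp (measurableC_LK t).1 (Re_LK_bound t)). Qed.

Lemma integrable_Im_LK t : m.-integrable setT (EFin \o (fun y => Im (LK_integrand t (X y)))).
Proof. exact: (integrable_comp (measurableC_LK t).2 (Im_LK_bound t)). Qed.

Lemma integrable_Re_LK' t : m.-integrable setT (EFin \o (fun y => Re (LK_integrand' t (X y)))).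
Proof. exact: (integrable_comp (measurableC_LK' t).1 (Re_LK'_bound t)). Qed.

Lemma integrable_Im_LK' t : m.-integrable setT (EFin \o (fun y => Im (LK_integrand' t (X y)))).
Proof. exact: (integrable_comp (measurableC_LK' t).2 (Im_LK'_bound t)). Qed.

(** The exponent of the image of m under X.  Keeping X apart from m allows the
    truncation in [psd_LK] to modify X alone. *)
Definition LKint t : C := cintegral m (fun y => LK_integrand t (X y)).
Definition LKint' t : C := cintegral m (fun y => LK_integrand' t (X y)).
Definition LKint'' t : C := cintegral m (fun y => LK_integrand'' t (X y)).

Let near_bound (a t : R) : a - 1 < t < a + 1 -> `|t| <= `|a| + 1.
Proof.
move=> /andP[a1 a2]; have -> : t = a + (t - a) by ring.
by rewrite (le_trans (ler_normD _ _))// lerD2l ler_norml; apply/andP; split; lra.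
Qed.

Lemma is_derive_LKint t : is_derive t 1 LKint (LKint' t).
Proof.
apply: is_derive_ReIm => /=.
  apply: (@is_derive_Rintegral _ _ _ m (fun s y => Re (LK_integrand s (X y)))
    (fun s y => Re (LK_integrand' s (X y))) (fun y => (`|t| + 1) * (1 + X y ^+ 2))).
  - exact: integrable_Re_LK.
  - by move=> s y; exact: is_derive_Re_LK.
  - exact: integrable_moment2.
  - move=> s y /near_bound st; apply: le_trans (Re_LK'_bound _ _) _.
    by rewrite ler_wpM2r// ltW// oneDsqr_gt0.
apply: (@is_derive_Rintegral _ _ _ m (fun s y => Im (LK_integrand s (X y)))
  (fun s y => Im (LK_integrand' s (X y))) (fun y => (`|t| + 1 + 1) * (1 + X y ^+ 2))).
- exact: integrable_Im_LK.
- by move=> s y; exact: is_derive_Im_LK.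
- exact: integrable_moment2.
- move=> s y /near_bound st; apply: le_trans (Im_LK'_bound _ _) _.
  by rewrite ler_wpM2r ?lerD2r// ltW// oneDsqr_gt0.
Qed.

Lemma is_derive_LKint' t : is_derive t 1 LKint' (LKint'' t).
Proof.
apply: is_derive_ReIm => /=.
  apply: (@is_derive_Rintegral _ _ _ m (fun s y => Re (LK_integrand' s (X y)))
    (fun s y => Re (LK_integrand'' s (X y))) (fun y => 1 + X y ^+ 2)) => //.
  - exact: integrable_Re_LK'.
  - by move=> s y; exact: is_derive_Re_LK'.
  - by move=> s y _; exact: Re_LK''_bound.
apply: (@is_derive_Rintegral _ _ _ m (fun s y => Im (LK_integrand' s (X y)))
  (fun s y => Im (LK_integrand'' s (X y))) (fun y => 1 + X y ^+ 2)) => //.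
- exact: integrable_Im_LK'.
- by move=> s y; exact: is_derive_Im_LK'.
- by move=> s y _; exact: Im_LK''_bound.
Qed.

Lemma LKint0 : LKint 0 = 0.
Proof.
apply: complex_ext; rewrite /LKint /=.
  rewrite (@eq_Rintegral _ _ _ _ _ (fun=> 0)) ?Rintegral_cst ?mul0r//.
  move=> y _; rewrite Re_LK; case: eqP => _.
    by rewrite expr0n /= mul0r oppr0.
  by rewrite mul0r cos0 subrr mulr0.
rewrite (@eq_Rintegral _ _ _ _ _ (fun=> 0)) ?Rintegral_cst ?mul0r//.
by move=> y _; rewrite Im_LK; case: eqP => // _; rewrite !mul0r sin0 subrr mulr0.
Qed.

Lemma LKintN t : LKint (- t) = conjc (LKint t).
Proof.
apply: complex_ext; rewrite ?Re_conj ?Im_conj /LKint /=.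
  apply: eq_Rintegral => y _; rewrite !Re_LK; case: eqP => _; first by rewrite sqrrN.
  by rewrite mulNr cosN.
rewrite -[RHS]mulN1r -RintegralZl//; last exact: integrable_Im_LK.
apply: eq_Rintegral => y _; rewrite !Im_LK; case: eqP => _; first by rewrite mulr0.
by rewrite mulNr sinN; ring.
Qed.

Lemma Re_LKint_le0 t : Re (LKint t) <= 0.
Proof.
rewrite /LKint /= -oppr_ge0 -mulN1r -RintegralZl//; last exact: integrable_Re_LK.
by apply: Rintegral_ge0 => y _; rewrite mulN1r oppr_ge0 Re_LK_le0.
Qed.

(** At t = 1 the centering term t sin x makes the imaginary part vanish; this is
    what identifies the drift with the argument at 1. *)
Lemma Im_LKint1 : Im (LKint 1) = 0.
Proof.
rewrite /LKint /= (@eq_Rintegral _ _ _ _ _ (fun=> 0)) ?Rintegral_cst ?mul0r//.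
by move=> y _; rewrite Im_LK; case: eqP => // _; rewrite !mul1r subrr mulr0.
Qed.

Lemma continuous_LKint : continuous LKint.
Proof.
by move=> t; exact: is_derive_continuousC (is_derive_LKint t).
Qed.

End levy_khintchine_exponent.

(** * Positivity of the exponential of the exponent *)

Lemma cvg_cexp (R : realType) T (F : set_system T) {FF : Filter F}
  (h : T -> Rcomplex R) (l : Rcomplex R) :
  h @ F --> l -> (fun t => cexp (h t)) @ F --> cexp l.
Proof.
move=> hl.
have hr : (fun t => Re (h t)) @ F --> Re l by exact: cvg_Re.
have hi : (fun t => Im (h t)) @ F --> Im l by exact: cvg_Im.
have he := cvg_comp _ _ hr (@continuous_expR R (Re l)).
have hc := cvg_comp _ _ hi (@continuous_cos R (Im l)).
have hs := cvg_comp _ _ hi (@continuous_sin R (Im l)).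
apply: cvgC_ReIm.
  by under eq_fun do rewrite /cexp ReZ; rewrite /cexp ReZ; exact: cvgM.
by under eq_fun do rewrite /cexp ImZ; rewrite /cexp ImZ; exact: cvgM.
Qed.

Section levy_khintchine_positivity.
Context (R : realType) d (Y : measurableType d).
Variable m : {sigma_finite_measure set Y -> \bar R}.
Local Notation C := (Rcomplex R).
Variables (tau a : R).
Hypotheses (tau0 : 0 < tau) (a0 : 0 <= a).

(** Away from 0 the exponent is, up to constants and a drift, the
    characteristic function of a finite measure (the compound Poisson case). *)
Lemma psdM_LK_away (X : Y -> R) (delta : R) (phi : R -> C) :
  measurable_fun setT X -> m.-integrable setT (EFin \o (fun y => 1 + X y ^+ 2)) ->
  0 < delta -> (forall y, delta <= `|X y|) -> psd tau phi ->
  psd tau (fun t => phi t * cexp (a *: LKint m X t) : C).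
Proof.
move=> mX moment2 d0 dX pphi.
have mfin := moment2_finite mX moment2.
have X0 y : X y != 0 by rewrite -normr_gt0 (lt_le_trans d0).
pose w y := a * ((1 + X y ^+ 2) / X y ^+ 2).
have w0 y : 0 <= w y.
  by rewrite mulr_ge0// divr_ge0 ?sqr_ge0// ltW// oneDsqr_gt0.
have mw : measurable_fun setT w.
  apply: measurable_funM => //; apply: measurable_funM; first exact: measurable_oneDsqr.
  apply: (@measurableT_comp _ _ _ _ _ _ (fun v : R => v^-1)); first exact: measurable_invr.
  exact: measurable_funX.
have iw : m.-integrable setT (EFin \o w).
  apply: (@bounded_integrableT _ _ _ _ _ (a * (1 + (delta ^+ 2)^-1))) => // y.
  rewrite ger0_norm// ler_wpM2l// mulrDl mulfV ?expf_neq0// mul1r addrC lerD2l.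
  have X2 : 0 < X y ^+ 2 by rewrite exprn_even_gt0//= X0.
  have d2 : 0 < delta ^+ 2 by rewrite exprn_gt0.
  rewrite lef_pV2 ?posrE//.
  by rewrite -(real_normK (num_real (X y))) lerXn2r ?nnegrE// ltW.
have msX : measurable_fun setT (fun y => sin (X y)) by exact: (measurableC_expi mX).2.
pose c := \int[m]_y w y.
pose s := \int[m]_y (w y * sin (X y)).
have isX : m.-integrable setT (EFin \o (fun y => w y * sin (X y))).
  apply: (le_integrableT iw); first exact: measurable_funM.
  by move=> y; rewrite normrM (ger0_norm (w0 y)) ler_piMr// sin_max.
have mtX t : measurable_fun setT (fun y => t * X y) by exact: measurable_funM.
have ic t : m.-integrable setT (EFin \o (fun y => w y * cos (t * X y))).
  apply: (le_integrableT iw).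
    by apply: measurable_funM => //; exact: (measurableC_expi (mtX t)).1.
  by move=> y; rewrite normrM (ger0_norm (w0 y)) ler_piMr// cos_max.
have isn t : m.-integrable setT (EFin \o (fun y => w y * sin (t * X y))).
  apply: (le_integrableT iw).
    by apply: measurable_funM => //; exact: (measurableC_expi (mtX t)).2.
  by move=> y; rewrite normrM (ger0_norm (w0 y)) ler_piMr// sin_max.
have its t : m.-integrable setT (EFin \o (fun y => t * (w y * sin (X y)))).
  by have := integrableZl measurableT t isX; exact: eq_integrable.
have E t : a *: LKint m X t = weighted_cf m w X t + Complex (- c) (t * - s) :> C.
  apply: complex_ext.
    rewrite ReZ ReD /= -RintegralZl//; last exact: integrable_Re_LK.
    rewrite /c -RintegralB//; apply: eq_Rintegral => y _.
    by rewrite Re_LK (negbTE (X0 y)) /w; ring.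
  rewrite ImZ ImD /= -RintegralZl//; last exact: integrable_Im_LK.
  rewrite mulrN /s -RintegralZl// -RintegralB//; apply: eq_Rintegral => y _.
  by rewrite Im_LK (negbTE (X0 y)) /w; ring.
have -> : (fun t => phi t * cexp (a *: LKint m X t) : C) =
    (fun t => expR (- c) *: ((phi t * cexp (weighted_cf m w X t)) * expi (t * - s)) : C).
  apply/funext => t; rewrite E cexpD mulrA.
  have -> : cexp (Complex (- c) (t * - s)) = expR (- c) *: expi (t * - s) by [].
  by apply: complex_ext; rewrite !ReImE; ring.
apply: psdZ => //.
apply: psd_expi => //; apply: psdM_cexp => //; split.
  by exists (2 * \int[m]_x w x) => t; exact: weighted_cf_bound.
by move=> f pf; exact: psdM_weighted_cf.
Qed.

(** Moving the values of X near 0 to a point at distance 1 / n of 0 reduces to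
    [psdM_LK_away]; the exponents converge since the integrand is continuous at 0. *)
Lemma psd_LK (X : Y -> R) :
  measurable_fun setT X -> m.-integrable setT (EFin \o (fun y => 1 + X y ^+ 2)) ->
  psd tau (fun t => cexp (a *: LKint m X t)).
Proof.
move=> mX moment2.
pose h (n : nat) : R := n.+1%:R^-1.
have h0 n : 0 < h n by rewrite invr_gt0.
have h1 n : h n <= 1 by rewrite invf_le1// ler1n.
pose Xn n y := if `|X y| <= h n then h n else X y.
have mXn n : measurable_fun setT (Xn n).
  apply: measurable_fun_ifT => //; apply: measurable_fun_ler => //.
  exact: measurableT_comp.
have Xn2 n y : 1 + Xn n y ^+ 2 <= 2 * (1 + X y ^+ 2).
  have X2 := sqr_ge0 (X y).
  rewrite /Xn; case: ifP => _; last by lra.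
  have : h n ^+ 2 <= 1 by rewrite expr_le1// ltW.
  by lra.
have im n : m.-integrable setT (EFin \o (fun y => 1 + Xn n y ^+ 2)).
  apply: (le_integrableT (integrable_moment2 moment2 2)).
    exact: measurable_oneDsqr.
  by move=> y; rewrite ger0_norm ?Xn2// ltW// oneDsqr_gt0.
have cX (y : Y) (t : R) : (fun n => LK_integrand t (Xn n y)) @ \oo --> LK_integrand t (X y).
  have [X0|X0] := eqVneq (X y) 0.
    rewrite X0 (_ : (fun n => _) = fun n => LK_integrand t (h n)).
      exact: LK_integrand_cvg0.
    by apply/funext => n; rewrite /Xn X0 normr0 ltW.
  apply: cvg_near_cst; have /cvgrPdist_lt := @cvg_harmonic R.
  have aX : 0 < `|X y| by rewrite normr_gt0.
  move=> /(_ _ aX); apply: filterS => n.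
  by rewrite sub0r normrN gtr0_norm ?h0// => hn; rewrite /Xn leNgt hn.
apply: (@psd_lim _ _ tau0 (fun n t => cexp (a *: LKint m (Xn n) t)) _ 1).
- move=> n; rewrite (_ : (fun t => _) = fun t => 1 * cexp (a *: LKint m (Xn n) t) : C).
    apply: (psdM_LK_away (mXn n) (im n) (h0 n)); last exact: psd1.
    move=> y; rewrite /Xn; case: ifPn => [_|]; first by rewrite gtr0_norm.
    by rewrite -ltNge => /ltW.
  by apply/funext => t; rewrite mul1r.
- move=> n t; rewrite normC_cexp -[leRHS]expR0 ler_expR ReZ.
  by rewrite mulr_ge0_le0// Re_LKint_le0.
- move=> t; apply: cvg_cexp; apply: cvgC_ReIm.
    under eq_fun do rewrite ReZ; rewrite ReZ; apply: cvgM; first exact: cvg_cst.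
    apply: (@dominated_Rintegral_cvg _ _ _ _ _ _ (fun y => t ^+ 2 * 2 * (1 + X y ^+ 2))).
    + by move=> n; exact: integrable_measurable (integrable_Re_LK (mXn n) (im n) t).
    + by move=> y; apply: cvg_Re; exact: cX.
    + exact: integrable_moment2.
    + move=> n y; apply: le_trans (Re_LK_bound _ _) _.
      by rewrite -mulrA ler_wpM2l// sqr_ge0.
  under eq_fun do rewrite ImZ; rewrite ImZ; apply: cvgM; first exact: cvg_cst.
  apply: (@dominated_Rintegral_cvg _ _ _ _ _ _ (fun y => (t ^+ 2 + `|t|) * 2 * (1 + X y ^+ 2))).
  + by move=> n; exact: integrable_measurable (integrable_Im_LK (mXn n) (im n) t).
  + by move=> y; apply: cvg_Im; exact: cX.
  + exact: integrable_moment2.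
  + move=> n y; apply: le_trans (Im_LK_bound _ _) _.
    by rewrite -mulrA ler_wpM2l// addr_ge0// sqr_ge0.
Qed.

End levy_khintchine_positivity.

(** * Distribution functions from probabilities and densities *)

Section distribution_of_probability.
Context {R : realType} (P : probability (measurableTypeR R) R).
Local Open Scope measure_display_scope.

Let idTR : measurableTypeR R -> R := idfun.

#[local] HB.instance Definition _ :=
  @isMeasurableFun.Build _ _ _ _ idTR (@measurable_id _ _ setT).

Let fcdf r := fine (cdf (idTR : {RV P >-> R}) r).

Let fcdf_nd : nondecreasing fcdf.
Proof. by move=> *; rewrite fine_le ?fin_num_measure// cdf_nondecreasing. Qed.

Let fcdf_rc : right_continuous fcdf.
Proof.
move=> a; apply: fine_cvg.
by rewrite fineK ?fin_num_measure//; exact: cdf_right_continuous.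
Qed.

#[local] HB.instance Definition _ :=
  isCumulative.Build R _ R fcdf fcdf_nd fcdf_rc.

Let fcdf_Ny0 : fcdf @ -oo --> (0:R).
Proof. exact/fine_cvg/cvg_cdfNy0. Qed.

Let fcdf_y1 : fcdf @ +oo --> (1:R).
Proof. exact/fine_cvg/cvg_cdfy1. Qed.

#[local] HB.instance Definition _ :=
  isCumulativeBounded.Build R 0 1 fcdf fcdf_Ny0 fcdf_y1.

Lemma exists_distribution : exists F : distribution_function R,
  (forall A, measurable A -> lebesgue_stieltjes_measure F A = P A) /\
  (forall x, F x = fine (P `]-oo, x]%classic)).
Proof.
exists fcdf; split=> // A mA.
exact: lebesgue_stieltjes_cdf_id.
Qed.

End distribution_of_probability.

Section density.
Variable R : realType.
Local Notation mu := (@lebesgue_measure R).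
Variable p : R -> R.
Hypothesis mp : measurable_fun setT p.
Hypothesis p0 : forall x, 0 <= p x.
Hypothesis p1 : (\int[mu]_x (p x)%:E = 1)%E.

Let dens (A : set (measurableTypeR R)) : \bar R := (\int[mu]_(x in A) (p x)%:E)%E.

Let ip : mu.-integrable setT (EFin \o p).
Proof.
apply/integrableP; split; first exact/measurable_EFinP.
by under eq_integral do rewrite /= ger0_norm//; rewrite p1 ltry.
Qed.

Let dens0 : dens set0 = 0%E.
Proof. by rewrite /dens integral_set0. Qed.

Let dens_ge0 A : (0 <= dens A)%E.
Proof. by apply: integral_ge0 => x _; rewrite lee_fin. Qed.

Let dens_sigma_additive : semi_sigma_additive dens.
Proof.
move=> /= A mA tA mUA; rewrite /dens integral_bigcup//=; last first.
  exact: (integrableS _ _ (subsetT _)).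
apply: is_cvg_ereal_nneg_natsum_cond => n _ _.
exact: dens_ge0.
Qed.

HB.instance Definition _ := isMeasure.Build _ _ _ dens dens0 dens_ge0 dens_sigma_additive.

Let dens_setT : dens setT = 1%E. Proof. exact: p1. Qed.

HB.instance Definition _ := @Measure_isProbability.Build _ _ R dens dens_setT.

Let dens_dom : dens `<< mu.
Proof.
apply/null_content_dominatesP => A mA muA0; rewrite /dens.
by apply: null_set_integral => //; exact/measurable_funTS/measurable_EFinP.
Qed.

Let integral_dens (g : R -> R) (M : R) : measurable_fun setT g ->
  (forall x, `|g x| <= M) -> \int[dens]_x g x = \int[mu]_x (g x * p x).
Proof.
move=> mg gM; congr fine.
have ig : dens.-integrable setT (EFin \o g).
  apply: (@bounded_integrableT _ _ _ _ _ M) => //.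
  by apply: le_lt_trans (ltry 1); rewrite -dens_setT.
rewrite -(Radon_Nikodym_change_of_variables dens_dom measurableT ig).
apply: ae_eq_integral => //.
- apply: emeasurable_funM; first exact/measurable_EFinP.
  by apply: (measurable_int mu); exact: Radon_Nikodym_integrable.
- by apply/measurable_EFinP; exact: measurable_funM.
- under [X in ae_eq _ _ _ X]eq_fun do rewrite EFinM.
  (* The Radon-Nikodym derivative of dens is almost everywhere p. *)
  apply: ae_eqe_mul2l => /=; rewrite Radon_NikodymE//=.
  case: cid => /= h [h1 h2 h3].
  apply: integral_ae_eq => //=; first exact/measurable_EFinP.
  by move=> E _ mE; rewrite -h3.
Qed.

Lemma exists_distribution_density : exists F : distribution_function R,
  forall (g : R -> R) (M : R), measurable_fun setT g -> (forall x, `|g x| <= M) ->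
    \int[lebesgue_stieltjes_measure F]_x g x = \int[mu]_x (g x * p x).
Proof.
have [F [FP _]] := exists_distribution dens.
exists F => g M mg gM; rewrite -(integral_dens mg gM); congr fine.
by apply: eq_measure_integral => A mA _; exact: FP.
Qed.

End density.

(** * Fourier inversion *)

Section fourier_inversion.
Variable R : realType.
Local Notation mu := (@lebesgue_measure R).
Local Notation C := (Rcomplex R).
Implicit Types (t y u eps : R) (w : C).

Lemma measurable_Re_expi (z : C) u : measurable_fun setT (fun y : R => Re (z * expi (u * y) : C)).
Proof.
apply: (measurableC_mul _ (measurableC_expi _)).1; last exact: measurable_funM.
by split; exact: measurable_cst.
Qed.

Lemma integrable_Re_expi_gw (z : C) u eps : 0 < eps ->
  mu.-integrable setT (EFin \o (fun y => Re (z * expi (u * y) : C) * gw eps y)).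
Proof.
move=> e0; apply: (integrable_mul_bounded (M := `|z|)).
- exact: measurable_Re_expi.
- by move=> v; exact: Re_mul_expi_bound.
- exact: integrable_gw.
Qed.

Lemma Rintegral_Re_expi_gw (z : C) u eps : 0 < eps ->
  \int[mu]_y (Re (z * expi (u * y) : C) * gw eps y) = 2 * pi * Re z * normal_pdf 0 eps u.
Proof.
move=> e0; rewrite -(Rintegral_rexp_gw e0 (Re z) (Im z) u).
by apply: eq_Rintegral => y _; rewrite Re_mul_expi.
Qed.

Lemma Re_mul_Re (a b : C) : Re a * Re b = (Re (a * b : C) + Re (conjc b * a : C)) / 2.
Proof. by rewrite !ReImE; field. Qed.

Lemma gw_cvg1 y : (fun n : nat => gw n.+1%:R^-1 y) @ \oo --> (1 : R).
Proof.
rewrite -[X in _ --> X](gw0 y) (_ : (fun n : nat => _) = fun n : nat => gw y n.+1%:R^-1).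
  by apply: (cvg_comp _ _ (@cvg_harmonic R)); exact: continuous_gw.
by apply/funext => n; rewrite /gw (mulrC y).
Qed.

Section inversion.
Variables (tau M : R) (phi : R -> C).
Hypothesis tau0 : 0 < tau.
Hypothesis mphi : measurableC phi.
Hypothesis phiM : forall t, `|phi t| <= M.

Let weighted (w : C) s : R := Re (w * phi s : C) * gw tau s.

Let measurable_weighted w : measurable_fun setT (weighted w).
Proof.
apply: measurable_funM; last exact: measurable_gw.
by apply: (measurableC_mul _ mphi).1; split; exact: measurable_cst.
Qed.

Let weighted_bound w s : `|weighted w s| <= `|w| * M.
Proof.
rewrite /weighted normrM (ger0_norm (gw_ge0 _ _)).
apply: (@le_trans _ _ (`|w| * `|phi s| * 1)); last by rewrite mulr1 ler_wpM2l.
by rewrite ler_pM ?gw_ge0 ?gw_le1// -normCM Re_le_norm.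
Qed.

Let f (w : C) t eps (y s : measurableTypeR R) : R :=
  Re (phi s * expi (- (s * y)) : C) * gw tau s * (Re (w * expi (t * y) : C) * gw eps y).

Let mf w t eps : measurable_fun setT
  (fun q : measurableTypeR R * measurableTypeR R => f w t eps q.1 q.2).
Proof.
have mfst : measurable_fun setT (fun q : measurableTypeR R * measurableTypeR R => q.1 : R).
  exact: measurable_fst.
have msnd : measurable_fun setT (fun q : measurableTypeR R * measurableTypeR R => q.2 : R).
  exact: measurable_snd.
apply: measurable_funM; apply: measurable_funM.
- apply: (measurableC_mul _ (measurableC_expi _)).1.
    by split; [exact: (measurableT_comp mphi.1 msnd)|exact: (measurableT_comp mphi.2 msnd)].
  by apply: measurableT_comp => //; exact: measurable_funM.
- exact: (measurableT_comp (measurable_gw tau) msnd).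
- exact: (measurableT_comp (measurable_Re_expi w t) mfst).
- exact: (measurableT_comp (measurable_gw eps) mfst).
Qed.

Let f_bound w t eps y s : `|f w t eps y s| <= `|w| * gw eps y * (M * gw tau s).
Proof.
rewrite /f mulrC !normrM !(ger0_norm (gw_ge0 _ _)) ler_pM ?mulr_ge0 ?gw_ge0//.
  by rewrite ler_wpM2r ?gw_ge0// Re_mul_expi_bound.
by rewrite ler_wpM2r ?gw_ge0// (le_trans (Re_mul_expi_bound _ _)).
Qed.

Let integrable_cgw c eps : 0 < eps -> mu.-integrable setT (EFin \o (fun y => c * gw eps y)).
Proof.
move=> e0; have := integrableZl measurableT c (integrable_gw e0).
exact: eq_integrable.
Qed.

Let int_f w t eps y : \int[mu]_s f w t eps y s =
  gauss_fourier tau phi y * (Re (w * expi (t * y) : C) * gw eps y).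
Proof. by rewrite /f RintegralZr//; exact: integrable_gauss_fourier phiM. Qed.

Lemma integrable_gauss_fourier_gw w t eps : 0 < eps ->
  mu.-integrable setT (EFin \o (fun y => gauss_fourier tau phi y *
    (Re (w * expi (t * y) : C) * gw eps y))).
Proof.
move=> e0; have := Rintegral_integrable1 (mf w t eps) (integrable_cgw `|w| e0)
  (integrable_cgw M tau0) (f_bound w t eps).
by apply: eq_integrable => // y _ /=; rewrite -int_f.
Qed.

(** Fubini's theorem gives the measurability of the product with a Gaussian in y,
    which is then divided out. *)
Lemma measurable_gauss_fourier : measurable_fun setT (gauss_fourier tau phi).
Proof.
have := integrable_measurable (integrable_gauss_fourier_gw 1 0 (@ltr01 R)) => m.
rewrite (_ : gauss_fourier tau phi = (fun y => (gauss_fourier tau phi y *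
    (Re ((1 : C) * expi (0 * y) : C) * gw 1 y)) * (gw 1 y)^-1)).
  apply: measurable_funM; first exact: m.
  apply: continuous_measurable_fun => t; apply: cvgV; last exact: continuous_gw.
  by rewrite gt_eqF// gw_gt0.
apply/funext => y; rewrite mul0r expi0 mulr1 mul1r mulfK// gt_eqF// gw_gt0//.
Qed.

(** Fubini against a Gaussian of width eps in y: the inner integral over y is a
    pair of normal densities centred at t and - t. *)
Lemma Rintegral_gauss_fourier_gw w t eps : 0 < eps ->
  \int[mu]_y (gauss_fourier tau phi y * (Re (w * expi (t * y) : C) * gw eps y)) =
  pi * (\int[mu]_s (weighted w s * normal_pdf t eps s) +
        \int[mu]_s (weighted (conjc w) s * normal_pdf (- t) eps s)).
Proof.
move=> e0; under eq_Rintegral do rewrite -int_f.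
rewrite (RFubini (mf w t eps) (integrable_cgw `|w| e0) (integrable_cgw M tau0)
  (f_bound w t eps)).
have iw v x : mu.-integrable setT (EFin \o (fun s => weighted v s * normal_pdf x eps s)).
  apply: (integrable_mul_bounded (M := `|v| * M)) => //.
  exact: integrable_normal_pdf.
rewrite -RintegralD// -RintegralZl//; last first.
  by have := integrableD measurableT (iw w t) (iw (conjc w) (- t)); exact: eq_integrable.
apply: eq_Rintegral => s _.
transitivity (gw tau s * \int[mu]_y (1 / 2 *
   (Re ((phi s * w) * expi ((t - s) * y) : C) * gw eps y +
    Re ((conjc w * phi s) * expi ((- t - s) * y) : C) * gw eps y))).
  rewrite -RintegralZl//; last first.
    have := integrableZl measurableT (1 / 2) (integrableD measurableT
      (integrable_Re_expi_gw (phi s * w : C) (t - s) e0)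
      (integrable_Re_expi_gw (conjc w * phi s : C) (- t - s) e0)).
    exact: eq_integrable.
  apply: eq_Rintegral => y _; rewrite /f.
  have -> : Re (phi s * expi (- (s * y)) : C) * gw tau s * (Re (w * expi (t * y) : C) * gw eps y)
    = gw tau s * gw eps y * (Re (phi s * expi (- (s * y)) : C) * Re (w * expi (t * y) : C)).
    by ring.
  rewrite Re_mul_Re.
  have -> : (phi s * expi (- (s * y)) * (w * expi (t * y)) : C) =
      phi s * w * expi ((t - s) * y).
    by rewrite mulrBl addrC expiD; ring.
  have -> : (conjc (w * expi (t * y) : C) * (phi s * expi (- (s * y))) : C) =
      conjc w * phi s * expi ((- t - s) * y).
    rewrite mulrBl expiD mulNr -(conj_expi (t * y)); apply: complex_ext; rewrite !ReImE; ring.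
  by field.
rewrite RintegralZl//; last first.
  have := integrableD measurableT
    (integrable_Re_expi_gw (phi s * w : C) (t - s) e0)
    (integrable_Re_expi_gw (conjc w * phi s : C) (- t - s) e0).
  exact: eq_integrable.
rewrite RintegralD//; [|exact: integrable_Re_expi_gw|exact: integrable_Re_expi_gw].
rewrite !Rintegral_Re_expi_gw//.
have -> : normal_pdf 0 eps (t - s) = normal_pdf t eps s.
  by rewrite !normal_pdf_gw// -gwN; congr (_ * gw _ _); ring.
have -> : normal_pdf 0 eps (- t - s) = normal_pdf (- t) eps s.
  by rewrite !normal_pdf_gw// -gwN; congr (_ * gw _ _); ring.
by rewrite /weighted (mulrC w); field.
Qed.

Hypothesis cphi : continuous phi.
Hypothesis phiN : forall t, phi (- t) = conjc (phi t).

Let continuous_weighted w : continuous (weighted w).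
Proof.
move=> t; apply: cvgM; last exact: continuous_gw.
have cr : {for t, continuous (fun s => Re (phi s))} by exact: (cvg_Re (cphi (x := t))).
have ci : {for t, continuous (fun s => Im (phi s))} by exact: (cvg_Im (cphi (x := t))).
rewrite (_ : (fun s => _) = fun s => Re w * Re (phi s) - Im w * Im (phi s)).
  by rewrite ReM; apply: cvgB; apply: cvgM => //; exact: cvg_cst.
by apply/funext => s; rewrite ReM.
Qed.

Lemma gauss_fourier_inversion w t :
  (fun n : nat => \int[mu]_y (gauss_fourier tau phi y *
     (Re (w * expi (t * y) : C) * gw n.+1%:R^-1 y))) @ \oo -->
  2 * pi * (Re (w * phi t : C) * gw tau t).
Proof.
have H v x := approximate_identity (x := x) (measurable_weighted v) (weighted_bound v)
   (@continuous_weighted v x).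
have -> : 2 * pi * (Re (w * phi t : C) * gw tau t) =
    pi * (weighted w t + weighted (conjc w) (- t)).
  by rewrite /weighted gwN phiN !ReImE; ring.
under eq_fun do rewrite Rintegral_gauss_fourier_gw ?invr_gt0//.
by apply: cvgM; [exact: cvg_cst|apply: cvgD; exact: H].
Qed.

Hypothesis phi0 : phi 0 = 1.
Hypothesis gf0 : forall y, 0 <= gauss_fourier tau phi y.

(** The density that the inversion formula predicts. *)
Let p y := (2 * pi)^-1 * gauss_fourier tau phi y.

Let pi2 : 0 < 2 * pi :> R. Proof. by rewrite mulr_gt0// pi_gt0. Qed.

Let mp : measurable_fun setT p.
Proof. by apply: measurable_funM => //; exact: measurable_gauss_fourier. Qed.

Let p0 y : 0 <= p y. Proof. by rewrite mulr_ge0// invr_ge0 ltW. Qed.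

Let integrable_p w t eps : 0 < eps -> mu.-integrable setT
  (EFin \o (fun y => p y * (Re (w * expi (t * y) : C) * gw eps y))).
Proof.
move=> e0; have := integrableZl measurableT (2 * pi)^-1
  (integrable_gauss_fourier_gw w t e0).
by apply: eq_integrable => // y _ /=; rewrite /p -mulrA.
Qed.

Let p_cvg w t : (fun n : nat => \int[mu]_y (p y * (Re (w * expi (t * y) : C) *
   gw n.+1%:R^-1 y))) @ \oo --> Re (w * phi t : C) * gw tau t.
Proof.
rewrite -[X in _ --> X](mulKf (lt0r_neq0 pi2)).
rewrite (_ : (fun n => _) = fun n : nat => (2 * pi)^-1 * \int[mu]_y
    (gauss_fourier tau phi y * (Re (w * expi (t * y) : C) * gw n.+1%:R^-1 y))).
  by apply: cvgM; [exact: cvg_cst|exact: gauss_fourier_inversion].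
apply/funext => n; rewrite -RintegralZl//; last first.
  by apply: integrable_gauss_fourier_gw; rewrite invr_gt0.
by apply: eq_Rintegral => y _; rewrite /p mulrA.
Qed.

Let gw_nd y (n m : nat) : (n <= m)%N -> gw n.+1%:R^-1 y <= gw m.+1%:R^-1 y.
Proof.
move=> nm; rewrite /gw ler_expR !mulNr lerN2 ler_wpM2r// !exprMn ler_wpM2r ?sqr_ge0//.
by rewrite lerXn2r ?nnegrE ?invr_ge0// lef_pV2 ?posrE// ler_nat.
Qed.

Let p1 : (\int[mu]_y (p y)%:E = 1)%E.
Proof.
pose g (n : nat) y := (p y * gw n.+1%:R^-1 y)%:E.
have e1 n : (\int[mu]_y g n y)%E = (\int[mu]_y (p y * (Re ((1 : C) * expi (0 * y) : C) *
   gw n.+1%:R^-1 y)))%:E.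
  rewrite /Rintegral fineK; last first.
    by apply: integrable_fin_num => //; apply: integrable_p; rewrite invr_gt0.
  by apply: eq_integral => y _; rewrite mul0r expi0 mulr1 mul1r.
have h1 : (fun n => (\int[mu]_y g n y)%E) @ \oo --> 1%E.
  under eq_fun do rewrite e1.
  apply/cvg_EFin; first exact: nearW.
  have := @p_cvg 1 0; rewrite phi0 mulr1 gw0 mulr1; exact.
have h2 : (fun n => (\int[mu]_y g n y)%E) @ \oo --> (\int[mu]_y (p y)%:E)%E.
  have := @cvg_monotone_convergence _ (measurableTypeR R) R mu setT measurableT g.
  have -> : (\int[mu]_y (p y)%:E)%E = (\int[mu]_y limn (g ^~ y))%E.
    apply: eq_integral => y _; apply/esym/cvg_lim => //.
    apply/cvg_EFin; first exact: nearW.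
    by rewrite -[X in _ --> X]mulr1; apply: cvgM; [exact: cvg_cst|exact: gw_cvg1].
  apply.
  - move=> n; apply/measurable_EFinP; apply: measurable_to_TypeR.
    by apply: measurable_funM => //; exact: measurable_gw.
  - by move=> n y _; rewrite lee_fin mulr_ge0// gw_ge0.
  - by move=> y _ n k nk; rewrite lee_fin ler_wpM2l// gw_nd.
exact: (cvg_unique _ h2 h1).
Qed.

(** Positivity of the inverse transform makes it a density: monotone
    convergence at t = 0 gives mass 1, dominated convergence the transform. *)
Lemma exists_distribution_char_fun : exists F : distribution_function R,
  forall t, char_fun F t = gw tau t *: phi t.
Proof.
have [F FP] := exists_distribution_density mp p0 p1.
exists F => t.
have key w : \int[mu]_y (Re (w * expi (t * y) : C) * p y) = Re (w * phi t : C) * gw tau t.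
  have ip : mu.-integrable setT (EFin \o p).
    apply/integrableP; split; first exact/measurable_EFinP.
    by under eq_integral do rewrite /= ger0_norm//; rewrite p1 ltry.
  have h : (fun n : nat => \int[mu]_y (p y * (Re (w * expi (t * y) : C) *
      gw n.+1%:R^-1 y))) @ \oo --> \int[mu]_y (Re (w * expi (t * y) : C) * p y).
    apply: (@dominated_Rintegral_cvg _ (measurableTypeR R) R mu _ _ (fun y => `|w| * p y)).
    - move=> n; apply: measurable_to_TypeR; apply: measurable_funM => //.
      by apply: measurable_funM; [exact: measurable_Re_expi|exact: measurable_gw].
    - move=> y; rewrite [X in _ --> X]mulrC -[X in _ --> p y * X]mulr1.
      apply: cvgM; first exact: cvg_cst.
      by apply: cvgM; [exact: cvg_cst|exact: gw_cvg1].
    - by have := integrableZl measurableT `|w| ip; exact: eq_integrable.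
    - move=> n y; rewrite normrM (ger0_norm (p0 y)) mulrC ler_wpM2r//.
      rewrite normrM (ger0_norm (gw_ge0 _ _)) -[leRHS]mulr1 ler_pM ?gw_ge0 ?gw_le1//.
      exact: Re_mul_expi_bound.
  exact: (cvg_unique _ h (@p_cvg w t)).
have mc : measurableC (fun x : R => expi (t * x)).
  by apply: measurableC_expi; exact: measurable_funM.
apply: complex_ext; rewrite ?ReZ ?ImZ /char_fun /=.
  rewrite (FP _ 1 mc.1); last by move=> x; exact: cos_max.
  have := key 1; rewrite mul1r mulrC => <-.
  by apply: eq_Rintegral => y _; rewrite mul1r.
rewrite (FP _ 1 mc.2); last by move=> x; exact: sin_max.
(* Multiplication by - i turns the real part into the imaginary part. *)
have := key (Complex 0 (-1)); rewrite ReM /= mul0r sub0r mulN1r opprK mulrC => <-.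
by apply: eq_Rintegral => y _; rewrite /= mul0r sub0r mulN1r opprK.
Qed.

End inversion.
End fourier_inversion.

(** * Characteristic functions: uniqueness and convolution *)

Section uniqueness.
Variable R : realType.
Local Notation mu := (@lebesgue_measure R).
Local Notation C := (Rcomplex R).

Section one_distribution.
Variable F : distribution_function R.
Local Notation mF := (lebesgue_stieltjes_measure F).

Lemma LS_finite : (mF setT < +oo)%E.
Proof. by apply: le_lt_trans (ltry 1); rewrite [leLHS]probability_setT. Qed.

Lemma measurable_id_LS : measurable_fun [set: measurableTypeR R] (fun x : measurableTypeR R => x : R).
Proof. exact: measurable_id. Qed.

Lemma integrable_cst_LS (c : R) : mF.-integrable setT (EFin \o (fun=> c)).
Proof. by apply: (@bounded_integrableT _ _ _ _ _ `|c|); [exact: LS_finite| |]. Qed.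

Lemma Re_mul_char_fun (z : C) t :
  Re (z * char_fun F t : C) = \int[mF]_x Re (z * expi (t * x) : C).
Proof.
have := @Re_mul_weighted_cf R _ _ mF (fun=> 1) (fun x => x) measurable_id_LS
  (fun=> ler01) (integrable_cst_LS 1) z t.
rewrite (_ : weighted_cf _ _ _ _ = char_fun F t); last first.
  by congr Complex; apply: eq_Rintegral => x _; rewrite mul1r.
by move=> ->; apply: eq_Rintegral => x _; rewrite mul1r.
Qed.

(** The Fourier integral of a characteristic function is the density of the law
    smoothed by a normal one, by Fubini's theorem and the Fourier transform of the
    Gaussian. *)
Lemma gauss_fourier_char_fun eps y : 0 < eps ->
  gauss_fourier eps (char_fun F) y = 2 * pi * \int[mF]_x normal_pdf x eps y.
Proof.
move=> e0.
pose f (t x : measurableTypeR R) : R := Re ((1 : C) * expi (t * (x - y)) : C) * gw eps t.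
have mfst : measurable_fun setT (fun q : measurableTypeR R * measurableTypeR R => q.1 : R).
  exact: measurable_fst.
have msnd : measurable_fun setT (fun q : measurableTypeR R * measurableTypeR R => q.2 : R).
  exact: measurable_snd.
have mf : measurable_fun setT (fun q : measurableTypeR R * measurableTypeR R => f q.1 q.2).
  apply: measurable_funM; last exact: (measurableT_comp (measurable_gw eps) mfst).
  apply: (measurableC_mul _ (measurableC_expi _)).1; first by split; exact: measurable_cst.
  by apply: measurable_funM => //; exact: measurable_funB.
have fab t x : `|f t x| <= gw eps t * 1.
  rewrite normrM (ger0_norm (gw_ge0 _ _)) mulr1 ler_piMl ?gw_ge0//.
  by rewrite (le_trans (Re_mul_expi_bound _ _))// normC1.
transitivity (\int[mu]_t (\int[mF]_x f t x)).
  apply: eq_Rintegral => t _; rewrite mulrC.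
  rewrite mulrC (mulrC (char_fun F t)) Re_mul_char_fun -RintegralZr//.
    apply: eq_Rintegral => x _; rewrite /f mul1r -expiD; congr (Re (expi _) * _); ring.
  apply: (@bounded_integrableT _ _ _ _ _ 1); first exact: LS_finite.
    exact: (measurable_Re_expi (expi (- (t * y))) t).
  by move=> x; apply: le_trans (Re_mul_expi_bound _ _) _; rewrite normC_expi.
rewrite (RFubini mf (integrable_gw e0) (integrable_cst_LS 1) fab).
have mn : measurable_fun setT (fun x : R => normal_pdf x eps y).
  under eq_fun do rewrite normal_pdf_gw//.
  apply: measurable_funM => //.
  apply: (measurableT_comp (measurable_gw eps^-1)); exact: measurable_funB.
rewrite -RintegralZl//; last first.
  apply: (@bounded_integrableT _ _ _ _ _ (normal_peak eps)) => //; first exact: LS_finite.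
  by move=> x; rewrite ger0_norm ?normal_pdf_ge0// normal_pdf_ub// gt_eqF.
apply: eq_Rintegral => x _; rewrite /f.
under eq_Rintegral do rewrite mulrC.
rewrite (_ : (fun t => _) = fun t => Re ((1 : C) * expi ((x - y) * t) : C) * gw eps t).
  rewrite Rintegral_Re_expi_gw// mulr1; congr (_ * _).
  by rewrite !normal_pdf_gw// -gwN; congr (_ * gw _ _); ring.
by apply/funext => t; rewrite mulrC (mulrC t).
Qed.

(** A bounded continuous integrable test function is recovered from the
    characteristic function by mollifying with narrower and narrower normal laws. *)
Lemma Rintegral_char_fun_cvg (h : R -> R) (M : R) :
  continuous h -> (forall x, `|h x| <= M) -> mu.-integrable setT (EFin \o h) ->
  (fun n : nat => \int[mu]_y (h y * gauss_fourier n.+1%:R^-1 (char_fun F) y)) @ \oo -->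
  2 * pi * \int[mF]_x h x.
Proof.
move=> ch hM ih.
have mh : measurable_fun setT h by exact: continuous_measurable_fun.
have e0 n : 0 < (n.+1%:R^-1 : R) by rewrite invr_gt0.
have [E im] : (forall n : nat, \int[mu]_y (h y * gauss_fourier n.+1%:R^-1 (char_fun F) y) =
      2 * pi * \int[mF]_x (\int[mu]_y (h y * normal_pdf x n.+1%:R^-1 y))) /\
    (forall n : nat, mF.-integrable setT
      (EFin \o (fun x => \int[mu]_y (h y * normal_pdf x n.+1%:R^-1 y)))).
  apply: all_and2 => n.
  set eps : R := n.+1%:R^-1.
  pose f (x y : measurableTypeR R) : R := h y * normal_pdf x eps y.
  have mfst : measurable_fun setT (fun q : measurableTypeR R * measurableTypeR R => q.1 : R).
    exact: measurable_fst.
  have msnd : measurable_fun setT (fun q : measurableTypeR R * measurableTypeR R => q.2 : R).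
    exact: measurable_snd.
  have mf : measurable_fun setT (fun q : measurableTypeR R * measurableTypeR R => f q.1 q.2).
    apply: measurable_funM; first exact: (measurableT_comp mh msnd).
    under eq_fun do rewrite normal_pdf_gw ?e0//.
    apply: measurable_funM => //.
    apply: (measurableT_comp (measurable_gw eps^-1)); exact: measurable_funB.
  have fab x y : `|f x y| <= normal_peak eps * `|h y|.
    rewrite normrM mulrC ler_wpM2r// ger0_norm ?normal_pdf_ge0//.
    by rewrite normal_pdf_ub// gt_eqF ?e0.
  have ihn : mu.-integrable setT (EFin \o (fun y => `|h y|)).
    by have := integrable_abse ih; exact: eq_integrable.
  have im := Rintegral_integrable1 mf (integrable_cst_LS (normal_peak eps)) ihn fab.
  split; last exact: im.
  rewrite -(RintegralZl (2 * pi) measurableT im).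
  transitivity (\int[mu]_y (2 * pi * \int[mF]_x f x y)).
    apply: eq_Rintegral => y _; rewrite gauss_fourier_char_fun ?e0// mulrCA; congr (_ * _).
    rewrite /f RintegralZl//.
    apply: (@bounded_integrableT _ _ _ _ _ (normal_peak eps)) => //; first exact: LS_finite.
      under eq_fun do rewrite normal_pdf_gw ?e0//.
      apply: measurable_funM => //.
      by apply: (measurableT_comp (measurable_gw eps^-1)); exact: measurable_funB.
    by move=> x; rewrite ger0_norm ?normal_pdf_ge0// normal_pdf_ub// gt_eqF ?e0.
  have mf' : measurable_fun setT (fun q : measurableTypeR R * measurableTypeR R => f q.2 q.1).
    apply: measurable_funM; first exact: (measurableT_comp mh mfst).
    under eq_fun do rewrite normal_pdf_gw ?e0//.
    apply: measurable_funM => //.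
    by apply: (measurableT_comp (measurable_gw eps^-1)); exact: measurable_funB.
  have fab' (y x : measurableTypeR R) : `|f x y| <= `|h y| * normal_peak eps.
    by rewrite mulrC.
  have im' := Rintegral_integrable1 (f := fun y x => f x y) mf' ihn
    (integrable_cst_LS (normal_peak eps)) fab'.
  rewrite (RintegralZl (2 * pi) measurableT im') (RintegralZl (2 * pi) measurableT im).
  by rewrite -(RFubini mf (integrable_cst_LS (normal_peak eps)) ihn fab).
under eq_fun do rewrite E.
apply: cvgM; first exact: cvg_cst.
apply: (@dominated_Rintegral_cvg _ _ _ _ _ _ (fun=> M)).
- by move=> n; exact: integrable_measurable (im n).
- by move=> x; exact: (approximate_identity mh hM (ch x)).
- exact: integrable_cst_LS.
- move=> n x; rewrite -[leRHS]mulr1 -[X in _ <= _ * X](Rintegral_normal_pdf x n.+1%:R^-1).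
  rewrite -RintegralZl//; last exact: integrable_normal_pdf.
  apply: (@le_norm_Rintegral_bound _ (measurableTypeR R)).
  + by have := integrableZl measurableT M (integrable_normal_pdf x n.+1%:R^-1);
      exact: eq_integrable.
  + apply: measurable_to_TypeR; apply: measurable_funM => //.
    exact: measurable_normal_pdf.
  + by move=> y; rewrite normrM (ger0_norm (normal_pdf_ge0 _ _ _)) ler_wpM2r ?normal_pdf_ge0.
Qed.

Lemma LS_itvNyc z : mF `]-oo, z]%classic = (F z)%:E.
Proof. exact: cdf_lebesgue_stieltjes_id. Qed.

Lemma Rintegral_indic_LS z : \int[mF]_x \1_(`]-oo, z]%classic) x = F z.
Proof.
rewrite /Rintegral integral_indic// setIT -[RHS]/(fine (F z)%:E).
by congr fine; exact: LS_itvNyc.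
Qed.

End one_distribution.

(** The Gaussian cutoffs g * gw (1 / n) are integrable, as
    [Rintegral_char_fun_cvg] requires, and tend boundedly to g. *)
Lemma Rintegral_LS_eq (F1 F2 : distribution_function R) (g : R -> R) (M : R) :
  char_fun F1 =1 char_fun F2 -> continuous g -> (forall x, `|g x| <= M) ->
  \int[lebesgue_stieltjes_measure F1]_x g x = \int[lebesgue_stieltjes_measure F2]_x g x.
Proof.
move=> eqF cg gM.
have e0 n : 0 < (n.+1%:R^-1 : R) by rewrite invr_gt0.
pose h (n : nat) x := g x * gw n.+1%:R^-1 x.
have ch n : continuous (h n).
  by move=> x; apply: cvgM; [exact: cg|exact: continuous_gw].
have hM n x : `|h n x| <= M.
  rewrite normrM (ger0_norm (gw_ge0 _ _)) -[leRHS]mulr1.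
  by rewrite ler_pM ?gw_ge0 ?gw_le1.
have mg : measurable_fun setT g by exact: continuous_measurable_fun.
have ih n : mu.-integrable setT (EFin \o h n).
  exact: (integrable_mul_bounded mg gM (integrable_gw (e0 n))).
have E n : \int[lebesgue_stieltjes_measure F1]_x h n x =
    \int[lebesgue_stieltjes_measure F2]_x h n x.
  have H1 := Rintegral_char_fun_cvg (F := F1) (ch n) (hM n) (ih n).
  have H2 := Rintegral_char_fun_cvg (F := F2) (ch n) (hM n) (ih n).
  have eF : char_fun F1 = char_fun F2 by apply/funext.
  rewrite eF in H1; apply: (@mulfI _ (2 * pi)).
    by apply: lt0r_neq0; rewrite mulr_gt0 ?pi_gt0.
  exact: (cvg_unique _ H1 H2).
have lim (F : distribution_function R) :
    (fun n => \int[lebesgue_stieltjes_measure F]_x h n x) @ \oo -->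
    \int[lebesgue_stieltjes_measure F]_x g x.
  apply: (@dominated_Rintegral_cvg _ _ _ _ _ _ (fun=> M)).
  - by move=> n; apply: measurable_to_TypeR; exact: continuous_measurable_fun.
  - move=> x; rewrite -[X in _ --> X]mulr1; apply: cvgM; first exact: cvg_cst.
    exact: gw_cvg1.
  - exact: integrable_cst_LS.
  - by move=> n x; exact: hM.
have L1 := lim F1; have L2 := lim F2.
rewrite (_ : (fun n => _) = fun n =>
  \int[lebesgue_stieltjes_measure F2]_x h n x) in L1; last exact/funext.
exact: (cvg_unique _ L1 L2).
Qed.

(** The integrals of bounded continuous functions agree, and the ramps g below
    decrease to the indicator of the half-line ending at z. *)
Lemma char_fun_inj (F1 F2 : distribution_function R) :
  char_fun F1 =1 char_fun F2 -> F1 = F2 :> (R -> R).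
Proof.
move=> eqF; apply/funext => z; rewrite -!Rintegral_indic_LS.
(* The function max (0, min (u, 1)), in a form that is visibly continuous. *)
pose clamp (u : R) : R := (1 + `|u| - `|u - 1|) / 2.
have clamp0 u : u <= 0 -> clamp u = 0.
  by move=> u0; rewrite /clamp !ler0_norm; [field|lra|lra].
have clamp1 u : 1 <= u -> clamp u = 1.
  by move=> u0; rewrite /clamp !ger0_norm; [field|lra|lra].
have clamp_le u : `|clamp u| <= 1.
  rewrite /clamp ler_norml; apply/andP.
  have [u0|u0] := leP 0 u; have [u1|u1] := leP 1 u; rewrite ?(ger0_norm u0) ?(ltr0_norm u0);
    first [rewrite ger0_norm; last lra | rewrite ler0_norm; last lra]; split; lra.
have cclamp : continuous clamp.
  move=> u; apply: cvgM; last exact: cvg_cst.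
  apply: cvgB; first by apply: cvgD; [exact: cvg_cst|apply: cvg_norm; exact: cvg_id].
  by apply: cvg_norm; apply: cvgB; [exact: cvg_id|exact: cvg_cst].
pose g (n : nat) y := clamp (1 - n.+1%:R * (y - z)).
have cg n : continuous (g n).
  move=> y; apply: (@continuous_comp _ _ _ (fun y => 1 - n.+1%:R * (y - z)) clamp).
    apply: cvgB; first exact: cvg_cst.
    apply: cvgM; first exact: cvg_cst.
    by apply: cvgB; [exact: cvg_id|exact: cvg_cst].
  exact: cclamp.
have lim (F : distribution_function R) :
    (fun n => \int[lebesgue_stieltjes_measure F]_x g n x) @ \oo -->
    \int[lebesgue_stieltjes_measure F]_x (\1_(`]-oo, z]%classic) x : R).
  apply: (@dominated_Rintegral_cvg _ _ _ _ _ _ (fun=> 1)).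
  - by move=> n; apply: measurable_to_TypeR; exact: continuous_measurable_fun.
  - move=> x; rewrite indicE; have [xz|zx] := leP x z.
      rewrite mem_set; last by rewrite /= in_itv.
      apply: cvg_near_cst; apply: nearW => n; apply: clamp1.
      by rewrite lerBrDr gerDl mulr_ge0_le0// subr_le0.
    rewrite memNset; last by rewrite /= in_itv /=; apply/negP; rewrite -ltNge.
    apply: cvg_near_cst; have d0 : 0 < x - z by rewrite subr_gt0.
    have /cvgrPdist_lt /(_ _ d0) := @cvg_harmonic R; apply: filterS => n.
    rewrite sub0r normrN ger0_norm ?invr_ge0// => hn; apply: clamp0.
    by rewrite subr_le0 -ler_pdivrMl ?ltr0n// mulr1 ltW.
  - exact: integrable_cst_LS.
  - by move=> n x; exact: clamp_le.
have L1 := lim F1; have L2 := lim F2.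
have E n : \int[lebesgue_stieltjes_measure F1]_x g n x =
    \int[lebesgue_stieltjes_measure F2]_x g n x.
  by apply: (@Rintegral_LS_eq _ _ _ 1 eqF (cg n)) => x; exact: clamp_le.
rewrite (_ : (fun n => _) = fun n =>
  \int[lebesgue_stieltjes_measure F2]_x g n x) in L1; last exact/funext.
exact: (cvg_unique _ L1 L2).
Qed.

End uniqueness.

Section convolution.
Variable R : realType.
Local Notation C := (Rcomplex R).
Variables A B : distribution_function R.
Local Notation mA := (lebesgue_stieltjes_measure A).
Local Notation mB := (lebesgue_stieltjes_measure B).
Let T : measurableType _ := measurableTypeR R.

Let add (q : T * T) : T := (q.1 : R) + q.2.

Let madd : measurable_fun setT add.
Proof.
by apply: (@measurable_funD _ _ R); [exact: measurable_fst|exact: measurable_snd].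
Qed.

#[local] HB.instance Definition _ := @isMeasurableFun.Build _ _ _ _ add madd.

Let P : probability T R := distribution (mB \x mA)%E (add : {mfun (T * T)%type >-> T}).

Let Rintegral_P (g : R -> R) (M : R) : measurable_fun setT g ->
  (forall x, `|g x| <= M) -> \int[P]_x g x = \int[mB]_y (\int[mA]_x g (y + x)).
Proof.
move=> mg gM.
have mf : measurable_fun setT (fun q : T * T => g ((q.1 : R) + q.2)).
  exact: (measurableT_comp mg madd).
rewrite -(@Rintegral_prod _ _ _ _ _ mB mA (fun y x => g ((y : R) + x)) (fun=> M) (fun=> 1)
  mf (integrable_cst_LS _ _) (integrable_cst_LS _ _)); last first.
  by move=> y x; rewrite mulr1.
congr fine; rewrite integral_pushforward//; first exact/measurable_EFinP.
apply: (@bounded_integrableT _ _ _ _ _ M) => //.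
by apply: le_lt_trans (ltry 1); rewrite [leLHS]probability_setT.
Qed.

(** The law of the sum of independent variables with laws A and B. *)
Lemma exists_convolution : exists D : distribution_function R,
  D = convolution A B :> (R -> R) /\
  forall t, char_fun D t = char_fun A t * char_fun B t.
Proof.
have [D [DP _]] := exists_distribution P; exists D.
have intD (g : R -> R) : \int[lebesgue_stieltjes_measure D]_x g x = \int[P]_x g x.
  by congr fine; apply: eq_measure_integral => S mS _; exact: DP.
split.
  apply/funext => z; rewrite -Rintegral_indic_LS intD (@Rintegral_P _ 1).
  - apply: eq_Rintegral => y _; rewrite -Rintegral_indic_LS.
    apply: eq_Rintegral => x _; rewrite !indicE; congr (_ %:R); congr nat_of_bool.
    by apply/idP/idP; rewrite !inE /= !in_itv /= lerBrDl.
  - exact: measurable_indic.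
  - by move=> x; rewrite indicE; case: (_ \in _); rewrite ?normr1 ?normr0.
move=> t.
have mc : measurableC (fun x : R => expi (t * x)).
  by apply: measurableC_expi; exact: measurable_funM.
have iz (z : C) : mB.-integrable setT (EFin \o (fun y => Re (z * expi (t * y) : C))).
  apply: (@bounded_integrableT _ _ _ _ _ `|z|); first exact: LS_finite.
    exact: (measurable_Re_expi z t).
  by move=> y; exact: Re_mul_expi_bound.
have key (z : C) : \int[P]_x Re (z * expi (t * x) : C) = Re (z * (char_fun A t * char_fun B t) : C).
  rewrite (@Rintegral_P _ `|z|).
  - rewrite mulrA Re_mul_char_fun; apply: eq_Rintegral => y _.
    rewrite mulrAC Re_mul_char_fun; apply: eq_Rintegral => x _.
    by rewrite mulrDr expiD mulrA.
  - exact: measurable_Re_expi.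
  - by move=> x; exact: Re_mul_expi_bound.
apply: complex_ext.
  have := key 1; rewrite mul1r => <-; rewrite /char_fun /= intD.
  by apply: eq_Rintegral => x _; rewrite mul1r mul0r subr0.
(* Multiplication by - i turns the real part into the imaginary part. *)
have := key (Complex 0 (-1)); rewrite ReM /= mul0r sub0r mulN1r opprK => <-.
rewrite intD; apply: eq_Rintegral => x _.
by rewrite /= mul0r sub0r mulN1r opprK.
Qed.

End convolution.

(** * The distinguished argument *)

Section distinguished_argument.
Variable R : realType.
Local Notation C := (Rcomplex R).
Implicit Types (t x v : R).

Lemma expi_eq1_small v : expi v = 1 -> `|v| <= 1 -> v = 0.
Proof.
move=> ev v1; have cv : cos `|v| = cos 0.
  by rewrite cos_norm cos0; have := congr1 (fun z : C => Re z) ev.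
have pi1 : 1 <= pi :> R by apply: le_trans (pi_ge2 R); lra.
apply/eqP; rewrite -normr_eq0; apply/eqP; apply: cos_inj cv.
  by rewrite in_itv /= normr_ge0 (le_trans v1).
by rewrite in_itv /= lexx pi_ge0.
Qed.

(** If d is nonzero at t, the intermediate value theorem gives a point where d
    takes the nonzero value d t / (1 + |d t|) of modulus less than 1. *)
Lemma continuous_period_eq0 (d : R -> R) (T : R) : continuous d -> d 0 = 0 ->
  (forall t, `|t| <= T -> expi (d t) = 1) -> forall t, `|t| <= T -> d t = 0.
Proof.
move=> cd d0 dT t tT; apply/eqP; apply: contraT => dt0.
pose v := d t / (1 + `|d t|).
have D0 : 0 < 1 + `|d t| by rewrite ltr_wpDr.
have v1 : `|v| <= 1.
  by rewrite normrM normfV (gtr0_norm D0) ler_pdivrMr// mul1r lerDr.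
have vd : Num.min 0 (d t) <= v <= Num.max 0 (d t).
  have k : (1 + `|d t|)^-1 <= 1 by rewrite invf_le1// lerDl.
  have k0 : 0 <= (1 + `|d t|)^-1 by rewrite invr_ge0 ltW.
  rewrite /v; move: (d t) (_^-1) k k0 => a b b1 b0.
  by have [a0|a0] := leP a 0; apply/andP; split; nra.
have wd (A : set R) : {within A, continuous d} by exact: continuous_subspaceT.
have [c ct dc] : exists2 c, `|c| <= `|t| & d c = v.
  have [t0|t0] := leP 0 t.
    have [|c] := @IVT _ d 0 t v t0 (wd _); first by rewrite d0.
    rewrite in_itv /= => /andP[c0 ct] dc; exists c => //.
    by rewrite !ger0_norm.
  have [|c] := @IVT _ d t 0 v (ltW t0) (wd _); first by rewrite d0 minC maxC.
  rewrite in_itv /= => /andP[ct c0] dc; exists c => //.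
  by rewrite !ler0_norm ?lerN2// ltW.
have : v = 0 by apply: expi_eq1_small => //; rewrite -dc; apply: dT; exact: le_trans tT.
by move/eqP; rewrite mulf_eq0 invr_eq0 (negbTE dt0) gt_eqF.
Qed.

Lemma lift_unique (u : R -> C) (phi psi : R -> R) (T : R) :
  continuous phi -> continuous psi -> phi 0 = 0 -> psi 0 = 0 ->
  (forall t, `|t| <= T -> u t = expi (phi t)) ->
  (forall t, `|t| <= T -> u t = expi (psi t)) ->
  forall t, `|t| <= T -> phi t = psi t.
Proof.
move=> cphi cpsi phi0 psi0 uphi upsi t tT; apply/eqP; rewrite -subr_eq0; apply/eqP.
apply: (@continuous_period_eq0 (fun t => phi t - psi t) T) tT.
- by move=> x; apply: cvgB; [exact: cphi|exact: cpsi].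
- by rewrite phi0 psi0 subrr.
- move=> x xT; have e : expi (phi x) = expi (psi x) by rewrite -uphi// -upsi.
  by rewrite expiD e -expiD subrr expi0.
Qed.

(** The principal argument on the right half-plane. *)
Definition atan2 (z : C) : R := atan (Im z / Re z).

Lemma expi_atan2 (z : C) : `|z| = 1 -> 0 < Re z -> expi (atan2 z) = z.
Proof.
move=> z1 z0; have zs : Re z ^+ 2 + Im z ^+ 2 = 1 by rewrite -normC_sqr z1 expr1n.
have zN0 : Re z != 0 by rewrite gt_eqF.
have cE : cos (atan2 z) = Re z.
  rewrite cos_atan.
  have -> : 1 + (Im z / Re z) ^+ 2 = (Re z)^-1 ^+ 2.
    apply: (@mulIf _ (Re z ^+ 2)); first by rewrite expf_neq0.
    by rewrite mulrDl mul1r -!exprMn divfK// mulVf// expr1n.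
  by rewrite sqrtr_sqr ger0_norm ?invr_ge0 ?ltW// invrK.
apply: complex_ext => //=.
have := atanK (Im z / Re z); rewrite /tan -/(atan2 z) cE => /(congr1 (fun v => v * Re z)).
by rewrite !mulfVK.
Qed.

Lemma continuous_atan2_comp (z : R -> C) t : {for t, continuous z} ->
  Re (z t) != 0 -> {for t, continuous (fun s => atan2 (z s))}.
Proof.
move=> cz z0.
have cr : {for t, continuous (fun s => Re (z s))} by exact: (cvg_Re cz).
have ci : {for t, continuous (fun s => Im (z s))} by exact: (cvg_Im cz).
apply: (@continuous_comp _ _ _ (fun s => Im (z s) / Re (z s)) (@atan R)).
  by apply: cvgM => //; exact: cvgV.
exact: continuous_atan.
Qed.

(** Unit vectors at distance less than 1 make an acute angle, so that the quotient
    a / b = a * conjc b has its principal argument given by [atan2]. *)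
Lemma Re_mul_conj (a b : C) : `|a| = 1 -> `|b| = 1 -> `|a - b| < 1 ->
  0 < Re (a * conjc b : C).
Proof.
move=> a1 b1 ab.
have ha : Re a ^+ 2 + Im a ^+ 2 = 1 by rewrite -normC_sqr a1 expr1n.
have hb : Re b ^+ 2 + Im b ^+ 2 = 1 by rewrite -normC_sqr b1 expr1n.
have hab : (Re a - Re b) ^+ 2 + (Im a - Im b) ^+ 2 < 1.
  by rewrite -ReB -ImB -normC_sqr expr_lt1.
by rewrite !ReImE; nra.
Qed.

Section lifting.
Variable u : R -> C.
Hypothesis cu : continuous u.
Hypothesis u1 : forall t, `|u t| = 1.
Hypothesis u0 : u 0 = 1.

(** Uniform continuity of u on a compact interval. *)
Lemma uniform_step (T : R) : exists n : nat, forall s t,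
  `|t| <= T -> `|s - t| <= T / n.+1%:R -> `|u s - u t| < 1.
Proof.
have /compact_near_coveringP K := @segment_compact R (- T) T.
pose P (n : nat) t := forall s, `|s - t| <= T / n.+1%:R -> `|u s - u t| < 1.
have : \forall n \near \oo, `[- T, T]%classic `<=` P n.
  apply: K => x _; have h2 : 0 < 1 / 2 :> R by [].
  have /cvgrPdist_lt /(_ _ h2) /nbhs_ballP[r /= r0 ur] := cu (x := x).
  have r2 : 0 < r / 2 by rewrite divr_gt0.
  have Tn : (fun n : nat => T / n.+1%:R) @ \oo --> (0 : R).
    by rewrite -[X in _ --> X](mulr0 T); apply: cvgM; [exact: cvg_cst|exact: cvg_harmonic].
  move/cvgrPdist_lt : Tn => /(_ _ r2) Tn.
  exists (ball x (r / 2), [set n : nat | `|0 - T / n.+1%:R| < r / 2]).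
    by split => //=; exact: nbhsx_ballx.
  move=> [y n] /= [xy nT] s sy.
  have xs : `|x - s| < r.
    have -> : x - s = (x - y) - (s - y) by ring.
    apply: le_lt_trans (ler_normB _ _) _; rewrite [ltRHS]splitr ltrD//.
    apply: le_lt_trans sy _; apply: le_lt_trans (ler_norm _) _.
    by move: nT; rewrite sub0r normrN.
  have xy' : `|x - y| < r by apply: lt_le_trans xy _; lra.
  have -> : u s - u y = (u x - u y) - (u x - u s) by ring.
  apply: le_lt_trans (ler_normB _ _) _; rewrite [ltRHS]splitr ltrD//; exact: ur.
move=> [n _ H]; exists n => s t tT st.
by apply: (H n) => //=; rewrite in_itv /= -ler_norml.
Qed.

(** The argument of u t is the sum of the principal arguments of the quotients of
    the values of u at consecutive points of a subdivision of [0, t] into n.+1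
    equal steps; each of them is continuous in t. *)
Lemma local_lift (T : R) : 0 <= T -> exists phi : R -> R,
  [/\ continuous phi, phi 0 = 0 & forall t, `|t| <= T -> u t = expi (phi t)].
Proof.
move=> T0; have [n Hn] := uniform_step T.
(* The projection to [- T, T], which makes the lift continuous everywhere. *)
pose c t := (`|t + T| - `|t - T|) / 2.
have cc : continuous c.
  move=> t; apply: cvgM; last exact: cvg_cst.
  apply: cvgB; apply: cvg_norm; [apply: cvgD|apply: cvgB]; try exact: cvg_cst.
    exact: cvg_id.
  exact: cvg_id.
have cT t : `|t| <= T -> c t = t.
  by rewrite ler_norml => /andP[h1 h2]; rewrite /c ger0_norm ?ler0_norm; [field|lra|lra].
have cle t : `|c t| <= T.
  rewrite normrM normfV [`|2|]ger0_norm// ler_pdivrMr// (le_trans (ler_dist_dist _ _))//.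
  have -> : t + T - (t - T) = T * 2 by ring.
  by rewrite ger0_norm// mulr_ge0.
pose N : R := n.+1%:R.
have N0 : 0 < N by rewrite ltr0n.
pose z (j : nat) t : C := u (c t * (j.+1%:R / N)) * conjc (u (c t * (j%:R / N))).
have zle (j : nat) t : (j < n.+1)%N -> `|c t * (j%:R / N)| <= T.
  move=> jn; rewrite normrM -[leRHS]mulr1 ler_pM// ger0_norm ?divr_ge0 ?(ltW N0)//.
  by rewrite ler_pdivrMr// mul1r ler_nat ltnW.
have zstep (j : nat) t : (j < n.+1)%N -> 0 < Re (z j t).
  move=> jn; apply: Re_mul_conj => //; apply: Hn; first exact: zle.
  have -> : c t * (j.+1%:R / N) - c t * (j%:R / N) = c t / N.
    by rewrite -natr1; field; rewrite gt_eqF.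
  by rewrite normrM normfV (gtr0_norm N0) ler_wpM2r// invr_ge0 ltW.
have z1 j t : `|z j t| = 1 by rewrite normCM normC_conj !u1 mulr1.
have cuc (k : R) : continuous (fun t => u (c t * k)).
  move=> t; apply: (@continuous_comp _ _ _ (fun t => c t * k) u); last exact: cu.
  by apply: cvgM; [exact: cc|exact: cvg_cst].
have cz j : continuous (z j).
  move=> t; have h1 := cuc (j.+1%:R / N) t; have h2 := cuc (j%:R / N) t.
  have [r1 i1] := (cvg_Re h1, cvg_Im h1); have [r2 i2] := (cvg_Re h2, cvg_Im h2).
  apply: cvgC_ReIm.
    under eq_fun do rewrite !ReImE; rewrite !ReImE.
    by apply: cvgB; apply: cvgM => //; exact: cvgN.
  under eq_fun do rewrite !ReImE; rewrite !ReImE.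
  by apply: cvgD; apply: cvgM => //; exact: cvgN.
exists (fun t => \sum_(j < n.+1) atan2 (z j t)); split.
- move=> t; apply: cvg_big => [|j _]; first exact: add_continuous.
  apply: continuous_atan2_comp; first exact: cz.
  by rewrite gt_eqF// zstep.
- apply: big1 => j _; rewrite /z cT ?normr0// !mul0r u0 mul1r /atan2 /=.
  by rewrite oppr0 mul0r atan0.
- move=> t tT; suff H k : (k <= n.+1)%N ->
      expi (\sum_(0 <= j < k) atan2 (z j t)) = u (c t * (k%:R / N)).
    by rewrite -(big_mkord xpredT (fun j => atan2 (z j t))) H// divff ?gt_eqF// mulr1 cT.
  elim: k => [|k IH] kn; first by rewrite big_nil expi0 mul0r mulr0 u0.
  rewrite big_nat_recr//= expiD IH ?(ltnW kn)// expi_atan2 ?zstep// /z.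
  set a := u _; set b := u _.
  have : `|a| = 1 by exact: u1.
  move=> /(congr1 (fun r => r ^+ 2)); rewrite normC_sqr expr1n => ha.
  have -> : a * (b * conjc a) = (Re a ^+ 2 + Im a ^+ 2) *: b :> C.
    by apply: complex_ext; rewrite !ReImE; ring.
  by rewrite ha scale1r.
Qed.

(** By uniqueness, the lifts on two intervals agree on the smaller one. *)
Lemma global_lift : exists phi : R -> R,
  [/\ continuous phi, phi 0 = 0 & forall t, u t = expi (phi t)].
Proof.
have /choice[phi_ H] : forall n : nat, exists phi : R -> R,
    [/\ continuous phi, phi 0 = 0 & forall t, `|t| <= n%:R -> u t = expi (phi t)].
  by move=> n; exact: local_lift.
pose N t := Num.bound `|t|.
have tN t : `|t| <= (N t)%:R by exact: ltW (archi_boundP (normr_ge0 t)).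
have agree (n m : nat) t : `|t| <= n%:R -> `|t| <= m%:R -> phi_ n t = phi_ m t.
  move=> tn tm; have [cn n0 un] := H n; have [cm m0 um] := H m.
  apply: (@lift_unique u _ _ `|t|) => // s st.
    by apply: un; exact: le_trans tn.
  by apply: um; exact: le_trans tm.
exists (fun t => phi_ (N t) t); split.
- move=> t; pose m := (N t).+1.
  have [cm _ _] := H m.
  have e : \forall s \near t, phi_ m s = phi_ (N s) s.
    near=> s; apply: agree => //.
    have : `|t - s| <= 1 by near: s; apply/nbhs_ballP; exists 1 => //= y /ltW.
    move=> st; have -> : s = t - (t - s) by ring.
    by rewrite (le_trans (ler_normB _ _))// /m -natr1 lerD.
  rewrite /continuous_at -(nbhs_singleton e).
  by apply: cvg_trans (cm t); exact: near_eq_cvg.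
- by have [_ h _] := H (N 0).
- by move=> t; have [_ _ h] := H (N t); exact: h.
Unshelve. all: by end_near. Qed.

End lifting.

Section argument.
Variable f : R -> C.
Hypothesis cf : continuous f.
Hypothesis f0 : f 0 = 1.
Hypothesis fN0 : forall t, f t <> 0.

Let normf_gt0 t : 0 < `|f t|. Proof. by rewrite normr_gt0; exact/eqP. Qed.

Lemma is_Arg_unique (phi psi : R -> R) : is_Arg f phi -> is_Arg f psi -> phi = psi.
Proof.
move=> [cphi phi0 fphi] [cpsi psi0 fpsi]; apply/funext => t.
pose u s : C := `|f s|^-1 *: f s.
have E (chi : R -> R) s : f s = `|f s| *: expi (chi s) -> u s = expi (chi s).
  by move=> e; rewrite /u [X in _ *: X]e scalerA mulVf ?scale1r// gt_eqF.
apply: (@lift_unique u _ _ `|t|) => // s _; exact: E.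
Qed.

Lemma exists_Arg : exists phi, is_Arg f phi.
Proof.
pose u s : C := `|f s|^-1 *: f s.
have cu : continuous u.
  move=> t; apply: cvgZ; last exact: cf.
  by apply: cvgV; [rewrite gt_eqF|apply: cvg_norm; exact: cf].
have [||phi [cphi phi0 uphi]] := global_lift cu.
- by move=> t; rewrite /u normrZ normfV normr_id mulVf// gt_eqF.
- by rewrite /u f0 normC1 invr1 scale1r.
exists phi; split => // t; rewrite -uphi /u scalerA mulfV ?scale1r// gt_eqF//.
Qed.

Lemma ArgP : is_Arg f (Arg f).
Proof.
have [phi Hphi] := exists_Arg.
by apply: (@xgetPex _ (fun=> 0) [set phi | is_Arg f phi]); exists phi.
Qed.

Lemma Arg_eq (phi : R -> R) : is_Arg f phi -> Arg f = phi.
Proof. by move=> Hphi; exact: is_Arg_unique ArgP Hphi. Qed.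

Lemma cexp_Ln t : cexp (Ln f t) = f t.
Proof. by have [_ _ h] := ArgP; rewrite /cexp /= lnK ?posrE// -h. Qed.

Lemma Ln_eq (psi : R -> C) : continuous psi -> psi 0 = 0 ->
  (forall t, f t = cexp (psi t)) -> forall t, Ln f t = psi t.
Proof.
move=> cpsi psi0 fpsi t.
have nf s : `|f s| = expR (Re (psi s)) by rewrite fpsi normC_cexp.
have -> : Ln f t = Complex (Re (psi t)) (Arg f t) by rewrite /Ln nf expRK.
rewrite (@Arg_eq (fun s => Im (psi s))); first by case: (psi t).
split; first by move=> s; exact: (cvg_Im (cpsi s)).
- by rewrite psi0.
- by move=> s; rewrite nf fpsi.
Qed.

End argument.
End distinguished_argument.

(** * Infinitely divisible laws *)

Section infinitely_divisible_laws.
Variable R : realType.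
Local Notation C := (Rcomplex R).

Section levy_khintchine_laws.
Context d (Y : measurableType d).
Variable m : {sigma_finite_measure set Y -> \bar R}.
Variable X : Y -> R.
Hypothesis mX : measurable_fun setT X.
Hypothesis moment2 : m.-integrable setT (EFin \o (fun y => 1 + X y ^+ 2)).

(** The law with Levy measure given by a, m and X, with drift gamma and with a
    Gaussian component of variance tau^2. *)
Lemma exists_LK_distribution (tau a gamma : R) : 0 < tau -> 0 <= a ->
  exists D : distribution_function R, forall t,
    char_fun D t = gw tau t *: (cexp (a *: LKint m X t) * expi (t * gamma) : C).
Proof.
move=> tau0 a0; have H := psd_expi gamma (psd_LK tau0 a0 mX moment2).
have [mphi _ gf0] := H.
apply: (exists_distribution_char_fun tau0 mphi (M := 1)) => //.
- move=> t; rewrite normCM normC_expi mulr1 normC_cexp -[leRHS]expR0 ler_expR ReZ.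
  by rewrite mulr_ge0_le0// Re_LKint_le0.
- move=> t.
  have cL : (fun s => cexp (a *: LKint m X s)) @ t --> cexp (a *: LKint m X t).
    apply: cvg_cexp; apply: cvgZ; first exact: cvg_cst.
    exact: continuous_LKint.
  have ce : (fun s : R => expi (s * gamma)) @ t --> expi (t * gamma).
    have cg : (fun s : R => s * gamma) @ t --> t * gamma.
      by apply: cvgM; [exact: cvg_id|exact: cvg_cst].
    apply: cvgC_ReIm => /=.
      exact: (cvg_comp _ _ cg (@continuous_cos R _)).
    exact: (cvg_comp _ _ cg (@continuous_sin R _)).
  exact: (cvgC_mul cL ce).
- move=> t; rewrite LKintN// mulNr -conj_expi.
  have -> : a *: (conjc (LKint m X t) : C) = conjc (a *: LKint m X t).
    by apply: complex_ext; rewrite !ReImE //; ring.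
  by rewrite -conj_cexp; apply: complex_ext; rewrite !ReImE; ring.
- by rewrite LKint0 scaler0 cexp0 mul0r expi0 mulr1.
Qed.

Lemma convolution_power_char_fun (D : distribution_function R) (k : nat) :
  exists E : distribution_function R, convolution_power k.+1 D = E :> (R -> R) /\
    forall t, char_fun E t = char_fun D t ^+ k.+1.
Proof.
elim: k => [|k [E [eE cE]]].
  by exists D; split => // t; rewrite expr1.
have [E' [eE' cE']] := exists_convolution E D; exists E'; split.
  by rewrite eE' -eE.
by move=> t; rewrite cE' cE [RHS]exprSr.
Qed.

(** For an n-th root, a is divided by n, gamma as well, and tau by the square
    root of n. *)
Lemma infinitely_divisible_LK (D : distribution_function R) (gamma : R) :
  (forall t, char_fun D t = gw 1 t *: (cexp (LKint m X t) * expi (t * gamma) : C)) ->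
  infinitely_divisible D.
Proof.
move=> cD [//|k] _; pose N : R := k.+1%:R.
have N0 : 0 < N by rewrite ltr0n.
have tau0 : 0 < (Num.sqrt N)^-1 by rewrite invr_gt0 sqrtr_gt0.
have a0 : 0 <= N^-1 by rewrite invr_ge0 ltW.
have [Dn cDn] := exists_LK_distribution (gamma / N) tau0 a0.
exists Dn; have [E [-> cE]] := convolution_power_char_fun Dn k.
apply: char_fun_inj => t; rewrite cE cDn cD.
have gwE (tau : R) (w : C) : gw tau t *: w = cexp (Complex (- (tau * t) ^+ 2 / 2) 0) * w.
  rewrite /cexp /= expi0; apply: complex_ext; rewrite !ReImE /gw; ring.
have eE x : expi x = cexp (imag x) :> C by rewrite /cexp /= expR0 scale1r.
rewrite !gwE !eE -!cexpD -cexpMn; congr cexp.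
have N1 : N != 0 by rewrite gt_eqF.
have sN : (Num.sqrt N)^-1 ^+ 2 = N^-1 by rewrite exprVn sqr_sqrtr// ltW.
rewrite -scaler_nat -/N; apply: complex_ext; rewrite !ReImE /=.
  by rewrite exprMn sN; field.
by field.
Qed.

End levy_khintchine_laws.
End infinitely_divisible_laws.

(** * The exponent of a function of bounded variation *)

Section jordan_decomposition.
Variables (R : realType) (G : bvT R).
Local Notation C := (Rcomplex R).
Local Notation mup := (lebesgue_stieltjes_measure (pos_var G)).
Local Notation mun := (lebesgue_stieltjes_measure (neg_var G)).
Local Notation muv := (lebesgue_stieltjes_measure (var G)).

Lemma LS_itvoc (g : cumulative R R) (a b : R) : a <= b ->
  lebesgue_stieltjes_measure g `]a, b]%classic = (g b - g a)%:E.
Proof.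
move=> ab; rewrite /lebesgue_stieltjes_measure /measure_extension/=.
by rewrite measurable_mu_extE/= ?wlength_itv_bnd//; exact: is_ocitv.
Qed.

(** Half-open intervals have the same mass on both sides, and determine a
    Lebesgue-Stieltjes measure. *)
Lemma LS_var A : measurable A -> muv A = (mup A + mun A)%E.
Proof.
move=> mA; rewrite -measure_addE.
apply: lebesgue_stieltjes_measure_unique => // S [[a b]] /= _ <-.
transitivity (mup `]a, b]%classic + mun `]a, b]%classic)%E; last first.
  exact/esym/measure_addE.
have [ab|ba] := leP a b; last first.
  by rewrite set_itv_ge ?measure0 ?adde0// bnd_simp -leNgt ltW.
rewrite !LS_itvoc// -EFinD; congr (_%:E).
have E (p q r s : R) : p - q =
    (p + r) / 2 - (q + s) / 2 + ((p - r) / 2 - (q - s) / 2) by field.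
exact: E.
Qed.

Hypothesis fin2 : finite_second_moment G.

Let m2 : measurable_fun [set: measurableTypeR R] (fun x : measurableTypeR R => (1 + (x : R) ^+ 2)%:E).
Proof.
apply/measurable_EFinP; apply: measurable_to_TypeR; apply: measurable_oneDsqr.
exact: measurable_idR.
Qed.

Let d0 (x : R) : (0 <= (1 + x ^+ 2)%:E)%E.
Proof. by rewrite lee_fin ltW// oneDsqr_gt0. Qed.

Let sum_moment2 : (\int[muv]_x (1 + x ^+ 2)%:E =
  \int[mup]_x (1 + x ^+ 2)%:E + \int[mun]_x (1 + x ^+ 2)%:E)%E.
Proof.
rewrite -ge0_integral_measure_add//; apply: eq_measure_integral => A mA _.
transitivity (mup A + mun A)%E; first exact: LS_var.
exact/esym/measure_addE.
Qed.

Lemma moment2_pos : mup.-integrable setT (EFin \o (fun x : R => 1 + x ^+ 2)).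
Proof.
apply/integrableP; split; first exact: m2.
rewrite (_ : (\int[_]_x _)%E = (\int[mup]_x (1 + x ^+ 2)%:E)%E); last first.
  by apply: eq_integral => x _; rewrite /= ger0_norm// ltW// oneDsqr_gt0.
by apply: le_lt_trans fin2; rewrite sum_moment2 leeDl// integral_ge0//.
Qed.

Lemma moment2_neg : mun.-integrable setT (EFin \o (fun x : R => 1 + x ^+ 2)).
Proof.
apply/integrableP; split; first exact: m2.
rewrite (_ : (\int[_]_x _)%E = (\int[mun]_x (1 + x ^+ 2)%:E)%E); last first.
  by apply: eq_integral => x _; rewrite /= ger0_norm// ltW// oneDsqr_gt0.
by apply: le_lt_trans fin2; rewrite sum_moment2 leeDr// integral_ge0//.
Qed.

Let id_ (x : measurableTypeR R) : R := x.
Let mid : measurable_fun setT id_. Proof. exact: measurable_id_LS. Qed.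

Definition LKexponent t : C := LSintegral G (LK_integrand t).
Definition LKexponent' t : C := LKint' mup id_ t - LKint' mun id_ t.

Lemma LKexponentE t : LKexponent t = LKint mup id_ t - LKint mun id_ t.
Proof. by []. Qed.

Lemma LKint''E (g : cumulative R R) t :
  (lebesgue_stieltjes_measure g).-integrable setT (EFin \o (fun x : R => 1 + x ^+ 2)) ->
  LKint'' (lebesgue_stieltjes_measure g) id_ t =
  - cintegral (lebesgue_stieltjes_measure g) (fun x : R => (1 + x ^+ 2) *: expi (t * x)).
Proof.
move=> i2; have [mr mi] := measurableC_LK'' t.
have ir : (lebesgue_stieltjes_measure g).-integrable setT
    (EFin \o (fun x : R => Re (LK_integrand'' t x))).
  apply: (le_integrableT i2); first exact: measurable_to_TypeR mr.
  by move=> x; exact: Re_LK''_bound.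
have ii : (lebesgue_stieltjes_measure g).-integrable setT
    (EFin \o (fun x : R => Im (LK_integrand'' t x))).
  apply: (le_integrableT i2); first exact: measurable_to_TypeR mi.
  by move=> x; exact: Im_LK''_bound.
rewrite -[LHS]opprK; congr (- _); apply: complex_ext.
  rewrite ReN /= -[LHS]mulN1r -RintegralZl//; apply: eq_Rintegral => x _.
  by rewrite mulN1r opprK.
rewrite ImN /= -[LHS]mulN1r -RintegralZl//; apply: eq_Rintegral => x _.
by rewrite mulN1r opprK.
Qed.

Lemma is_derive_LKexponent (t : R) : is_derive t 1 LKexponent (LKexponent' t).
Proof.
have dp := is_derive_LKint mid moment2_pos t.
have dn := is_derive_LKint mid moment2_neg t.
by have := is_deriveB dp dn.
Qed.

Lemma is_derive_LKexponent' (t : R) : is_derive t 1 LKexponent'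
  (- LSintegral G (fun x : R => (1 + x ^+ 2) *: expi (t * x))).
Proof.
have dp := is_derive_LKint' mid moment2_pos t.
have dn := is_derive_LKint' mid moment2_neg t.
apply: (is_derive_eq (is_deriveB dp dn)).
rewrite (LKint''E t moment2_pos) (LKint''E t moment2_neg) /LSintegral.
by rewrite opprB opprK addrC.
Qed.

Lemma LKexponent0 : LKexponent 0 = 0.
Proof. by rewrite LKexponentE !LKint0// subrr. Qed.

Lemma LKexponentN t : LKexponent (- t) = conjc (LKexponent t).
Proof.
rewrite !LKexponentE (LKintN mid moment2_pos) (LKintN mid moment2_neg).
by rewrite conjCB.
Qed.

Lemma Im_LKexponent1 : Im (LKexponent 1) = 0.
Proof.
by rewrite LKexponentE ImB -[RHS](subrr 0); congr (_ - _); exact: Im_LKint1.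
Qed.

End jordan_decomposition.

(** * Functions with a given second derivative *)

Section second_derivative.
Variable R : realType.
Local Notation C := (Rcomplex R).

Lemma is_derive_has_second_derivative (g g' : R -> C) (t : R) (l : C) :
  (forall s : R, is_derive s 1 g (g' s)) -> is_derive t 1 g' l ->
  has_second_derivative g t l.
Proof.
move=> dg dg'; have e : derive1 g = g'.
  by apply/funext => s; rewrite derive1E; have [_ ->] := dg s.
have [d1 d2] := dg'; split.
- by apply: filterE => s; have [] := dg s.
- by rewrite e.
- by rewrite /derive1n /= e derive1E d2.
Qed.

Lemma has_second_derivative_is_derive (g : R -> C) (l : R -> C) :
  (forall t, has_second_derivative g t (l t)) ->
  (forall t : R, is_derive t 1 g (derive1 g t)) /\
  (forall t : R, is_derive t 1 (derive1 g) (l t)).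
Proof.
move=> H; split => t; have [d1 d2 d3] := H t.
  by split; [exact: (nbhs_singleton d1)|rewrite derive1E].
by split; [exact: d2|rewrite -derive1E; exact: d3].
Qed.

Lemma is_derive0_cst (h : R -> C) : (forall t : R, is_derive t 1 h 0) ->
  forall x y, h x = h y.
Proof.
move=> dh x y; apply: complex_ext.
  by apply: (@is_derive_0_is_cst _ (fun s => Re (h s))) => t; exact: is_derive_Re (dh t).
by apply: (@is_derive_0_is_cst _ (fun s => Im (h s))) => t; exact: is_derive_Im (dh t).
Qed.

Lemma is_derive_scale (c : C) (t : R) : is_derive t 1 (fun s : R => s *: c) c.
Proof.
by apply: is_derive_ReIm; [under [X in is_derive _ _ X _]eq_fun do rewrite ReZ
  |under [X in is_derive _ _ X _]eq_fun do rewrite ImZ]; apply: is_derive_eq;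
  rewrite /GRing.scale /=; ring.
Qed.

(** The derivative of g - h is a constant c, so the function g t - h t - t c is
    constant too. *)
Lemma second_derivative_unique (g h g' h' l : R -> C) :
  (forall t : R, is_derive t 1 g (g' t)) -> (forall t : R, is_derive t 1 h (h' t)) ->
  (forall t : R, is_derive t 1 g' (l t)) -> (forall t : R, is_derive t 1 h' (l t)) ->
  g 0 = h 0 -> exists c : C, forall t : R, g t = h t + t *: c.
Proof.
move=> dg dh dg' dh' gh0; pose c := g' 0 - h' 0.
have cE t : g' t - h' t = c.
  apply: (@is_derive0_cst (fun t => g' t - h' t)) => s.
  by have := is_deriveB (dg' s) (dh' s); rewrite subrr.
exists c => t.
have dl := is_derive_scale c.
pose r (s : R) : C := g s - h s - s *: c.
have dr (s : R) : is_derive s 1 r 0.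
  by have := is_deriveB (is_deriveB (dg s) (dh s)) (dl s); rewrite cE subrr.
have := is_derive0_cst dr t 0; rewrite /r gh0 subrr scale0r subr0.
by move/eqP; rewrite subr_eq0 subr_eq addrC => /eqP.
Qed.

End second_derivative.

(** * The representation of f *)

Section representation.
Variable R : realType.
Local Notation C := (Rcomplex R).

Lemma char_fun_hermitian (F : distribution_function R) t :
  char_fun F (- t) = conjc (char_fun F t).
Proof.
apply: complex_ext.
  by apply: eq_Rintegral => x _ /=; rewrite mulNr cosN.
have ms : measurable_fun setT (fun x : R => sin (t * x)).
  apply: (measurableC_expi _).2; apply: measurable_funM; first exact: measurable_cst.
  exact: measurable_idR.
have is_ : (lebesgue_stieltjes_measure F).-integrable setT (EFin \o (fun x => sin (t * x))).
  apply: (@bounded_integrableT _ _ _ _ _ 1); first exact: LS_finite.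
    exact: measurable_to_TypeR ms.
  by move=> x; exact: sin_max.
rewrite /= -[RHS]mulN1r -(RintegralZl (-1) measurableT is_).
by apply: eq_Rintegral => x _; rewrite mulNr sinN mulN1r.
Qed.

Lemma imagZ (t gamma : R) : imag (t * gamma) = t *: (imag gamma : C).
Proof. by apply: complex_ext; rewrite !ReImE /= ?mulr0. Qed.

Lemma LK_expE (gamma : R) (G : bvT R) t :
  LK_exp gamma G t = cexp (t *: imag gamma + LKexponent G t).
Proof. by rewrite -imagZ. Qed.

(** The characteristic functions of F1 and of F * F2, with p and n for the
    exponents of the positive and of the negative variation: the Gaussian factor g
    occurs on both sides, and n cancels. *)
Lemma LK_exp_cancel (g t gamma : R) (p n : C) :
  g *: (cexp p * expi (t * gamma)) =
  cexp (t *: imag gamma + (p - n)) * (g *: (cexp n * expi (t * 0))) :> C.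
Proof.
have scaleAr (z w : C) : z * (g *: w) = g *: (z * w).
  by apply: complex_ext; rewrite !ReImE; ring.
rewrite mulr0 expi0 mulr1 scaleAr -cexpD -addrA subrK cexpD -imagZ mulrC.
by rewrite [in RHS]/cexp /= expR0 scale1r.
Qed.

Section nonvanishing_function.
Variable f : R -> C.
Hypotheses (cf : continuous f) (f0 : f 0 = 1) (fN0 : forall t, f t <> 0).

Lemma Ln0 : Ln f 0 = 0.
Proof.
by have [_ a0 _] := ArgP cf f0 fN0; rewrite /Ln f0 -[X in `|X|]expi0 normC_expi ln1 a0.
Qed.

Variable G : bvT R.
Hypothesis G2 : finite_second_moment G.

(** The exponent is continuous and vanishes at 0, so it is Ln f by uniqueness of
    the argument. *)
Lemma LK_exp_second_derivative (gamma t : R) :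
  (forall t, f t = LK_exp gamma G t) ->
  has_second_derivative (Ln f) t
    (- LSintegral G (fun x : R => (1 + x ^+ 2) *: expi (t * x))).
Proof.
move=> fE; pose psi (t : R) : C := t *: imag gamma + LKexponent G t.
have dpsi (s : R) : is_derive s 1 psi (imag gamma + LKexponent' G s).
  by have := is_deriveD (is_derive_scale (imag gamma) s) (is_derive_LKexponent G2 s).
have -> : Ln f = psi.
  apply/funext => s; apply: (Ln_eq cf f0 fN0).
  - by move=> r; exact: is_derive_continuousC (dpsi r).
  - by rewrite /psi scale0r LKexponent0 addr0.
  - by move=> r; rewrite fE LK_expE.
have := is_deriveD (is_derive_cst (imag gamma : C) t 1) (is_derive_LKexponent' G2 t).
by rewrite add0r => d2psi; exact (is_derive_has_second_derivative dpsi d2psi).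
Qed.

Hypothesis d2f : forall t : R, has_second_derivative (Ln f) t
  (- LSintegral G (fun x : R => (1 + x ^+ 2) *: expi (t * x))).

Lemma second_derivative_LK_exp : (forall t, f (- t) = conjc (f t)) ->
  forall t, f t = LK_exp (Arg f 1) G t.
Proof.
move=> fN; have [d1 d2] := has_second_derivative_is_derive d2f.
have [|c cE] := second_derivative_unique d1 (is_derive_LKexponent G2) d2
  (is_derive_LKexponent' G2).
  by rewrite Ln0 LKexponent0.
(* |f (- 1)| = |f 1|, while the real part of the exponent is even. *)
have Rec : Re c = 0.
  have e (t : R) : ln `|f t| = Re (LKexponent G t) + t * Re c.
    by rewrite -[LHS]/(Re (Ln f t)) cE ReD ReZ.
  have := e (- 1); rewrite fN normC_conj e LKexponentN // Re_conj => h.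
  by lra.
(* The exponent is real at 1. *)
have Imc : Im c = Arg f 1.
  by rewrite -[RHS]/(Im (Ln f 1)) cE ImD ImZ mul1r Im_LKexponent1 add0r.
have cI : c = imag (Arg f 1) by apply: complex_ext.
by move=> t; rewrite LK_expE -cI addrC -cE (cexp_Ln cf f0 fN0).
Qed.

(** F1 and F2 are the laws with the exponents of the positive and of the negative
    variation of G and with a standard normal component each; the drift goes to
    F1. *)
Lemma char_fun_rational_infinitely_divisible (F : distribution_function R) :
  (forall t, f t = char_fun F t) -> rational_infinitely_divisible F.
Proof.
move=> fF; have fE : forall t, f t = LK_exp (Arg f 1) G t.
  by apply: second_derivative_LK_exp => t; rewrite !fF char_fun_hermitian.
pose id_ (x : measurableTypeR R) : R := x.
have mid : measurable_fun setT id_ by exact: measurable_id_LS.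
have [F1 F1E] := exists_LK_distribution mid (moment2_pos G2) (Arg f 1) ltr01 ler01.
have [F2 F2E] := exists_LK_distribution mid (moment2_neg G2) 0 ltr01 ler01.
exists F1, F2; split.
- apply: (infinitely_divisible_LK mid (moment2_pos G2) (gamma := Arg f 1)) => t.
  by rewrite F1E scale1r.
- apply: (infinitely_divisible_LK mid (moment2_neg G2) (gamma := 0)) => t.
  by rewrite F2E scale1r.
have [D [<- DE]] := exists_convolution F F2.
apply: char_fun_inj => t; rewrite DE F1E F2E -fF fE LK_expE LKexponentE !scale1r.
exact: LK_exp_cancel.
Qed.

End nonvanishing_function.

End representation.

Theorem theorem3 (R : realType) (f : R -> Rcomplex R)
    (f_cont : continuous f) (f0 : f 0 = 1) (f_neq0 : forall t : R, f t <> 0) :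
  (forall (gamma : R) (G : bvT R),
      (forall t : R, f t = LK_exp gamma G t) ->
      finite_second_moment G ->
      forall t : R, has_second_derivative (Ln f) t
        (- LSintegral G (fun x : R => (1 + x ^+ 2) *: expi (t * x))))
  /\
  (forall G : bvT R,
      finite_second_moment G ->
      (forall t : R, has_second_derivative (Ln f) t
        (- LSintegral G (fun x : R => (1 + x ^+ 2) *: expi (t * x)))) ->
      ((forall t : R, f (- t) = conjc (f t)) ->
       forall t : R, f t = LK_exp (Arg f 1) G t)
      /\
      (forall F : distribution_function R,
          (forall t : R, f t = char_fun F t) ->
          rational_infinitely_divisible F)).
Proof.
split=> [gamma G fE G2 t|G G2 d2f].
  exact: (LK_exp_second_derivative f_cont f0 f_neq0 G2 t fE).
split; first exact: (second_derivative_LK_exp f_cont f0 f_neq0 G2 d2f).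
exact: (char_fun_rational_infinitely_divisible f_cont f0 f_neq0 G2 d2f).
Qed.
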